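(* Let $D\subseteq\mathbb{C}$ be a domain and let $\mathcal{F}$ be a subfamily of $\mathcal{H}(D)$. Then the following hold: (a) If $J(\mathcal{F})$ is forward invariant under $\mathcal{F}$, then $J(\mathcal{F})=D$ or $\operatorname{Int}(J(\mathcal{F}))=\emptyset$. In particular, if (under this same hypothesis) $\mathbb{C}\setminus D$ contains at least two points, then $\operatorname{Int}(J(\mathcal{F}))=\emptyset$. (b) If $J(\mathcal{F})$ contains at least two points and $F(\mathcal{F})$ is forward invariant under $\mathcal{F}$, then $J(\mathcal{F})$ is a perfect set.
   Context: For a domain $D\subseteq\mathbb{C}$, $\mathcal{H}(D)$ denotes the class of all holomorphic functions on $D$. A family $\mathcal{F}\subseteq\mathcal{H}(D)$ is normal on an open set $G\subseteq D$ if every sequence in $\mathcal{F}$ contains a subsequence that converges locally uniformly on $G$, where the limit is either a holomorphic function or identically $\infty$ (locally uniform convergence to $\infty$ is allowed). $\mathcal{F}$ is normal at a point $z_0\in D$ if it is normal in some neighborhood of $z_0$ in $D$. The Fatou-like set $F(\mathcal{F})$ is the set of points of $D$ at which $\mathcal{F}$ is normal, and the Julia-like set is $J(\mathcal{F}):=D\setminus F(\mathcal{F})$. A set $A\subseteq D$ is forward invariant under $\mathcal{F}$ if $f(A)\subseteq A$ for every $f\in\mathcal{F}$. $\operatorname{Int}$ denotes the interior. A perfect set here means a set that is closed in $D$ and has no isolated points. *)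

(* Defs.v *)
From Stdlib Require Import Reals.
From Coquelicot Require Import Coquelicot.

Open Scope R_scope.

Definition has_two_points (A : C -> Prop) : Prop :=
  exists a b : C, A a /\ A b /\ a <> b.

Definition is_empty (A : C -> Prop) : Prop := forall z : C, ~ A z.

Definition same_set (A B : C -> Prop) : Prop := forall z : C, A z <-> B z.

Definition subset (A B : C -> Prop) : Prop := forall z : C, A z -> B z.

Definition interior_of (A : C -> Prop) : C -> Prop := fun z => locally z A.

Definition connected (A : C -> Prop) : Prop :=
  forall U V : C -> Prop, open U -> open V ->
    (forall z, A z -> U z \/ V z) ->
    (exists z, A z /\ U z) -> (exists z, A z /\ V z) ->
    exists z, A z /\ U z /\ V z.

Definition is_domain (D : C -> Prop) : Prop :=
  (exists z, D z) /\ open D /\ connected D.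

(* An element of H(D) is represented by a total function C -> C; its values
   outside D play no role in any of the notions below, which only evaluate the
   functions at points of D. *)
Definition holomorphic_on (f : C -> C) (D : C -> Prop) : Prop :=
  forall z, D z -> @ex_derive C_AbsRing C_NormedModule f z.

Definition family_in_H (F : (C -> C) -> Prop) (D : C -> Prop) : Prop :=
  forall f, F f -> holomorphic_on f D.

Definition cvg_loc_unif (G : C -> Prop) (u : nat -> C -> C) (g : C -> C)
  : Prop :=
  forall z, G z -> exists V : C -> Prop, locally z V /\
    forall eps : R, 0 < eps ->
      eventually (fun n => forall w, G w -> V w -> Cmod (u n w - g w) < eps).

Definition cvg_loc_unif_infty (G : C -> Prop) (u : nat -> C -> C) : Prop :=
  forall z, G z -> exists V : C -> Prop, locally z V /\
    forall M : R,
      eventually (fun n => forall w, G w -> V w -> M < Cmod (u n w)).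

Definition normal_on (F : (C -> C) -> Prop) (G : C -> Prop) : Prop :=
  forall u : nat -> C -> C, (forall n, F (u n)) ->
    exists phi : nat -> nat, (forall m n, (m < n)%nat -> (phi m < phi n)%nat) /\
      ((exists g : C -> C, holomorphic_on g G /\
          cvg_loc_unif G (fun n => u (phi n)) g)
       \/ cvg_loc_unif_infty G (fun n => u (phi n))).

Definition normal_at (D : C -> Prop) (F : (C -> C) -> Prop) (z : C) : Prop :=
  exists G : C -> Prop, open G /\ G z /\ subset G D /\ normal_on F G.

Definition Fatou (D : C -> Prop) (F : (C -> C) -> Prop) : C -> Prop :=
  fun z => D z /\ normal_at D F z.

Definition Julia (D : C -> Prop) (F : (C -> C) -> Prop) : C -> Prop :=
  fun z => D z /\ ~ Fatou D F z.

Definition forward_invariant (F : (C -> C) -> Prop) (A : C -> Prop) : Prop :=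
  forall f, F f -> forall z, A z -> A (f z).

Definition closed_in (D A : C -> Prop) : Prop :=
  exists K : C -> Prop, closed K /\ same_set A (fun z => K z /\ D z).

Definition isolated_point (A : C -> Prop) (z : C) : Prop :=
  A z /\ locally z (fun w => A w -> w = z).

(* Perfect relative to D: closedness is only required in D, and the empty set
   is allowed. *)
Definition perfect_in (D A : C -> Prop) : Prop :=
  closed_in D A /\ forall z, ~ isolated_point A z.

(* Main.v *)
Require Import Defs.
From Stdlib Require Import Reals Lra Lia Classical IndefiniteDescription.
From Coquelicot Require Import Coquelicot.

(** Everything rests on Schottky's theorem: a function omitting [a] and [b] on a disc and
    bounded by [M] at the centre is bounded on the concentric disc of half the radius by a
    constant depending only on [a], [b] and [M].  For [a = 0], [b = 1] one lifts
    [2 f - 1 = cos (PI cos G)]; the image of [G] then avoids a net of points, so Bloch's theorem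
    bounds [G'].  Moving the centre in Schottky's bound shows that when [f_n (z)] tends to
    infinity so does [f_n] uniformly near [z]; with Montel's theorem for bounded families this
    gives normality of families omitting two values, without Hurwitz's theorem.

    In (a), [F] omits on [Int J] two points of the complement of [J].  In (b), near an isolated
    point [z] of [J] the family omits two points [a], [b] of [J] off [z].  Chaining Schottky's
    bound around a small circle centred at [z], a sequence has a subsequence bounded on the
    circle, hence inside, or it tends to infinity on the circle; in the latter case each [f_n]
    omits [a] or [b] on the whole disc, so the maximum principle for [1 / (f_n - c)] shows that
    it tends to infinity inside. *)

(** One form of Goursat's theorem, in star coordinates [(x, y) |-> z + x c(y)], carries the complex
    analysis. With a closed [c] it shrinks a circle to any interior point and gives Cauchy's formula
    off the centre; with an affine [c] and [x] starting at 0 it is the triangle identity behind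
    primitives, hence behind logarithms and cosine lifts. The double cosine creates the net:
    [2 f - 1] avoids 1 and -1, so a first lift [F] exists, and it avoids all multiples of [PI]; then
    [F / PI] avoids every integer, in particular 1 and -1, so it lifts to [G], which avoids every
    point where the cosine is an integer. Such points lie within 11 of any point, whereas Bloch's
    theorem puts into the image a disc whose radius grows with the derivative. Since all bounds must
    be uniform over the family, each lift comes with an explicit bound at the centre. Compactness of
    bounded families is extracted from Taylor coefficients, which are countably many bounded
    sequences, instead of equicontinuity and a countable dense set. *)

Local Notation cderiv := (@is_derive C_AbsRing C_NormedModule).
Local Notation holo_at f z := (@ex_derive C_AbsRing C_NormedModule f z).
Local Notation rderiv := (@is_derive R_AbsRing C_R_NormedModule).
Local Notation rcont := (@continuous R_UniformSpace C_UniformSpace).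
Local Notation is_CInt := (@is_RInt C_R_NormedModule).
Local Notation ex_CInt := (@ex_RInt C_R_NormedModule).

(** * Epsilon-delta forms of limits and derivatives for complex-valued maps *)

Lemma norm_C_R (z : C) : @norm R_AbsRing C_R_NormedModule z = Cmod z.
Proof.
unfold norm; simpl; unfold prod_norm, Cmod.
unfold norm; simpl; unfold abs; simpl.
now rewrite !Rmult_1_r, <- !Rabs_mult, !Rabs_pos_eq by nra.
Qed.

(** Balls of [C_UniformSpace] come from the product structure and are squares; comparing the norm
    with the uniform structure replaces them by round discs. *)
Lemma locally_C_iff (z : C) (P : C -> Prop) :
  @locally C_UniformSpace z P <->
  exists d, 0 < d /\ forall w, Cmod (w - z) < d -> P w.
Proof.
split.
- intros H.
  destruct (@locally_norm_le_locally C_AbsRing C_NormedModule z P H) as [d Hd].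
  exists d; split; [apply cond_pos | exact Hd].
- intros [d [Hd H]].
  apply (@locally_le_locally_norm C_AbsRing C_NormedModule z P).
  exists (mkposreal d Hd); exact H.
Qed.

Lemma cderiv_iff (f : C -> C) (z l : C) :
  cderiv f z l <->
  forall eps, 0 < eps -> exists d, 0 < d /\ forall w, Cmod (w - z) < d ->
    Cmod (f w - f z - (w - z) * l) <= eps * Cmod (w - z).
Proof.
split.
- intros [_ H] eps Heps.
  destruct (H z (fun P H => H) (mkposreal eps Heps)) as [d Hd].
  exists d; split; [apply cond_pos | intros w Hw; exact (Hd w Hw)].
- intros H; split.
  + apply is_linear_scal_l.
  + intros x Hx eps.
    assert (E : z = x) by (exact (@is_filter_lim_locally_unique C_AbsRing (AbsRing_NormedModule C_AbsRing) _ _ Hx)).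
    rewrite <- E.
    destruct (H eps (cond_pos eps)) as [d [Hd H']].
    exists (mkposreal d Hd); intros w Hw; exact (H' w Hw).
Qed.

Lemma rderiv_iff (f : R -> C) (t : R) (l : C) :
  rderiv f t l <->
  forall eps, 0 < eps -> exists d, 0 < d /\ forall s, Rabs (s - t) < d ->
    Cmod (f s - f t - RtoC (s - t) * l) <= eps * Rabs (s - t).
Proof.
split.
- intros [_ H] eps Heps.
  destruct (H t (fun P H => H) (mkposreal eps Heps)) as [d Hd].
  exists d; split; [apply cond_pos | intros w Hw].
  specialize (Hd w Hw); rewrite norm_C_R in Hd.
  rewrite <- scal_R_Cmult; exact Hd.
- intros H; split.
  + apply is_linear_scal_l.
  + intros x Hx eps.
    assert (E : t = x) by (apply is_filter_lim_locally_unique; exact Hx).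
    rewrite <- E.
    destruct (H eps (cond_pos eps)) as [d [Hd H']].
    exists (mkposreal d Hd); intros w Hw.
    rewrite norm_C_R.
    generalize (H' w Hw); rewrite <- scal_R_Cmult; intros K; exact K.
Qed.

Lemma rcont_iff (f : R -> C) (t : R) :
  rcont f t <->
  forall eps, 0 < eps -> exists d, 0 < d /\ forall s, Rabs (s - t) < d ->
    Cmod (f s - f t) < eps.
Proof.
split.
- intros H eps Heps.
  destruct (H (fun w => Cmod (w - f t) < eps)) as [d Hd].
  + apply locally_C_iff; exists eps; auto.
  + exists d; split; [apply cond_pos | intros s Hs; exact (Hd s Hs)].
- intros H P HP.
  destruct (proj1 (locally_C_iff _ _) HP) as [e [He HPe]].
  destruct (H e He) as [d [Hd Hs]].
  exists (mkposreal d Hd); intros s Hs'; apply HPe, Hs, Hs'.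
Qed.

Lemma rcont_pair (f : R -> C) (t : R) :
  rcont f t <->
  continuous (fun s => Re (f s)) t /\ continuous (fun s => Im (f s)) t.
Proof.
split.
- intros H; split.
  + apply (continuous_comp f fst); [exact H | apply continuous_fst].
  + apply (continuous_comp f snd); [exact H | apply continuous_snd].
- intros [H1 H2].
  apply (continuous_ext (fun s => (Re (f s), Im (f s)))).
  { intros s; symmetry; apply surjective_pairing. }
  intros P [d Hd].
  generalize (H1 _ (locally_ball (Re (f t)) d)) (H2 _ (locally_ball (Im (f t)) d)).
  unfold filtermap; intros K1 K2.
  generalize (filter_and _ _ K1 K2); apply filter_imp.
  intros s [L1 L2]; apply Hd; split; assumption.
Qed.

Lemma rcont_const (c : C) (t : R) : rcont (fun _ => c) t.
Proof. apply continuous_const. Qed.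

Lemma rcont_RtoC (f : R -> R) (t : R) : continuous f t -> rcont (fun s => RtoC (f s)) t.
Proof. intros H; apply rcont_pair; split; [exact H | apply continuous_const]. Qed.

Lemma rcont_plus (f g : R -> C) (t : R) :
  rcont f t -> rcont g t -> rcont (fun s => f s + g s)%C t.
Proof. apply (@continuous_plus R_UniformSpace R_AbsRing C_R_NormedModule). Qed.

Lemma rcont_opp (f : R -> C) (t : R) : rcont f t -> rcont (fun s => - f s)%C t.
Proof. apply (@continuous_opp R_UniformSpace R_AbsRing C_R_NormedModule). Qed.

Lemma rcont_minus (f g : R -> C) (t : R) :
  rcont f t -> rcont g t -> rcont (fun s => f s - g s)%C t.
Proof. intros; apply rcont_plus; [assumption | now apply rcont_opp]. Qed.

Lemma rcont_mult (f g : R -> C) (t : R) :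
  rcont f t -> rcont g t -> rcont (fun s => f s * g s)%C t.
Proof.
rewrite !rcont_pair; intros [F1 F2] [G1 G2]; split; simpl.
- apply (continuous_minus (fun s => Re (f s) * Re (g s)) (fun s => Im (f s) * Im (g s)));
  now apply (continuous_mult (K := R_AbsRing)).
- apply (continuous_plus (fun s => Re (f s) * Im (g s)) (fun s => Im (f s) * Re (g s)));
  now apply (continuous_mult (K := R_AbsRing)).
Qed.

Lemma Cmod_sqr (z : C) : Cmod z * Cmod z = Re z * Re z + Im z * Im z.
Proof. generalize (Cmod2_alt z); simpl; rewrite !Rmult_1_r; tauto. Qed.

Lemma Cmod_minus_diag (z : C) : Cmod (z - z) = 0.
Proof. replace (z - z)%C with (RtoC 0) by ring; apply Cmod_0. Qed.

Lemma Cmod_minus_sym (z w : C) : Cmod (z - w) = Cmod (w - z).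
Proof. rewrite <- Cmod_opp; f_equal; ring. Qed.

Lemma Cmod_triangle_rev (z w : C) : Cmod z - Cmod w <= Cmod (z - w).
Proof.
generalize (Cmod_triangle (z - w) w).
replace (z - w + w)%C with z by ring; lra.
Qed.

Lemma Cmod_triangle_minus (z w : C) : Cmod (z - w) <= Cmod z + Cmod w.
Proof.
generalize (Cmod_triangle z (- w)); rewrite Cmod_opp; tauto.
Qed.

Lemma rcont_inv (f : R -> C) (t : R) :
  rcont f t -> f t <> 0 -> rcont (fun s => / f s)%C t.
Proof.
rewrite !rcont_pair; intros [F1 F2] Hn.
assert (P : Re (f t) * Re (f t) + Im (f t) * Im (f t) <> 0).
{ rewrite <- Cmod_sqr; generalize (proj1 (Cmod_gt_0 _) Hn); nra. }
assert (D : continuous (fun s => / (Re (f s) * Re (f s) + Im (f s) * Im (f s))) t).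
{ apply (continuous_comp (fun s => Re (f s) * Re (f s) + Im (f s) * Im (f s)) Rinv).
  - apply (continuous_plus (fun s => Re (f s) * Re (f s)) (fun s => Im (f s) * Im (f s)));
    now apply (continuous_mult (K := R_AbsRing)).
  - now apply continuous_Rinv. }
split; simpl; unfold Rdiv.
- apply (continuous_ext (fun s => Re (f s) * / (Re (f s) * Re (f s) + Im (f s) * Im (f s)))).
  { intros s; unfold Re, Im; now rewrite !Rmult_1_r. }
  now apply (continuous_mult (K := R_AbsRing)).
- apply (continuous_ext (fun s => - Im (f s) * / (Re (f s) * Re (f s) + Im (f s) * Im (f s)))).
  { intros s; unfold Re, Im; now rewrite !Rmult_1_r. }
  apply (continuous_mult (K := R_AbsRing)); [|exact D].
  now apply (continuous_opp (V := R_NormedModule)).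
Qed.

Lemma rcont_Cmod (f : R -> C) (t : R) : rcont f t -> continuous (fun s => Cmod (f s)) t.
Proof.
intros H P [d Hd].
destruct (proj1 (rcont_iff f t) H d (cond_pos d)) as [e [He K]].
exists (mkposreal e He); intros s Hs; apply Hd.
specialize (K s Hs).
change (Rabs (Cmod (f s) - Cmod (f t)) < d).
apply Rabs_def1.
- generalize (Cmod_triangle_rev (f s) (f t)); lra.
- generalize (Cmod_triangle_rev (f t) (f s)); rewrite Cmod_minus_sym; lra.
Qed.

Lemma cderiv_cont (f : C -> C) (z l : C) : cderiv f z l ->
  forall eps, 0 < eps -> exists d, 0 < d /\ forall w, Cmod (w - z) < d -> Cmod (f w - f z) < eps.
Proof.
intros H eps Heps.
destruct (proj1 (cderiv_iff f z l) H 1 Rlt_0_1) as [d [Hd K]].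
set (m := Cmod l); assert (Hm : 0 <= m) by apply Cmod_ge_0.
exists (Rmin d (eps / (2 + m))); split.
- apply Rmin_glb_lt; [exact Hd | apply Rdiv_lt_0_compat; lra].
- intros w Hw.
  assert (Hw1 : Cmod (w - z) < d) by (eapply Rlt_le_trans; [exact Hw | apply Rmin_l]).
  assert (Hw2 : Cmod (w - z) < eps / (2 + m)) by (eapply Rlt_le_trans; [exact Hw | apply Rmin_r]).
  specialize (K w Hw1).
  apply Rmult_lt_compat_r with (r := 2 + m) in Hw2; [|lra].
  unfold Rdiv in Hw2; rewrite Rmult_assoc, Rinv_l in Hw2 by lra.
  generalize (Cmod_triangle (f w - f z - (w - z) * l) ((w - z) * l)).
  rewrite Cmod_mult; fold m.
  replace (f w - f z - (w - z) * l + (w - z) * l)%C with (f w - f z)%C by ring.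
  generalize (Cmod_ge_0 (w - z)); nra.
Qed.

Lemma rcont_comp_holo (f : C -> C) (c : R -> C) (t : R) :
  @ex_derive C_AbsRing C_NormedModule f (c t) -> rcont c t -> rcont (fun s => f (c s)) t.
Proof.
intros [l Hl] Hc; apply rcont_iff; intros eps Heps.
destruct (cderiv_cont f _ l Hl eps Heps) as [d [Hd K]].
destruct (proj1 (rcont_iff c t) Hc d Hd) as [e [He L]].
exists e; split; [exact He | intros s Hs; apply K, L, Hs].
Qed.

Lemma rderiv_rcont (c : R -> C) (t : R) (l : C) : rderiv c t l -> rcont c t.
Proof.
intros H; apply (@ex_derive_continuous R_AbsRing C_R_NormedModule); now exists l.
Qed.

Lemma cderiv_ext (f : C -> C) (z l l' : C) : cderiv f z l -> l = l' -> cderiv f z l'.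
Proof. now intros H <-. Qed.

Lemma cderiv_ext_loc (f g : C -> C) (z l : C) (d : R) :
  0 < d -> (forall w, Cmod (w - z) < d -> f w = g w) -> cderiv f z l -> cderiv g z l.
Proof.
intros Hd E H; apply cderiv_iff; intros eps Heps.
destruct (proj1 (cderiv_iff f z l) H eps Heps) as [d' [Hd' K]].
exists (Rmin d d'); split; [now apply Rmin_glb_lt|].
intros w Hw; rewrite <- !E.
- apply K; eapply Rlt_le_trans; [exact Hw | apply Rmin_r].
- now rewrite Cmod_minus_diag.
- eapply Rlt_le_trans; [exact Hw | apply Rmin_l].
Qed.

Lemma cderiv_const (c z : C) : cderiv (fun _ => c) z (RtoC 0).
Proof. apply (@is_derive_const C_AbsRing C_NormedModule). Qed.

Lemma cderiv_id (z : C) : cderiv (fun w => w) z (RtoC 1).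
Proof.
apply cderiv_iff; intros eps Heps; exists 1; split; [lra | intros w _].
replace (w - z - (w - z) * 1)%C with (RtoC 0) by ring.
rewrite Cmod_0; generalize (Cmod_ge_0 (w - z)); nra.
Qed.

Lemma cderiv_plus (f g : C -> C) (z a b : C) :
  cderiv f z a -> cderiv g z b -> cderiv (fun w => f w + g w)%C z (a + b)%C.
Proof. apply (@is_derive_plus C_AbsRing C_NormedModule). Qed.

Lemma cderiv_minus (f g : C -> C) (z a b : C) :
  cderiv f z a -> cderiv g z b -> cderiv (fun w => f w - g w)%C z (a - b)%C.
Proof. apply (@is_derive_minus C_AbsRing C_NormedModule). Qed.

(** The library's product rule, and the inner function of its chain rule, live over
    [AbsRing_NormedModule C_AbsRing], not over [C_NormedModule]. The limit conditions are
    convertible, so only linearity is proved afresh. *)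
Lemma cderiv_AbsRing (f : C -> C) (z l : C) :
  cderiv f z l <-> @is_derive C_AbsRing (AbsRing_NormedModule C_AbsRing) f z l.
Proof.
split; intros [_ H]; (split; [apply is_linear_scal_l | exact H]).
Qed.

Lemma cderiv_mult (f g : C -> C) (z a b : C) :
  cderiv f z a -> cderiv g z b ->
  cderiv (fun w => f w * g w)%C z (a * g z + f z * b)%C.
Proof.
rewrite !cderiv_AbsRing; intros Hf Hg.
exact (@is_derive_mult C_AbsRing f g z a b Hf Hg Cmult_comm).
Qed.

Lemma cderiv_comp (f g : C -> C) (z a b : C) :
  cderiv f (g z) a -> cderiv g z b -> cderiv (fun w => f (g w)) z (b * a)%C.
Proof. 
rewrite (cderiv_AbsRing g); intros Hf Hg.
exact (@is_derive_comp C_AbsRing C_NormedModule f g z a b Hf Hg). Qed.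

Lemma cderiv_scal (k : C) (f : C -> C) (z a : C) :
  cderiv f z a -> cderiv (fun w => k * f w)%C z (k * a)%C.
Proof.
intros H; eapply cderiv_ext; [apply cderiv_mult; [apply cderiv_const | exact H] | cbv beta; ring].
Qed.

Lemma cderiv_Cinv (z : C) : z <> 0 -> cderiv Cinv z (- / (z * z))%C.
Proof.
intros Hz; apply cderiv_iff; intros eps Heps.
set (m := Cmod z); assert (Hm : 0 < m) by now apply Cmod_gt_0.
exists (Rmin (m / 2) (eps * (m * m * m) / 2)); split.
{ apply Rmin_glb_lt; [lra|].
  apply Rdiv_lt_0_compat; [|lra]; repeat apply Rmult_lt_0_compat; lra. }
intros w Hw.
assert (Hw1 : Cmod (w - z) < m / 2) by (eapply Rlt_le_trans; [exact Hw | apply Rmin_l]).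
assert (Hw2 : Cmod (w - z) < eps * (m * m * m) / 2) by (eapply Rlt_le_trans; [exact Hw | apply Rmin_r]).
assert (Hwm : m / 2 <= Cmod w).
{ generalize (Cmod_triangle_rev z w); rewrite Cmod_minus_sym; fold m; lra. }
assert (Hw0 : w <> 0) by (apply Cmod_gt_0; lra).
replace (/ w - / z - (w - z) * - / (z * z))%C
  with ((w - z) * (w - z) * (/ z * / z * / w))%C by (field; tauto).
rewrite !Cmod_mult, !Cmod_inv by assumption; fold m.
assert (I : / Cmod w <= 2 / m).
{ replace (2 / m) with (/ (m / 2)) by (field; lra); apply Rinv_le_contravar; lra. }
assert (J : Cmod (w - z) * (/ m * / m * / Cmod w) <= eps).
{ apply Rle_trans with ((eps * (m * m * m) / 2) * (/ m * / m * (2 / m))).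
  - assert (0 < / m) by now apply Rinv_0_lt_compat.
    assert (0 < / Cmod w) by (apply Rinv_0_lt_compat; lra).
    apply Rmult_le_compat; [apply Cmod_ge_0 | | lra |].
    + repeat apply Rmult_le_pos; lra.
    + apply Rmult_le_compat_l; [nra | exact I].
  - right; field; lra. }
generalize (Cmod_ge_0 (w - z)); nra.
Qed.

Lemma cderiv_inv (f : C -> C) (z a : C) :
  cderiv f z a -> f z <> 0 -> cderiv (fun w => / f w)%C z (- a / (f z * f z))%C.
Proof.
intros H Hz; eapply cderiv_ext.
- apply (cderiv_comp Cinv f); [now apply cderiv_Cinv | exact H].
- unfold Cdiv; ring.
Qed.

Lemma rderiv_comp (f : C -> C) (c : R -> C) (t : R) (a b : C) :
  cderiv f (c t) a -> rderiv c t b -> rderiv (fun s => f (c s)) t (a * b)%C.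
Proof.
intros Hf Hc; apply rderiv_iff; intros eps Heps.
set (m := Cmod a); assert (Hm : 0 <= m) by apply Cmod_ge_0.
set (n := Cmod b); assert (Hn : 0 <= n) by apply Cmod_ge_0.
assert (He1 : 0 < eps / (2 * (n + 1))) by (apply Rdiv_lt_0_compat; lra).
destruct (proj1 (cderiv_iff f _ a) Hf _ He1) as [d [Hd K]].
assert (He2 : 0 < Rmin 1 (eps / (2 * (m + 1)))).
{ apply Rmin_glb_lt; [lra | apply Rdiv_lt_0_compat; lra]. }
destruct (proj1 (rderiv_iff c t b) Hc _ He2) as [d1 [Hd1 L]].
destruct (proj1 (rcont_iff c t) (rderiv_rcont c t b Hc) d Hd) as [d2 [Hd2 M]].
exists (Rmin d1 d2); split; [now apply Rmin_glb_lt|].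
intros s Hs.
assert (Hs1 : Rabs (s - t) < d1) by (eapply Rlt_le_trans; [exact Hs | apply Rmin_l]).
assert (Hs2 : Rabs (s - t) < d2) by (eapply Rlt_le_trans; [exact Hs | apply Rmin_r]).
specialize (L s Hs1); specialize (K _ (M s Hs2)).
set (x := Rabs (s - t)) in *; assert (Hx : 0 <= x) by apply Rabs_pos.
assert (La : Cmod (c s - c t - RtoC (s - t) * b) <= 1 * x).
{ eapply Rle_trans; [exact L|]; apply Rmult_le_compat_r; [exact Hx | apply Rmin_l]. }
assert (Lb : Cmod (c s - c t - RtoC (s - t) * b) <= eps / (2 * (m + 1)) * x).
{ eapply Rle_trans; [exact L|]; apply Rmult_le_compat_r; [exact Hx | apply Rmin_r]. }
assert (N : Cmod (c s - c t) <= (n + 1) * x).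
{ generalize (Cmod_triangle (c s - c t - RtoC (s - t) * b) (RtoC (s - t) * b)).
  rewrite (Cmod_mult (RtoC (s - t))), Cmod_R; fold x n.
  replace (c s - c t - RtoC (s - t) * b + RtoC (s - t) * b)%C with (c s - c t)%C by ring.
  lra. }
replace (f (c s) - f (c t) - RtoC (s - t) * (a * b))%C
  with ((f (c s) - f (c t) - (c s - c t) * a) + (c s - c t - RtoC (s - t) * b) * a)%C by ring.
eapply Rle_trans; [apply Cmod_triangle|].
rewrite (Cmod_mult _ a); fold m.
assert (X1 : Cmod (f (c s) - f (c t) - (c s - c t) * a) <= eps / 2 * x).
{ eapply Rle_trans; [exact K|].
  apply Rle_trans with (eps / (2 * (n + 1)) * ((n + 1) * x)).
  - apply Rmult_le_compat_l; lra.
  - right; field; lra. }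
assert (X2 : Cmod (c s - c t - RtoC (s - t) * b) * m <= eps / 2 * x).
{ apply Rle_trans with (eps / (2 * (m + 1)) * x * (m + 1)).
  - apply Rmult_le_compat; [apply Cmod_ge_0 | exact Hm | exact Lb | lra].
  - right; field; lra. }
lra.
Qed.

Lemma Cmod_le_Re_Im (w : C) : Cmod w <= Rabs (Re w) + Rabs (Im w).
Proof.
apply Rsqr_incr_0_var; [unfold Rsqr; rewrite Cmod_sqr|].
- rewrite <- (Rabs_pos_eq (Re w * Re w)), <- (Rabs_pos_eq (Im w * Im w)) by nra.
  rewrite !Rabs_mult.
  generalize (Rabs_pos (Re w)) (Rabs_pos (Im w)); nra.
- generalize (Rabs_pos (Re w)) (Rabs_pos (Im w)); lra.
Qed.

Lemma rderiv_pair (c : R -> C) (t : R) (l : C) :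
  is_derive (fun s => Re (c s)) t (Re l) -> is_derive (fun s => Im (c s)) t (Im l) ->
  rderiv c t l.
Proof.
intros H1 H2; apply rderiv_iff; intros eps Heps.
assert (He : 0 < eps / 2) by lra.
destruct H1 as [_ H1], H2 as [_ H2].
destruct (H1 t (fun P H => H) (mkposreal _ He)) as [d1 K1].
destruct (H2 t (fun P H => H) (mkposreal _ He)) as [d2 K2].
exists (Rmin d1 d2); split; [apply Rmin_glb_lt; apply cond_pos|].
intros s Hs.
specialize (K1 s (Rlt_le_trans _ _ _ Hs (Rmin_l _ _))).
specialize (K2 s (Rlt_le_trans _ _ _ Hs (Rmin_r _ _))).
change (Rabs (Re (c s) - Re (c t) - (s - t) * Re l) <= eps / 2 * Rabs (s - t)) in K1.
change (Rabs (Im (c s) - Im (c t) - (s - t) * Im l) <= eps / 2 * Rabs (s - t)) in K2.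
set (w := (c s - c t - RtoC (s - t) * l)%C).
replace (Re (c s) - Re (c t) - (s - t) * Re l) with (Re w) in K1
  by (unfold w; simpl; unfold Re, Im; ring).
replace (Im (c s) - Im (c t) - (s - t) * Im l) with (Im w) in K2
  by (unfold w; simpl; unfold Re, Im; ring).
generalize (Cmod_le_Re_Im w); lra.
Qed.

(** * Integrals of complex-valued functions and the mean value inequality *)

Lemma is_CInt_pair (f : R -> C) (a b : R) (l : C) :
  is_CInt f a b l <->
  is_RInt (fun s => Re (f s)) a b (Re l) /\ is_RInt (fun s => Im (f s)) a b (Im l).
Proof.
split.
- intros H; split.
  + apply (@is_RInt_fct_extend_fst R_NormedModule R_NormedModule f a b l H).
  + apply (@is_RInt_fct_extend_snd R_NormedModule R_NormedModule f a b l H).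
- intros [H1 H2].
  rewrite (surjective_pairing l).
  apply (@is_RInt_fct_extend_pair R_NormedModule R_NormedModule f a b _ _ H1 H2).
Qed.

Lemma ex_CInt_cont (f : R -> C) (a b : R) :
  a <= b -> (forall x, a <= x <= b -> rcont f x) -> ex_CInt f a b.
Proof.
intros Hab H; apply (@ex_RInt_continuous C_R_CompleteNormedModule).
rewrite Rmin_left, Rmax_right by exact Hab; exact H.
Qed.

Definition CInt (f : R -> C) (a b : R) : C := @RInt C_R_CompleteNormedModule f a b.

Lemma is_CInt_unique (f : R -> C) (a b : R) (l : C) : is_CInt f a b l -> CInt f a b = l.
Proof. apply (@is_RInt_unique C_R_CompleteNormedModule). Qed.

Lemma CInt_correct (f : R -> C) (a b : R) : ex_CInt f a b -> is_CInt f a b (CInt f a b).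
Proof. apply (@RInt_correct C_R_CompleteNormedModule). Qed.

Lemma is_CInt_scal (k : C) (f : R -> C) (a b : R) (l : C) :
  is_CInt f a b l -> is_CInt (fun s => k * f s)%C a b (k * l)%C.
Proof.
rewrite !is_CInt_pair; intros [H1 H2]; split; simpl.
- apply (@is_RInt_minus R_NormedModule); apply (@is_RInt_scal R_NormedModule); assumption.
- apply (@is_RInt_plus R_NormedModule); apply (@is_RInt_scal R_NormedModule); assumption.
Qed.

Lemma CInt_scal (k : C) (f : R -> C) (a b : R) :
  ex_CInt f a b -> CInt (fun s => k * f s)%C a b = (k * CInt f a b)%C.
Proof. intros H; now apply is_CInt_unique, is_CInt_scal, CInt_correct. Qed.

Lemma ex_CInt_scal (k : C) (f : R -> C) (a b : R) :
  ex_CInt f a b -> ex_CInt (fun s => k * f s)%C a b.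
Proof. intros H; eexists; now apply is_CInt_scal, CInt_correct. Qed.

Lemma CInt_plus (f g : R -> C) (a b : R) : ex_CInt f a b -> ex_CInt g a b ->
  CInt (fun s => f s + g s)%C a b = (CInt f a b + CInt g a b)%C.
Proof. apply (@RInt_plus C_R_CompleteNormedModule). Qed.

Lemma CInt_minus (f g : R -> C) (a b : R) : ex_CInt f a b -> ex_CInt g a b ->
  CInt (fun s => f s - g s)%C a b = (CInt f a b - CInt g a b)%C.
Proof. apply (@RInt_minus C_R_CompleteNormedModule). Qed.

Lemma CInt_ext (f g : R -> C) (a b : R) : a <= b ->
  (forall x, a <= x <= b -> f x = g x) -> CInt f a b = CInt g a b.
Proof.
intros Hab H; apply (@RInt_ext C_R_CompleteNormedModule).
rewrite Rmin_left, Rmax_right by exact Hab; intros x Hx; apply H; lra.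
Qed.

Lemma CInt_Chasles (f : R -> C) (a b c : R) : ex_CInt f a b -> ex_CInt f b c ->
  CInt f a c = (CInt f a b + CInt f b c)%C.
Proof. intros H1 H2; symmetry; now apply (@RInt_Chasles C_R_CompleteNormedModule). Qed.

Lemma CInt_const (k : C) (a b : R) : CInt (fun _ => k) a b = (RtoC (b - a) * k)%C.
Proof.
rewrite <- scal_R_Cmult; apply (@RInt_const C_R_CompleteNormedModule).
Qed.

Lemma CInt_bound (f : R -> C) (a b M : R) : a <= b -> ex_CInt f a b ->
  (forall x, a <= x <= b -> Cmod (f x) <= M) -> Cmod (CInt f a b) <= (b - a) * M.
Proof.
intros Hab Hex H; rewrite <- norm_C_R.
apply (@norm_RInt_le_const C_R_NormedModule f a b); [exact Hab | | now apply CInt_correct].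
intros x Hx; rewrite norm_C_R; now apply H.
Qed.

Lemma CInt_derive (c c' : R -> C) (a b : R) : a <= b ->
  (forall x, a <= x <= b -> rderiv c x (c' x)) ->
  (forall x, a <= x <= b -> rcont c' x) -> CInt c' a b = (c b - c a)%C.
Proof.
intros Hab H1 H2; apply is_CInt_unique.
apply (@is_RInt_derive C_R_CompleteNormedModule c c' a b);
rewrite Rmin_left, Rmax_right by exact Hab; assumption.
Qed.

Lemma rderiv_Re (c : R -> C) (t : R) (l : C) :
  rderiv c t l -> is_derive (fun s => Re (c s)) t (Re l).
Proof.
intros H; split; [apply is_linear_scal_l|].
intros x Hx eps.
assert (E : t = x) by (apply is_filter_lim_locally_unique; exact Hx).
rewrite <- E.
destruct (proj1 (rderiv_iff c t l) H eps (cond_pos eps)) as [d [Hd K]].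
exists (mkposreal d Hd); intros s Hs.
change (Rabs (Re (c s) - Re (c t) - (s - t) * Re l) <= eps * Rabs (s - t)).
eapply Rle_trans; [|exact (K s Hs)].
eapply Rle_trans; [|apply re_le_Cmod].
right; f_equal; simpl; unfold Re, Im; ring.
Qed.

(** Pairing with the conjugate of the increment [d] reduces the claim to the real mean value
    theorem: [Re (Cconj d * c)] increases by [|d| ^ 2], and its derivative is at most [|d| * M]. *)
Lemma mean_value_ineq (c c' : R -> C) (a b M : R) : a <= b ->
  (forall x, a <= x <= b -> rderiv c x (c' x)) ->
  (forall x, a <= x <= b -> Cmod (c' x) <= M) -> Cmod (c b - c a) <= M * (b - a).
Proof.
intros Hab H HM.
set (d := (c b - c a)%C).
destruct (Req_dec (Cmod d) 0) as [E | E].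
{ rewrite E; apply Rmult_le_pos; [|lra].
  eapply Rle_trans; [apply Cmod_ge_0 | apply (HM a); lra]. }
assert (Hd : 0 < Cmod d) by (generalize (Cmod_ge_0 d); lra).
assert (K : forall x, a <= x <= b ->
  is_derive (fun s => Re (Cconj d * c s)) x (Re (Cconj d * c' x))).
{ intros x Hx; apply (rderiv_Re (fun s => Cconj d * c s)%C).
  apply (rderiv_comp (fun w => Cconj d * w)%C c x (Cconj d)).
  - eapply cderiv_ext; [apply cderiv_scal, cderiv_id | ring].
  - apply H; lra. }
destruct (MVT_gen (fun s => Re (Cconj d * c s)) a b (fun s => Re (Cconj d * c' s)))
  as [x [Hx Ex]]; rewrite ?Rmin_left, ?Rmax_right in * by exact Hab.
- intros x Hx; apply K; lra.
- intros x Hx; apply continuity_pt_filterlim.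
  apply (ex_derive_continuous (fun s => Re (Cconj d * c s))).
  eexists; apply K; lra.
- assert (S : Re (Cconj d * c b) - Re (Cconj d * c a) = Cmod d * Cmod d).
  { rewrite Cmod_sqr; unfold d; simpl; unfold Re, Im; simpl; ring. }
  rewrite S in Ex.
  assert (T : Re (Cconj d * c' x) <= Cmod d * M).
  { eapply Rle_trans; [apply Rle_abs|].
    eapply Rle_trans; [apply re_le_Cmod|].
    rewrite Cmod_mult, Cmod_conj.
    apply Rmult_le_compat_l; [lra | now apply HM]. }
  apply Rmult_le_reg_l with (Cmod d); [exact Hd|].
  rewrite Ex; nra.
Qed.

(** * Goursat's theorem *)

Lemma nested_intervals (s h : nat -> R) :
  (forall n, 0 <= h n) -> (forall n, s n <= s (S n)) ->
  (forall n, s (S n) + h (S n) <= s n + h n) ->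
  exists x, forall n, s n <= x <= s n + h n.
Proof.
intros H0 H1 H2.
assert (I : forall n k, s n <= s (n + k)%nat).
{ intros n k; induction k as [|k IH]; [rewrite Nat.add_0_r; lra|].
  rewrite Nat.add_succ_r; specialize (H1 (n + k)%nat); lra. }
assert (J : forall n k, s (n + k)%nat + h (n + k)%nat <= s n + h n).
{ intros n k; induction k as [|k IH]; [rewrite Nat.add_0_r; lra|].
  rewrite Nat.add_succ_r; specialize (H2 (n + k)%nat); lra. }
assert (B : forall m n, s m <= s n + h n).
{ intros m n.
  generalize (I m n) (J n m) (H0 (m + n)%nat); rewrite (Nat.add_comm n m); lra. }
destruct (completeness (fun x => exists n, x = s n)) as [x [Ux Lx]].
- exists (s O + h O); intros y [n ->]; apply B.
- exists (s O), O; reflexivity.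
- exists x; intros n; split.
  + apply Ux; now exists n.
  + apply Lx; intros y [m ->]; apply B.
Qed.

(* Repeated bisection: a quarter of a rectangle carries at least a quarter of [I],
   while the density hypothesis makes [I] negligible with respect to the area. *)
Lemma rectangle_additive_zero (I : R -> R -> R -> R -> C) (a a' b b' : R) :
  a <= a' -> b <= b' ->
  (forall s m s' t t', a <= s <= m -> m <= s' <= a' -> b <= t <= t' -> t' <= b' ->
    I s s' t t' = (I s m t t' + I m s' t t')%C) ->
  (forall s s' t m t', a <= s <= s' -> s' <= a' -> b <= t <= m -> m <= t' <= b' ->
    I s s' t t' = (I s s' t m + I s s' m t')%C) ->
  (forall x y, a <= x <= a' -> b <= y <= b' -> forall eps, 0 < eps ->
    exists d, 0 < d /\ forall s s' t t', a <= s <= x -> x <= s' <= a' ->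
      b <= t <= y -> y <= t' <= b' -> s' - s < d -> t' - t < d ->
      Cmod (I s s' t t') <= eps * ((s' - s + (t' - t)) * (s' - s + (t' - t)))) ->
  I a a' b b' = 0.
Proof.
intros Ha Hb Hs Ht Hd.
set (h := a' - a); set (k := b' - b).
(* [cut] keeps the first half when it carries at least half of the modulus; otherwise additivity
   forces the second half to do so. Each step halves once in each direction, so four times the new
   modulus dominates the old one. *)
pose (cut := fun (u v : C) (p q : R) =>
  if Rle_dec (Cmod u) (2 * Cmod v) then p else q).
pose (step := fun (P : R * R) (n : nat) =>
  let s := fst P in let t := snd P in
  let s1 := cut (I s (s + h / 2 ^ n) t (t + k / 2 ^ n))
                (I s (s + h / 2 ^ S n) t (t + k / 2 ^ n)) s (s + h / 2 ^ S n) in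
  let t1 := cut (I s1 (s1 + h / 2 ^ S n) t (t + k / 2 ^ n))
                (I s1 (s1 + h / 2 ^ S n) t (t + k / 2 ^ S n)) t (t + k / 2 ^ S n) in
  (s1, t1)).
pose (P := fix P n := match n with O => (a, b) | S m => step (P m) m end).
pose (s := fun n => fst (P n)); pose (t := fun n => snd (P n)).
pose (V := fun n => Cmod (I (s n) (s n + h / 2 ^ n) (t n) (t n + k / 2 ^ n))).
assert (Hh : 0 <= h) by (unfold h; lra).
assert (Hk : 0 <= k) by (unfold k; lra).
assert (E2 : forall x n, x / 2 ^ n = 2 * (x / 2 ^ S n)).
{ intros x n; simpl; field; apply pow_nonzero; lra. }
assert (Pp : forall x n, 0 <= x -> 0 <= x / 2 ^ n).
{ intros x n Hx; apply Rmult_le_pos; [exact Hx|].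
  left; apply Rinv_0_lt_compat, pow_lt; lra. }
assert (Es : forall n, s (S n) = cut (I (s n) (s n + h / 2 ^ n) (t n) (t n + k / 2 ^ n))
  (I (s n) (s n + h / 2 ^ S n) (t n) (t n + k / 2 ^ n)) (s n) (s n + h / 2 ^ S n))
  by reflexivity.
assert (Et : forall n, t (S n) =
  cut (I (s (S n)) (s (S n) + h / 2 ^ S n) (t n) (t n + k / 2 ^ n))
      (I (s (S n)) (s (S n) + h / 2 ^ S n) (t n) (t n + k / 2 ^ S n))
      (t n) (t n + k / 2 ^ S n)) by reflexivity.
assert (HC : forall u v p q, (Cmod u <= 2 * Cmod v /\ cut u v p q = p) \/
                             (2 * Cmod v < Cmod u /\ cut u v p q = q)).
{ intros u v p q; unfold cut; destruct (Rle_dec _ _); [left | right]; split; lra. }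
clearbody cut.
assert (HA : forall n, (s n <= s (S n) /\ s (S n) + h / 2 ^ S n <= s n + h / 2 ^ n /\
                       t n <= t (S n) /\ t (S n) + k / 2 ^ S n <= t n + k / 2 ^ n)).
{ intros n.
  generalize (E2 h n) (E2 k n) (Pp h (S n) Hh) (Pp k (S n) Hk); intros e1 e2 e3 e4.
  assert (As : s (S n) = s n \/ s (S n) = s n + h / 2 ^ S n).
  { rewrite Es; edestruct HC as [[_ ->] | [_ ->]]; tauto. }
  assert (At : t (S n) = t n \/ t (S n) = t n + k / 2 ^ S n).
  { rewrite Et; edestruct HC as [[_ ->] | [_ ->]]; tauto. }
  destruct As as [As | As], At as [At | At]; rewrite As, At; lra. }
assert (HB : forall n, a <= s n /\ s n + h / 2 ^ n <= a' /\ b <= t n /\ t n + k / 2 ^ n <= b').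
{ induction n as [|n IH].
  - unfold s, t, h, k; simpl; repeat split; lra.
  - generalize (HA n); lra. }
assert (HV : forall n, V n <= 4 * V (S n)).
{ intros n.
  destruct (HB n) as [B1 [B2 [B3 B4]]].
  generalize (E2 h n) (E2 k n) (Pp h (S n) Hh) (Pp k (S n) Hk); intros e1 e2 e3 e4.
  set (s1 := s (S n)).
  assert (X : V n <= 2 * Cmod (I s1 (s1 + h / 2 ^ S n) (t n) (t n + k / 2 ^ n))
              /\ a <= s1 /\ s1 + h / 2 ^ S n <= a').
  { unfold s1; rewrite Es.
    edestruct HC as [[L E] | [L E]]; rewrite E; clear E; [split; [exact L | lra]|].
    split; [|lra].
    unfold V.
    assert (Hsum : I (s n) (s n + h / 2 ^ n) (t n) (t n + k / 2 ^ n) =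
      Cplus (I (s n) (s n + h / 2 ^ S n) (t n) (t n + k / 2 ^ n))
       (I (s n + h / 2 ^ S n) (s n + h / 2 ^ S n + h / 2 ^ S n) (t n) (t n + k / 2 ^ n))).
    { replace (s n + h / 2 ^ S n + h / 2 ^ S n) with (s n + h / 2 ^ n) by lra.
      apply Hs; lra. }
    generalize (Cmod_triangle
       (I (s n) (s n + h / 2 ^ S n) (t n) (t n + k / 2 ^ n))
       (I (s n + h / 2 ^ S n) (s n + h / 2 ^ S n + h / 2 ^ S n) (t n) (t n + k / 2 ^ n))).
    rewrite <- Hsum; lra. }
  destruct X as [X [X1 X2]].
  enough (Y : Cmod (I s1 (s1 + h / 2 ^ S n) (t n) (t n + k / 2 ^ n)) <= 2 * V (S n)) by lra.
  unfold V; fold s1.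
  rewrite Et; fold s1.
  edestruct HC as [[L E] | [L E]]; rewrite E; clear E; [exact L|].
  assert (Hsum : I s1 (s1 + h / 2 ^ S n) (t n) (t n + k / 2 ^ n) =
    Cplus (I s1 (s1 + h / 2 ^ S n) (t n) (t n + k / 2 ^ S n))
     (I s1 (s1 + h / 2 ^ S n) (t n + k / 2 ^ S n) (t n + k / 2 ^ S n + k / 2 ^ S n))).
  { replace (t n + k / 2 ^ S n + k / 2 ^ S n) with (t n + k / 2 ^ n) by lra.
    apply Ht; lra. }
  generalize (Cmod_triangle
     (I s1 (s1 + h / 2 ^ S n) (t n) (t n + k / 2 ^ S n))
     (I s1 (s1 + h / 2 ^ S n) (t n + k / 2 ^ S n) (t n + k / 2 ^ S n + k / 2 ^ S n))).
  rewrite <- Hsum; lra. }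
assert (HV4 : forall n, V O <= 4 ^ n * V n).
{ induction n as [|n IH]; [simpl; lra|].
  simpl; specialize (HV n); assert (0 < 4 ^ n) by (apply pow_lt; lra); nra. }
destruct (nested_intervals s (fun n => h / 2 ^ n)) as [x Hx].
{ intros n; now apply Pp. } { intros n; apply HA. } { intros n; apply HA. }
destruct (nested_intervals t (fun n => k / 2 ^ n)) as [y Hy].
{ intros n; now apply Pp. } { intros n; apply HA. } { intros n; apply HA. }
apply Cmod_eq_0.
assert (V0 : V O = Cmod (I a a' b b')).
{ unfold V, s, t; simpl; do 2 f_equal; unfold h, k; field. }
rewrite <- V0.
destruct (Rle_lt_or_eq_dec 0 (V O)) as [Hpos | Hz]; [apply Cmod_ge_0 | exfalso | now symmetry].
(* The [+ 1] keeps [q] positive for a degenerate rectangle and strictly above [(h + k) * (h + k)];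
   this strictness contradicts [V O <= 4 ^ n * V n]. *)
set (q := (h + k) * (h + k) + 1).
assert (Hq : 0 < q) by (unfold q; nra).
assert (Heps : 0 < V O / q) by (now apply Rdiv_lt_0_compat).
destruct (Hd x y) with (eps := V O / q) as [d [Hd0 Hd1]]; [| |exact Heps|].
{ generalize (Hx O) (HB O); simpl; lra. } { generalize (Hy O) (HB O); simpl; lra. }
assert (exists n, h / 2 ^ n < d /\ k / 2 ^ n < d) as [n [Hn1 Hn2]].
{ assert (Hr : 0 < d / (h + k + 1)) by (apply Rdiv_lt_0_compat; lra).
  destruct (pow_lt_1_zero (/ 2)) with (y := d / (h + k + 1)) as [n Hn].
  { rewrite Rabs_pos_eq; lra. } { exact Hr. }
  exists n; specialize (Hn n (le_n n)).
  rewrite Rabs_pos_eq in Hn by (apply pow_le; lra).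
  rewrite pow_inv in Hn.
  assert (Hp : 0 < / 2 ^ n) by (apply Rinv_0_lt_compat, pow_lt; lra).
  apply Rmult_lt_compat_r with (r := h + k + 1) in Hn; [|lra].
  unfold Rdiv in Hn; rewrite (Rmult_assoc d), Rinv_l, Rmult_1_r in Hn by lra.
  unfold Rdiv; split; nra. }
destruct (HB n) as [B1 [B2 [B3 B4]]]; specialize (Hx n); specialize (Hy n).
specialize (Hd1 (s n) (s n + h / 2 ^ n) (t n) (t n + k / 2 ^ n)).
fold (V n) in Hd1.
assert (F : V n <= V O / q * ((h + k) * (h + k)) / 4 ^ n).
{ eapply Rle_trans; [apply Hd1; lra|].
  right; replace (4 ^ n) with (2 ^ n * 2 ^ n) by (rewrite <- Rpow_mult_distr; f_equal; lra).
  field; repeat split; try lra; apply pow_nonzero; lra. }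
specialize (HV4 n).
assert (P4 : 0 < 4 ^ n) by (apply pow_lt; lra).
apply Rmult_le_compat_l with (r := 4 ^ n) in F; [|lra].
replace (4 ^ n * (V O / q * ((h + k) * (h + k)) / 4 ^ n)) with (V O / q * ((h + k) * (h + k))) in F
  by (field; split; lra).
replace (V O) with (V O / q * q) in HV4 at 1 by (field; lra).
unfold q in HV4 at 2; nra.
Qed.

(* The head symbol is matched syntactically: unifying [Cmult] with [Cplus] unfolds both. *)
Ltac rcont_arith :=
  repeat (first [ assumption | match goal with
   | |- @continuous _ _ (fun _ => ?k) _ => apply (rcont_const k)
   | |- @continuous _ _ (fun s => RtoC s) _ => apply rcont_RtoC, continuous_id
   | |- @continuous _ _ (fun s => Cmult (@?f s) (@?g s)) _ => apply (rcont_mult f g)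
   | |- @continuous _ _ (fun s => Cplus (@?f s) (@?g s)) _ => apply (rcont_plus f g)
   | |- @continuous _ _ (fun s => Cminus (@?f s) (@?g s)) _ => apply (rcont_minus f g)
   | |- @continuous _ _ (fun s => Copp (@?f s)) _ => apply (rcont_opp f)
   end]; cbv beta).

Lemma rderiv_star_radial (z v : C) (x : R) : rderiv (fun x => z + RtoC x * v)%C x v.
Proof.
apply rderiv_iff; intros eps Heps; exists 1; split; [lra | intros s _].
replace (z + s * v - (z + x * v) - RtoC (s - x) * v)%C with (RtoC 0)
  by (rewrite RtoC_minus; ring).
rewrite Cmod_0; generalize (Rabs_pos (s - x)); nra.
Qed.

Lemma rderiv_affine (z k : C) (c : R -> C) (t : R) (l : C) :
  rderiv c t l -> rderiv (fun y => z + k * c y)%C t (k * l)%C.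
Proof.
intros H; apply (rderiv_comp (fun w => z + k * w)%C c t k); [|exact H].
eapply cderiv_ext; [apply cderiv_plus; [apply cderiv_const | apply cderiv_scal, cderiv_id]|].
ring.
Qed.

(* [radial f z c t s s'] and [transversal f z c c' s t t'] are the integrals of [f w dw]
   along the sides of the image of [[s,s'] x [t,t']] under [(x,y) |-> z + x c(y)]. *)
Definition radial (f : C -> C) (z : C) (c : R -> C) (t s s' : R) : C :=
  CInt (fun x => f (z + RtoC x * c t) * c t)%C s s'.

Definition transversal (f : C -> C) (z : C) (c c' : R -> C) (s t t' : R) : C :=
  CInt (fun y => f (z + RtoC s * c y) * (RtoC s * c' y))%C t t'.

(* Near each point [f] is affine up to a small error, and the affine part has a primitive. *)
Lemma goursat_star (f : C -> C) (z : C) (c c' : R -> C) (S0 S1 T0 T1 K : R) :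
  0 <= S0 <= S1 -> S1 <= 1 -> T0 <= T1 -> 0 < K ->
  (forall y, T0 <= y <= T1 -> rderiv c y (c' y)) ->
  (forall y, T0 <= y <= T1 -> rcont c' y) ->
  (forall y, T0 <= y <= T1 -> Cmod (c y) <= K) ->
  (forall y, T0 <= y <= T1 -> Cmod (c' y) <= K) ->
  (forall x y, S0 <= x <= S1 -> T0 <= y <= T1 -> holo_at f (z + RtoC x * c y)%C) ->
  (radial f z c T0 S0 S1 + transversal f z c c' S1 T0 T1
   - radial f z c T1 S0 S1 - transversal f z c c' S0 T0 T1)%C = 0.
Proof.
intros HS HS1 HT HK Hc Hc' Kc Kc' Hf.
assert (Cc : forall y, T0 <= y <= T1 -> rcont c y)
  by (intros y Hy; eapply rderiv_rcont, Hc, Hy).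
assert (exR : forall g t s s', T0 <= t <= T1 -> S0 <= s <= s' -> s' <= S1 ->
  (forall x, s <= x <= s' -> holo_at g (z + RtoC x * c t)%C) ->
  ex_CInt (fun x => g (z + RtoC x * c t) * c t)%C s s').
{ intros g t s s' Ht Hs Hs' Hg; apply ex_CInt_cont; [lra | intros x Hx].
  apply rcont_mult; [|apply rcont_const].
  apply (rcont_comp_holo g (fun x => z + RtoC x * c t)%C); [now apply Hg | rcont_arith]. }
assert (exT : forall g s t t', S0 <= s <= S1 -> T0 <= t <= t' -> t' <= T1 ->
  (forall y, t <= y <= t' -> holo_at g (z + RtoC s * c y)%C) ->
  ex_CInt (fun y => g (z + RtoC s * c y) * (RtoC s * c' y))%C t t').
{ intros g s t t' Hs Ht Ht' Hg; apply ex_CInt_cont; [lra | intros y Hy].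
  assert (Y : T0 <= y <= T1) by lra.
  apply rcont_mult; [|specialize (Hc' y Y); rcont_arith].
  apply (rcont_comp_holo g (fun y => z + RtoC s * c y)%C); [now apply Hg | specialize (Cc y Y); rcont_arith]. }
apply (rectangle_additive_zero (fun s s' t t' =>
   radial f z c t s s' + transversal f z c c' s' t t'
   - radial f z c t' s s' - transversal f z c c' s t t')%C); [lra | lra | | |].
- intros s m s' t t' H1 H2 H3 H4; unfold radial.
  rewrite (CInt_Chasles _ s m s'), (CInt_Chasles _ s m s'); [ring | | | |];
  apply exR; try lra; intros x Hx; apply Hf; lra.
- intros s s' t m t' H1 H2 H3 H4; unfold transversal.
  rewrite (CInt_Chasles _ t m t'), (CInt_Chasles _ t m t'); [ring | | | |];
  apply exT; try lra; intros x Hx; apply Hf; lra.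
- intros x0 y0 Hx0 Hy0 eps Heps.
  set (w0 := (z + RtoC x0 * c y0)%C).
  destruct (Hf x0 y0 Hx0 Hy0) as [B HB]; fold w0 in HB.
  set (A := f w0).
  set (lin := fun w => (A + (w - w0) * B)%C).
  set (g := fun w => (f w - lin w)%C).
  set (P := fun w => (A * w + B / 2 * ((w - w0) * (w - w0)))%C).
  assert (HP : forall w, cderiv P w (lin w)).
  { intros w; unfold P; eapply cderiv_ext.
    - apply cderiv_plus; [apply cderiv_scal, cderiv_id|].
      apply cderiv_scal; apply cderiv_mult;
      (apply cderiv_minus; [apply cderiv_id | apply cderiv_const]).
    - unfold lin; field. }
  assert (Hlin : forall w, holo_at lin w).
  { intros w; exists B; unfold lin; eapply cderiv_ext.
    - apply cderiv_plus; [apply cderiv_const|]; apply cderiv_mult; [|apply cderiv_const].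
      apply cderiv_minus; [apply cderiv_id | apply cderiv_const].
    - cbv beta; ring. }
  assert (Lip : forall y, T0 <= y <= T1 -> Cmod (c y - c y0) <= K * Rabs (y - y0)).
  { intros y Hy; destruct (Rle_dec y y0) as [Y | Y].
    - rewrite Cmod_minus_sym, Rabs_minus_sym, (Rabs_pos_eq (y0 - y)) by lra.
      apply (mean_value_ineq c c'); [exact Y | |]; intros u Hu; [apply Hc | apply Kc']; lra.
    - rewrite (Rabs_pos_eq (y - y0)) by lra.
      apply (mean_value_ineq c c'); [lra | |]; intros u Hu; [apply Hc | apply Kc']; lra. }
  assert (Near : forall x y, S0 <= x <= S1 -> T0 <= y <= T1 ->
    Cmod (z + RtoC x * c y - w0) <= K * (Rabs (x - x0) + Rabs (y - y0))).
  { intros x y Hx Hy; unfold w0.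
    replace (z + x * c y - (z + x0 * c y0))%C
      with (RtoC (x - x0) * c y + RtoC x0 * (c y - c y0))%C by (rewrite RtoC_minus; ring).
    eapply Rle_trans; [apply Cmod_triangle|].
    rewrite !Cmod_mult, !Cmod_R, (Rabs_pos_eq x0) by lra.
    generalize (Lip y Hy) (Kc y Hy) (Rabs_pos (x - x0)) (Rabs_pos (y - y0))
      (Cmod_ge_0 (c y)) (Cmod_ge_0 (c y - c y0)); nra. }
  (* Each side contributes its parameter length times [eta * (K * d) * K]; the four lengths add up
     to [2 * d], and [eta] turns the sum into [eps * (d * d)]. *)
  set (eta := eps / (2 * K * K)).
  assert (Heta : 0 < eta) by (unfold eta; apply Rdiv_lt_0_compat; nra).
  destruct (proj1 (cderiv_iff f w0 B) HB eta Heta) as [r [Hr Kr]].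
  exists (r / (2 * K)); split; [apply Rdiv_lt_0_compat; lra|].
  intros s s' t t' Hs Hs' Ht Ht' Ds Dt.
  set (d := s' - s + (t' - t)).
  assert (Hd : K * d < r).
  { replace r with (K * (2 * (r / (2 * K)))) by (field; lra).
    apply Rmult_lt_compat_l; unfold d; lra. }
  assert (G : forall x y, s <= x <= s' -> t <= y <= t' ->
    Cmod (g (z + RtoC x * c y)%C) <= eta * (K * d)).
  { intros x y Hx Hy.
    assert (N : Cmod (z + RtoC x * c y - w0) <= K * d).
    { eapply Rle_trans; [apply Near; lra|].
      apply Rmult_le_compat_l; [lra|].
      assert (Rabs (x - x0) <= s' - s) by (apply Rabs_le; lra).
      assert (Rabs (y - y0) <= t' - t) by (apply Rabs_le; lra).
      unfold d; lra. }
    unfold g, lin, A.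
    replace (f (z + x * c y) - (f w0 + (z + x * c y - w0) * B))%C
      with (f (z + x * c y) - f w0 - (z + x * c y - w0) * B)%C by ring.
    eapply Rle_trans; [apply Kr; lra|].
    apply Rmult_le_compat_l; lra. }
  assert (Hg : forall x y, S0 <= x <= S1 -> T0 <= y <= T1 -> holo_at g (z + RtoC x * c y)%C).
  { intros x y Hx Hy; destruct (Hf x y Hx Hy) as [l1 D1].
    destruct (Hlin (z + RtoC x * c y)%C) as [l2 D2].
    eexists; apply cderiv_minus; eassumption. }
  assert (R1 : forall y, t <= y <= t' -> radial f z c y s s' =
     (P (z + RtoC s' * c y) - P (z + RtoC s * c y) + radial g z c y s s')%C).
  { intros y Hy; unfold radial.
    rewrite <- (CInt_derive (fun x => P (z + RtoC x * c y)%C)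
        (fun x => lin (z + RtoC x * c y) * c y)%C); [ | lra | |].
    - rewrite <- CInt_plus.
      + apply CInt_ext; [lra | intros x Hx; unfold g; ring].
      + apply exR; try lra; intros; apply Hlin.
      + apply exR; try lra; intros; apply Hg; lra.
    - intros x Hx; apply rderiv_comp; [apply HP | apply rderiv_star_radial].
    - intros x Hx; apply rcont_mult; [|apply rcont_const].
      apply (rcont_comp_holo lin (fun x => z + RtoC x * c y)%C); [apply Hlin | rcont_arith]. }
  assert (T2 : forall x, s <= x <= s' -> transversal f z c c' x t t' =
     (P (z + RtoC x * c t') - P (z + RtoC x * c t) + transversal g z c c' x t t')%C).
  { intros x Hx; unfold transversal.
    rewrite <- (CInt_derive (fun y => P (z + RtoC x * c y)%C)
        (fun y => lin (z + RtoC x * c y) * (RtoC x * c' y))%C); [ | lra | |].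
    - rewrite <- CInt_plus.
      + apply CInt_ext; [lra | intros y Hy; unfold g; ring].
      + apply exT; try lra; intros; apply Hlin.
      + apply exT; try lra; intros; apply Hg; lra.
    - intros y Hy; apply rderiv_comp; [apply HP | apply rderiv_affine, Hc; lra].
    - intros y Hy; assert (Y : T0 <= y <= T1) by lra.
      specialize (Cc y Y); specialize (Hc' y Y).
      apply rcont_mult; [|rcont_arith].
      apply (rcont_comp_holo lin (fun y => z + RtoC x * c y)%C); [apply Hlin | rcont_arith]. }
  assert (BR : forall y, t <= y <= t' -> Cmod (radial g z c y s s') <= (s' - s) * (eta * (K * d) * K)).
  { intros y Hy; apply CInt_bound; [lra | apply exR; try lra; intros; apply Hg; lra|].
    intros x Hx; rewrite Cmod_mult.
    apply Rmult_le_compat; try apply Cmod_ge_0; [now apply G | apply Kc; lra]. }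
  assert (BT : forall x, s <= x <= s' ->
     Cmod (transversal g z c c' x t t') <= (t' - t) * (eta * (K * d) * K)).
  { intros x Hx; apply CInt_bound; [lra | apply exT; try lra; intros; apply Hg; lra|].
    intros y Hy; rewrite !Cmod_mult, Cmod_R, Rabs_pos_eq by lra.
    apply Rmult_le_compat; [apply Cmod_ge_0 | | now apply G |].
    - apply Rmult_le_pos; [lra | apply Cmod_ge_0].
    - assert (Y : T0 <= y <= T1) by lra.
      generalize (Kc' y Y) (Cmod_ge_0 (c' y)); nra. }
  rewrite !R1, !T2 by lra.
  match goal with |- Cmod ?X <= _ => replace X with
    (radial g z c t s s' + transversal g z c c' s' t t'
     - radial g z c t' s s' - transversal g z c c' s t t')%C by ring end.
  eapply Rle_trans; [apply Cmod_triangle_minus|].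
  eapply Rle_trans; [apply Rplus_le_compat_r, Cmod_triangle_minus|].
  eapply Rle_trans; [apply Rplus_le_compat_r, Rplus_le_compat_r, Cmod_triangle|].
  generalize (BR t ltac:(lra)) (BR t' ltac:(lra)) (BT s ltac:(lra)) (BT s' ltac:(lra)).
  replace (eps * (d * d)) with (2 * (d * (eta * (K * d) * K))) by (unfold eta; field; lra).
  unfold d at 6; lra.
Qed.

(** * Cauchy's formula *)

Lemma Rle_eps_zero (x k : R) : 0 <= k -> (forall s, 0 < s <= 1 -> x <= k * s) -> x <= 0.
Proof.
intros Hk H; apply Rnot_lt_le; intros Hx.
assert (B : 0 < x / (2 * (k + x))) by (apply Rdiv_lt_0_compat; lra).
assert (E : x / (2 * (k + x)) * (2 * (k + x)) = x) by (field; lra).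
assert (S : 0 < x / (2 * (k + x)) <= 1) by (split; [exact B | nra]).
specialize (H _ S); nra.
Qed.

(** The radial sides of the image rectangle cancel because [c 0 = c T], so the integral over the
    scaled curve [s c] does not depend on [s] in [(0, 1]]; boundedness of [q] near [z] makes it at
    most a multiple of [s]. Holomorphy is demanded only for [x > 0], which admits a difference
    quotient at its base point. *)
Lemma cauchy_closed_star (q : C -> C) (z : C) (c c' : R -> C) (T K M d : R) :
  0 <= T -> 0 < K -> 0 < d ->
  (forall y, 0 <= y <= T -> rderiv c y (c' y)) ->
  (forall y, 0 <= y <= T -> rcont c' y) ->
  (forall y, 0 <= y <= T -> Cmod (c y) <= K) ->
  (forall y, 0 <= y <= T -> Cmod (c' y) <= K) ->
  c 0 = c T ->
  (forall x y, 0 < x <= 1 -> 0 <= y <= T -> holo_at q (z + RtoC x * c y)%C) ->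
  (forall w, Cmod (w - z) < d -> Cmod (q w) <= M) ->
  CInt (fun y => q (z + c y) * c' y)%C 0 T = 0.
Proof.
intros HT HK Hd Hc Hc' Kc Kc' Hper Hq HM.
assert (HM0 : 0 <= M).
{ eapply Rle_trans; [apply Cmod_ge_0 | apply (HM z)].
  now rewrite Cmod_minus_diag. }
replace (CInt (fun y => q (z + c y) * c' y)%C 0 T) with (transversal q z c c' 1 0 T).
2:{ apply CInt_ext; [exact HT | intros y _; now rewrite !Cmult_1_l]. }
assert (Inv : forall s, 0 < s <= 1 -> transversal q z c c' 1 0 T = transversal q z c c' s 0 T).
{ intros s Hs.
  assert (G := goursat_star q z c c' s 1 0 T K).
  unfold radial in G; rewrite <- Hper in G.
  apply Ceq_minus; rewrite <- G; try assumption; try lra; [ring|].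
  intros x y Hx; apply Hq; lra. }
apply Cmod_eq_0, Rle_antisym; [|apply Cmod_ge_0].
set (s0 := Rmin 1 (d / (2 * K))).
assert (Hs0 : 0 < s0 <= 1).
{ unfold s0; split; [apply Rmin_glb_lt; [lra | apply Rdiv_lt_0_compat; lra] | apply Rmin_l]. }
assert (Hs1 : s0 * K < d).
{ apply Rle_lt_trans with (d / (2 * K) * K).
  - apply Rmult_le_compat_r; [lra | apply Rmin_r].
  - replace (d / (2 * K) * K) with (d / 2) by (field; lra); lra. }
apply (Rle_eps_zero _ (T * (M * (s0 * K)))).
{ repeat apply Rmult_le_pos; lra. }
intros u Hu.
assert (Hs : 0 < u * s0 <= 1) by nra.
assert (HuK : u * s0 * K < d) by (assert (0 < s0 * K) by nra; nra).
rewrite (Inv (u * s0) Hs).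
replace (T * (M * (s0 * K)) * u) with ((T - 0) * (M * (u * s0 * K))) by ring.
apply CInt_bound; [exact HT | |].
- apply ex_CInt_cont; [exact HT | intros y Hy].
  specialize (Hc' y Hy); assert (Cc := rderiv_rcont _ _ _ (Hc y Hy)).
  apply rcont_mult; [|rcont_arith].
  apply (rcont_comp_holo q (fun y => z + RtoC (u * s0) * c y)%C); [now apply Hq | rcont_arith].
- intros y Hy; rewrite !Cmod_mult, Cmod_R, (Rabs_pos_eq (u * s0)) by lra.
  apply Rmult_le_compat; [apply Cmod_ge_0 | | | ].
  + apply Rmult_le_pos; [lra | apply Cmod_ge_0].
  + apply HM; replace (z + RtoC (u * s0) * c y - z)%C with (RtoC (u * s0) * c y)%C by ring.
    rewrite Cmod_mult, Cmod_R, Rabs_pos_eq by lra.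
    specialize (Kc y Hy); generalize (Cmod_ge_0 (c y)); nra.
  + apply Rmult_le_compat_l; [lra | now apply Kc'].
Qed.

Definition cis (t : R) : C := (cos t, sin t).

Lemma Cmod_cis (t : R) : Cmod (cis t) = 1.
Proof.
unfold Cmod, cis; simpl; rewrite !Rmult_1_r.
rewrite Rplus_comm; change (sqrt (Rsqr (sin t) + Rsqr (cos t)) = 1).
now rewrite sin2_cos2, sqrt_1.
Qed.

Lemma cis_conj_mult (t : R) : (cis t * cis (- t))%C = 1.
Proof.
unfold cis; rewrite cos_neg, sin_neg.
generalize (sin2_cos2 t); unfold Rsqr; intros E.
apply injective_projections; simpl; nra.
Qed.

Lemma cis_neq_0 (t : R) : cis t <> 0.
Proof. apply Cmod_gt_0; rewrite Cmod_cis; lra. Qed.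

Lemma cis_neg (t : R) : cis (- t) = (/ cis t)%C.
Proof.
rewrite <- (Cmult_1_l (/ cis t)), <- (cis_conj_mult t).
field; apply cis_neq_0.
Qed.

Lemma rderiv_cis (t : R) : rderiv cis t (Ci * cis t)%C.
Proof. apply rderiv_pair; simpl; auto_derive; try easy; ring. Qed.

Lemma rderiv_cis_neg (t : R) : rderiv (fun t => cis (- t)) t (- Ci * cis (- t))%C.
Proof. apply rderiv_pair; simpl; auto_derive; try easy; ring. Qed.

Lemma rcont_cis (t : R) : rcont cis t.
Proof. eapply rderiv_rcont, rderiv_cis. Qed.

Lemma rcont_cis_neg (t : R) : rcont (fun t => cis (- t)) t.
Proof. eapply (rderiv_rcont (fun t => cis (- t))), rderiv_cis_neg. Qed.

Lemma one_minus_neq_0 (w : C) : Cmod w < 1 -> (1 - w)%C <> 0.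
Proof.
intros H; apply Cmod_gt_0; generalize (Cmod_triangle_rev 1 w); rewrite Cmod_1; lra.
Qed.

Lemma two_PI_pos : 0 < 2 * PI.
Proof. generalize PI_RGT_0; lra. Qed.

Lemma rcont_geometric (a : C) (t : R) : Cmod a < 1 -> rcont (fun t => / (1 - a * cis (- t)))%C t.
Proof.
intros Ha; apply rcont_inv.
- generalize (rcont_cis_neg t); intros; rcont_arith.
- apply one_minus_neq_0; rewrite Cmod_mult, Cmod_cis; lra.
Qed.

(** Since [1 / (1 - u) = 1 + u / (1 - u)], the integrand is 1 plus a contour integrand on the unit
    circle run clockwise, holomorphic on the closed disc because [|a| < 1]. This stands in for the
    winding number about an off-centre point. *)
Lemma CInt_geometric (a : C) : Cmod a < 1 ->
  CInt (fun t => / (1 - a * cis (- t)))%C 0 (2 * PI) = RtoC (2 * PI).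
Proof.
intros Ha; generalize two_PI_pos; intros HPI.
assert (Hn : forall w, Cmod w <= 1 -> (1 - a * w)%C <> 0).
{ intros w Hw; apply one_minus_neq_0; rewrite Cmod_mult.
  generalize (Cmod_ge_0 a) (Cmod_ge_0 w); nra. }
assert (Z : CInt (fun t => a / (1 - a * (0 + cis (- t))) * (- Ci * cis (- t)))%C 0 (2 * PI) = 0).
{ apply (cauchy_closed_star (fun w => a / (1 - a * w))%C 0
          (fun t => cis (- t)) (fun t => - Ci * cis (- t))%C (2 * PI) 1 (/ (1 - Cmod a)) 1);
    try lra.
  - intros; apply rderiv_cis_neg.
  - intros y _; generalize (rcont_cis_neg y); intros; rcont_arith.
  - intros y _; rewrite Cmod_cis; lra.
  - intros y _; rewrite Cmod_mult, Cmod_opp, Cmod_Ci, Cmod_cis; lra.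
  - unfold cis; rewrite Ropp_0, !cos_neg, !sin_neg, cos_0, sin_0, cos_2PI, sin_2PI, Ropp_0; reflexivity.
  - intros x y Hx _; eexists; apply cderiv_scal.
    apply (cderiv_inv (fun w => 1 - a * w)%C).
    + apply cderiv_minus; [apply cderiv_const | apply cderiv_scal, cderiv_id].
    + apply Hn; rewrite Cplus_0_l, Cmod_mult, Cmod_cis, Cmod_R, Rabs_pos_eq; lra.
  - intros w Hw.
    replace (w - 0)%C with w in Hw by ring.
    unfold Cdiv; rewrite Cmod_mult, Cmod_inv by (apply Hn; lra).
    assert (B : 1 - Cmod a <= Cmod (1 - a * w)).
    { generalize (Cmod_triangle_rev 1 (a * w)); rewrite Cmod_1, Cmod_mult.
      generalize (Cmod_ge_0 a) (Cmod_ge_0 w); nra. }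
    apply Rle_trans with (1 * / Cmod (1 - a * w)).
    + apply Rmult_le_compat_r; [|lra]; left; apply Rinv_0_lt_compat; lra.
    + rewrite Rmult_1_l; apply Rinv_le_contravar; lra. }
rewrite (CInt_ext _ (fun t => 1 + Ci * (a / (1 - a * (0 + cis (- t))) * (- Ci * cis (- t))))%C).
2: lra.
2:{ intros t _.
    assert (N := Hn (cis (- t)) ltac:(rewrite Cmod_cis; lra)).
    replace (Ci * (a / (1 - a * (0 + cis (- t))) * (- Ci * cis (- t))))%C with
      (- (Ci * Ci) * (a * cis (- t) / (1 - a * (0 + cis (- t)))))%C
      by (rewrite Cplus_0_l; field; exact N).
    replace (Ci * Ci)%C with (- (1))%C by (apply injective_projections; simpl; ring).
    rewrite Cplus_0_l; field; exact N. }
assert (Ex : ex_CInt (fun t => a / (1 - a * (0 + cis (- t))) * (- Ci * cis (- t)))%C 0 (2 * PI)).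
{ apply ex_CInt_cont; [lra | intros t _].
  generalize (rcont_cis_neg t); intros; unfold Cdiv.
  apply rcont_mult; [apply rcont_mult; [apply rcont_const|]|rcont_arith].
  apply rcont_inv; [rcont_arith|]; cbv beta; rewrite Cplus_0_l; apply Hn; rewrite Cmod_cis; lra. }
rewrite CInt_plus.
- rewrite CInt_const, CInt_scal, Z by exact Ex.
  rewrite Rminus_0_r; ring.
- apply ex_CInt_cont; [lra | intros; apply rcont_const].
- now apply ex_CInt_scal.
Qed.

Lemma circle_dist (z0 z : C) (r t : R) : 0 <= r ->
  r - Cmod (z - z0) <= Cmod (z0 + RtoC r * cis t - z).
Proof.
intros Hr.
generalize (Cmod_triangle_rev (RtoC r * cis t) (z - z0)).
rewrite Cmod_mult, Cmod_cis, Cmod_R, Rabs_pos_eq by exact Hr.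
replace (r * cis t - (z - z0))%C with (z0 + r * cis t - z)%C by ring; lra.
Qed.

Lemma circle_neq (z0 z : C) (r t : R) : Cmod (z - z0) < r -> (z0 + RtoC r * cis t - z)%C <> 0.
Proof.
intros H; apply Cmod_gt_0.
assert (0 <= r) by (generalize (Cmod_ge_0 (z - z0)); lra).
generalize (circle_dist z0 z r t); lra.
Qed.

Lemma circle_radius (z0 : C) (r t : R) : 0 <= r -> Cmod (z0 + RtoC r * cis t - z0) = r.
Proof.
intros Hr; replace (z0 + r * cis t - z0)%C with (r * cis t)%C by ring.
rewrite Cmod_mult, Cmod_cis, Cmod_R, Rabs_pos_eq by exact Hr; ring.
Qed.

(** Subtracting [f z] leaves the difference quotient [q], bounded near [z], whose integral vanishes
    by shrinking the circle towards [z], not towards [z0]. The remaining multiple of [f z] is the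
    integral of the geometric kernel with [a = (z - z0) / r]. *)
Lemma cauchy_formula (f : C -> C) (z0 z : C) (r : R) : Cmod (z - z0) < r ->
  (forall w, Cmod (w - z0) <= r -> holo_at f w) ->
  CInt (fun t => f (z0 + RtoC r * cis t) * (RtoC r * cis t) / (z0 + RtoC r * cis t - z))%C
    0 (2 * PI) = (RtoC (2 * PI) * f z)%C.
Proof.
intros Hz Hf; generalize two_PI_pos; intros HPI.
assert (Hr : 0 < r) by (generalize (Cmod_ge_0 (z - z0)); lra).
assert (Hr0 : RtoC r <> 0) by (intros E; apply RtoC_inj in E; lra).
assert (Hon : forall t, holo_at f (z0 + RtoC r * cis t)%C).
{ intros t; apply Hf; rewrite circle_radius; lra. }
set (q := fun w => ((f w - f z) / (w - z))%C).
(* The circle as seen from [z]: the segments [z + x c(t)] stay in the disc by convexity and avoid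
   [z] for [x > 0]. *)
set (c := fun t => (z0 - z + RtoC r * cis t)%C).
assert (Ec : forall t, (z + c t = z0 + RtoC r * cis t)%C) by (intros t; unfold c; ring).
assert (cdist : forall t, c t = (z0 + RtoC r * cis t - z)%C) by (intros t; unfold c; ring).
assert (Hq : forall w, w <> z -> Cmod (w - z0) <= r -> holo_at q w).
{ intros w Hw Hwr; destruct (Hf w Hwr) as [l Hl].
  eexists; apply (cderiv_mult (fun w => f w - f z)%C (fun w => / (w - z))%C).
  - apply cderiv_minus; [exact Hl | apply cderiv_const].
  - apply (cderiv_inv (fun w => w - z)%C); [apply cderiv_minus; [apply cderiv_id | apply cderiv_const]|].
    intros E; apply Hw; now apply Ceq_minus. }
assert (Z : CInt (fun t => q (z + c t) * (RtoC r * (Ci * cis t)))%C 0 (2 * PI) = 0).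
{ destruct (Hf z ltac:(lra)) as [l Hl].
  destruct (proj1 (cderiv_iff f z l) Hl 1 Rlt_0_1) as [d [Hd Kd]].
  apply (cauchy_closed_star q z c (fun t => RtoC r * (Ci * cis t))%C (2 * PI) (2 * r)
     (Cmod l + 1) d); try lra.
  - intros y _; apply rderiv_affine, rderiv_cis.
  - intros y _; generalize (rcont_cis y); intros; rcont_arith.
  - intros y _; unfold c.
    generalize (Cmod_triangle (z0 - z) (r * cis y)).
    rewrite Cmod_mult, Cmod_cis, Cmod_R, Rabs_pos_eq, (Cmod_minus_sym z0) by lra; lra.
  - intros y _; rewrite !Cmod_mult, Cmod_cis, Cmod_R, Cmod_Ci, Rabs_pos_eq by lra; lra.
  - unfold c, cis; now rewrite cos_0, sin_0, cos_2PI, sin_2PI.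
  - intros x y Hx _; apply Hq.
    + intros E; apply (circle_neq z0 z r y Hz); rewrite <- cdist.
      replace (c y) with ((z + x * c y - z) / x)%C by (field; intros F; apply RtoC_inj in F; lra).
      rewrite E; field; intros F; apply RtoC_inj in F; lra.
    + unfold c.
      replace (z + x * (z0 - z + r * cis y) - z0)%C
        with (RtoC (1 - x) * (z - z0) + RtoC x * (r * cis y))%C by (rewrite RtoC_minus; ring).
      eapply Rle_trans; [apply Cmod_triangle|].
      rewrite !Cmod_mult, !Cmod_R, Cmod_cis, !Rabs_pos_eq by lra; nra.
  - intros w Hw; unfold q.
    destruct (Ceq_dec w z) as [-> | N].
    { replace (f z - f z)%C with (RtoC 0) by ring; unfold Cdiv; rewrite Cmult_0_l, Cmod_0.
      generalize (Cmod_ge_0 l); lra. }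
    assert (N' : (w - z)%C <> 0) by (intros E; apply N; now apply Ceq_minus).
    rewrite Cmod_div by exact N'.
    assert (P := proj1 (Cmod_gt_0 _) N').
    apply Rmult_le_reg_r with (Cmod (w - z)); [exact P|].
    unfold Rdiv; rewrite Rmult_assoc, Rinv_l, Rmult_1_r by lra.
    specialize (Kd w Hw).
    generalize (Cmod_triangle (f w - f z - (w - z) * l) ((w - z) * l)).
    rewrite (Cmod_mult (w - z)).
    replace (f w - f z - (w - z) * l + (w - z) * l)%C with (f w - f z)%C by ring; lra. }
set (a := ((z - z0) / RtoC r)%C).
assert (Ha : Cmod a < 1).
{ unfold a; rewrite Cmod_div, Cmod_R, Rabs_pos_eq by (assumption || lra).
  apply Rmult_lt_reg_r with r; [exact Hr|].
  unfold Rdiv; rewrite Rmult_assoc, Rinv_l; lra. }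
rewrite (CInt_ext _ (fun t => - Ci * (q (z + c t) * (RtoC r * (Ci * cis t)))
                              + f z * / (1 - a * cis (- t)))%C).
2: lra.
2:{ intros t _; rewrite Ec; unfold q, a; rewrite cis_neg.
    assert (N1 := circle_neq z0 z r t Hz); assert (N2 := cis_neq_0 t).
    replace (- Ci * ((f (z0 + r * cis t) - f z) / (z0 + r * cis t - z) * (r * (Ci * cis t))))%C
      with (- (Ci * Ci) * ((f (z0 + r * cis t) - f z) * (r * cis t) / (z0 + r * cis t - z)))%C
      by (field; exact N1).
    replace (Ci * Ci)%C with (- (1))%C by (apply injective_projections; simpl; ring).
    field; repeat split; try assumption.
    intros E; apply N1; rewrite <- E; ring. }
assert (E1 : ex_CInt (fun t => q (z + c t) * (RtoC r * (Ci * cis t)))%C 0 (2 * PI)).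
{ apply ex_CInt_cont; [lra | intros t _].
  generalize (rcont_cis t); intros.
  apply rcont_mult; [|rcont_arith].
  apply (rcont_comp_holo q (fun t => z + c t)%C).
  - rewrite Ec; apply Hq; [|rewrite circle_radius; lra].
    intros E; apply (circle_neq z0 z r t Hz); rewrite E; ring.
  - unfold c; rcont_arith. }
assert (E2 : ex_CInt (fun t => / (1 - a * cis (- t)))%C 0 (2 * PI)).
{ apply ex_CInt_cont; [lra | intros; now apply rcont_geometric]. }
rewrite CInt_plus, CInt_scal, CInt_scal, Z, CInt_geometric by
  (assumption || (apply ex_CInt_scal; assumption)).
ring.
Qed.

(** The Cauchy kernel has modulus at most [r / (r - |z - z0|)] on the circle. At the centre this is
    the sharp maximum principle; elsewhere the weight on the left is the loss, and the same weight
    defines the supremum in Bloch's theorem. *)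
Lemma cauchy_modulus_bound (f : C -> C) (z0 z : C) (r M : R) : Cmod (z - z0) < r ->
  (forall w, Cmod (w - z0) <= r -> holo_at f w) ->
  (forall w, Cmod (w - z0) = r -> Cmod (f w) <= M) ->
  Cmod (f z) * (r - Cmod (z - z0)) <= M * r.
Proof.
intros Hz Hf HM; generalize two_PI_pos; intros HPI.
assert (Hr : 0 < r) by (generalize (Cmod_ge_0 (z - z0)); lra).
assert (E := cauchy_formula f z0 z r Hz Hf).
set (d := r - Cmod (z - z0)); assert (Hd : 0 < d) by (unfold d; lra).
assert (B : Cmod (RtoC (2 * PI) * f z)%C <= (2 * PI - 0) * (M * r / d)).
{ rewrite <- E; apply CInt_bound; [lra | |].
  - apply ex_CInt_cont; [lra | intros t _].
    generalize (rcont_cis t); intros.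
    unfold Cdiv; apply rcont_mult; [apply rcont_mult|]; [|rcont_arith|].
    + apply (rcont_comp_holo f (fun t => z0 + RtoC r * cis t)%C); [|rcont_arith].
      apply Hf; rewrite circle_radius; lra.
    + apply rcont_inv; [rcont_arith | now apply circle_neq].
  - intros t _.
    rewrite Cmod_div by (now apply circle_neq).
    rewrite !Cmod_mult, Cmod_cis, Cmod_R, Rabs_pos_eq by lra.
    generalize (circle_dist z0 z r t ltac:(lra)); fold d; intros D.
    assert (F : Cmod (f (z0 + RtoC r * cis t)%C) <= M) by (apply HM, circle_radius; lra).
    assert (I : / Cmod (z0 + RtoC r * cis t - z) <= / d) by (apply Rinv_le_contravar; lra).
    assert (0 < / Cmod (z0 + RtoC r * cis t - z)) by (apply Rinv_0_lt_compat; lra).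
    generalize (Cmod_ge_0 (f (z0 + RtoC r * cis t)%C)); intros.
    unfold Rdiv; apply Rmult_le_compat; nra. }
rewrite Cmod_mult, Cmod_R, Rabs_pos_eq, Rminus_0_r in B by lra.
apply Rmult_le_reg_l in B; [|exact HPI].
apply Rmult_le_compat_r with (r := d) in B; [|lra].
replace (M * r / d * d) with (M * r) in B by (field; lra); exact B.
Qed.

Lemma rcont_bounded (f : R -> C) (a b : R) : a <= b ->
  (forall t, a <= t <= b -> rcont f t) ->
  exists M, 0 < M /\ forall t, a <= t <= b -> Cmod (f t) <= M.
Proof.
intros Hab H.
destruct (continuity_ab_maj (fun t => Cmod (f t)) a b Hab) as [t0 [Ht0 _]].
- intros t Ht; apply continuity_pt_filterlim; now apply rcont_Cmod, H.
- exists (Cmod (f t0) + 1); split; [generalize (Cmod_ge_0 (f t0)); lra|].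
  intros t Ht; specialize (Ht0 t Ht); lra.
Qed.

(** A remainder quadratic in [w - z], uniformly in [t], integrates to a quadratic remainder; this
    takes the place of a convergence theorem for integrals. *)
Lemma cderiv_under_CInt (G : C -> R -> C) (G' : R -> C) (z : C) (a b d L : R) :
  a <= b -> 0 < d ->
  (forall w, Cmod (w - z) < d -> ex_CInt (G w) a b) -> ex_CInt G' a b ->
  (forall w t, Cmod (w - z) < d -> a <= t <= b ->
    Cmod (G w t - G z t - (w - z) * G' t) <= L * (Cmod (w - z) * Cmod (w - z))) ->
  cderiv (fun w => CInt (G w) a b) z (CInt G' a b).
Proof.
intros Hab Hd ExG ExG' HL; apply cderiv_iff; intros eps Heps.
assert (Hz : Cmod (z - z) < d)
  by now rewrite Cmod_minus_diag.
set (k := (b - a) * Rabs L); assert (Hk : 0 <= k).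
{ apply Rmult_le_pos; [lra | apply Rabs_pos]. }
exists (Rmin d (eps / (k + 1))); split.
{ apply Rmin_glb_lt; [exact Hd | apply Rdiv_lt_0_compat; lra]. }
intros w Hw.
assert (Hw1 := Rlt_le_trans _ _ _ Hw (Rmin_l _ _)).
assert (Hw2 := Rlt_le_trans _ _ _ Hw (Rmin_r _ _)).
assert (E1 := ExG w Hw1); assert (E0 := ExG z Hz).
rewrite <- CInt_scal by exact ExG'.
rewrite <- CInt_minus by assumption.
rewrite <- CInt_minus;
  [ | now apply (@ex_RInt_minus C_R_NormedModule) | now apply ex_CInt_scal].
set (m := Cmod (w - z)) in *; assert (Hm : 0 <= m) by apply Cmod_ge_0.
apply Rle_trans with ((b - a) * (Rabs L * (m * m))).
- apply CInt_bound; [exact Hab | |].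
  + apply (@ex_RInt_minus C_R_NormedModule); [now apply (@ex_RInt_minus C_R_NormedModule)|].
    now apply ex_CInt_scal.
  + intros t Ht; eapply Rle_trans; [now apply HL|].
    apply Rmult_le_compat_r; [nra | apply Rle_abs].
- replace ((b - a) * (Rabs L * (m * m))) with (k * m * m) by (unfold k; ring).
  apply Rmult_le_compat_r; [exact Hm|].
  apply Rmult_lt_compat_r with (r := k + 1) in Hw2; [|lra].
  unfold Rdiv in Hw2; rewrite Rmult_assoc, Rinv_l in Hw2 by lra; nra.
Qed.

(** * Differentiation of integrals of Cauchy type *)

Section CauchyType.

Variables (phi gam : R -> C) (a b d : R) (z : C).
Hypothesis Hab : a <= b.
Hypothesis Hd : 0 < d.
Hypothesis Cphi : forall t, a <= t <= b -> rcont phi t.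
Hypothesis Cgam : forall t, a <= t <= b -> rcont gam t.
Hypothesis Hdist : forall t, a <= t <= b -> d <= Cmod (gam t - z).

Lemma dist_nearby (w : C) (t : R) : Cmod (w - z) < d / 2 -> a <= t <= b ->
  d / 2 <= Cmod (gam t - w).
Proof.
intros Hw Ht; specialize (Hdist t Ht).
generalize (Cmod_triangle (gam t - w) (w - z)).
replace (gam t - w + (w - z))%C with (gam t - z)%C by ring; lra.
Qed.

Lemma gam_neq (w : C) (t : R) : Cmod (w - z) < d / 2 -> a <= t <= b -> (gam t - w)%C <> 0.
Proof. intros Hw Ht; apply Cmod_gt_0; generalize (dist_nearby w t Hw Ht); lra. Qed.

Lemma gam_neq_z (t : R) : a <= t <= b -> (gam t - z)%C <> 0.
Proof. intros Ht; apply Cmod_gt_0; generalize (Hdist t Ht); lra. Qed.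

Lemma Cinv_dist_z (t : R) : a <= t <= b -> 0 < / Cmod (gam t - z) <= / d.
Proof.
intros Ht; specialize (Hdist t Ht); split;
[apply Rinv_0_lt_compat; lra | apply Rinv_le_contravar; lra].
Qed.

Lemma Cinv_dist (w : C) (t : R) : Cmod (w - z) < d / 2 -> a <= t <= b ->
  0 < / Cmod (gam t - w) <= 2 / d.
Proof.
intros Hw Ht; generalize (dist_nearby w t Hw Ht); intros D; split.
- apply Rinv_0_lt_compat; lra.
- replace (2 / d) with (/ (d / 2)) by (field; lra); apply Rinv_le_contravar; lra.
Qed.

Lemma ex_CInt_cauchy_type (n : nat) (w : C) : Cmod (w - z) < d / 2 ->
  ex_CInt (fun t => phi t / (gam t - w) ^ n)%C a b.
Proof.
intros Hw; apply ex_CInt_cont; [exact Hab | intros t Ht].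
specialize (Cphi t Ht); specialize (Cgam t Ht).
apply rcont_mult; [exact Cphi|].
apply rcont_inv; [|now apply Cpow_nz, gam_neq].
induction n as [|n IH]; simpl; [apply rcont_const | apply rcont_mult; [rcont_arith | exact IH]].
Qed.

Lemma cderiv_cauchy_type_1 :
  cderiv (fun w => CInt (fun t => phi t / (gam t - w) ^ 1)%C a b) z
    (CInt (fun t => phi t / (gam t - z) ^ 2)%C a b).
Proof.
destruct (rcont_bounded phi a b Hab Cphi) as [M [HM Bphi]].
assert (Hzz : Cmod (z - z) < d / 2)
  by (rewrite Cmod_minus_diag; lra).
apply (cderiv_under_CInt (fun w t => phi t / (gam t - w) ^ 1)%C _ z a b (d / 2)
         (M * (/ d * / d * (2 / d)))); [exact Hab | lra | | |].
- intros w Hw; now apply ex_CInt_cauchy_type.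
- now apply ex_CInt_cauchy_type.
- intros w t Hw Ht.
  replace (phi t / (gam t - w) ^ 1 - phi t / (gam t - z) ^ 1
           - (w - z) * (phi t / (gam t - z) ^ 2))%C
    with (phi t * (/ (gam t - z) * / (gam t - z) * / (gam t - w)) * ((w - z) * (w - z)))%C
    by (simpl; field; split; [now apply gam_neq_z | now apply gam_neq]).
  rewrite !Cmod_mult, !Cmod_inv by (now apply gam_neq_z || now apply gam_neq).
  generalize (Cinv_dist_z t Ht) (Cinv_dist w t Hw Ht) (Bphi t Ht) (Cmod_ge_0 (phi t)); intros I1 I2 I3 I4.
  apply Rmult_le_compat_r; [generalize (Cmod_ge_0 (w - z)); nra|].
  apply Rmult_le_compat; [lra | | lra |].
  + repeat apply Rmult_le_pos; lra.
  + apply Rmult_le_compat; try lra; [apply Rmult_le_pos; lra | apply Rmult_le_compat; lra].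
Qed.

Lemma ex_cderiv_cauchy_type_2 :
  holo_at (fun w => CInt (fun t => phi t / (gam t - w) ^ 2)%C a b) z.
Proof.
destruct (rcont_bounded phi a b Hab Cphi) as [M [HM Bphi]].
assert (Hzz : Cmod (z - z) < d / 2)
  by (rewrite Cmod_minus_diag; lra).
exists (CInt (fun t => 2 * (phi t / (gam t - z) ^ 3))%C a b).
apply (cderiv_under_CInt (fun w t => phi t / (gam t - w) ^ 2)%C _ z a b (d / 2)
   (M * (2 / d * (2 / d) * (2 / d * (2 / d)) + 2 * (2 / d * (2 / d) * (2 / d * (2 / d))))));
  [exact Hab | lra | | |].
- intros w Hw; now apply ex_CInt_cauchy_type.
- now apply ex_CInt_scal, ex_CInt_cauchy_type.
- intros w t Hw Ht.
  replace (phi t / (gam t - w) ^ 2 - phi t / (gam t - z) ^ 2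
           - (w - z) * (2 * (phi t / (gam t - z) ^ 3)))%C
    with (phi t * (/ (gam t - z) * / (gam t - z) * (/ (gam t - w) * / (gam t - w))
       + 2 * (/ (gam t - z) * / (gam t - z) * (/ (gam t - z) * / (gam t - w)))) * ((w - z) * (w - z)))%C
    by (simpl; field; split; [now apply gam_neq_z | now apply gam_neq]).
  generalize (Cinv_dist_z t Ht) (Cinv_dist w t Hw Ht) (Bphi t Ht) (Cmod_ge_0 (phi t)); intros I1 I2 I3 I4.
  rewrite !Cmod_mult.
  apply Rmult_le_compat_r; [generalize (Cmod_ge_0 (w - z)); nra|].
  apply Rmult_le_compat; [lra | apply Cmod_ge_0 | lra |].
  eapply Rle_trans; [apply Cmod_triangle|].
  rewrite !Cmod_mult, Cmod_R, Rabs_pos_eq by lra.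
  rewrite !Cmod_inv by (now apply gam_neq_z || now apply gam_neq).
  assert (J : 0 < / d) by (now apply Rinv_0_lt_compat).
  assert (I1' : 0 < / Cmod (gam t - z) <= 2 / d) by (unfold Rdiv; lra).
  apply Rplus_le_compat; [|apply Rmult_le_compat_l; [lra|]];
  (repeat apply Rmult_le_compat); try lra; apply Rmult_le_pos; lra.
Qed.

End CauchyType.

(** * Consequences of Cauchy's formula on discs: derivatives, limits, primitives *)

Definition holo_disc (f : C -> C) (z0 : C) (r : R) : Prop :=
  forall w, Cmod (w - z0) < r -> holo_at f w.

Lemma holo_disc_sub (f : C -> C) (z0 z1 : C) (r s : R) :
  Cmod (z1 - z0) + s <= r -> holo_disc f z0 r -> holo_disc f z1 s.
Proof.
intros H Hf w Hw; apply Hf.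
generalize (Cmod_triangle (w - z1) (z1 - z0)).
replace (w - z1 + (z1 - z0))%C with (w - z0)%C by ring; lra.
Qed.

Lemma holo_disc_le (f : C -> C) (z0 : C) (r s : R) :
  s <= r -> holo_disc f z0 r -> holo_disc f z0 s.
Proof. intros H Hf w Hw; apply Hf; lra. Qed.

Lemma RtoC_neq_0 (x : R) : x <> 0 -> RtoC x <> 0.
Proof. intros H E; apply RtoC_inj in E; lra. Qed.

Lemma C_derive_spec (f : C -> C) (z : C) : holo_at f z -> cderiv f z (C_derive f z).
Proof. intros [l Hl]; now rewrite (is_C_derive_unique f z l Hl). Qed.

Lemma rcont_circle (z0 : C) (r t : R) : rcont (fun t => z0 + RtoC r * cis t)%C t.
Proof. generalize (rcont_cis t); intros; rcont_arith. Qed.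

Lemma cauchy_formula_type (f : C -> C) (z0 z : C) (r : R) : Cmod (z - z0) < r ->
  (forall w, Cmod (w - z0) <= r -> holo_at f w) ->
  f z = (/ RtoC (2 * PI) * CInt (fun t => f (z0 + RtoC r * cis t) * (RtoC r * cis t)
                                   / (z0 + RtoC r * cis t - z) ^ 1) 0 (2 * PI))%C.
Proof.
intros Hz Hf.
assert (N := RtoC_neq_0 _ (Rgt_not_eq _ _ two_PI_pos)).
rewrite (CInt_ext _ (fun t => f (z0 + RtoC r * cis t) * (RtoC r * cis t)
                                   / (z0 + RtoC r * cis t - z))%C).
- rewrite cauchy_formula by assumption.
  field; exact N.
- generalize two_PI_pos; lra.
- intros t _; simpl; now rewrite Cmult_1_r.
Qed.

Lemma cderiv_cauchy_formula (f : C -> C) (z0 z : C) (r : R) : Cmod (z - z0) < r ->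
  (forall w, Cmod (w - z0) <= r -> holo_at f w) ->
  cderiv f z (/ RtoC (2 * PI) * CInt (fun t => f (z0 + RtoC r * cis t) * (RtoC r * cis t)
                                   / (z0 + RtoC r * cis t - z) ^ 2) 0 (2 * PI))%C.
Proof.
intros Hz Hf; generalize two_PI_pos; intros HPI.
assert (Hr : 0 < r) by (generalize (Cmod_ge_0 (z - z0)); lra).
apply (cderiv_ext_loc (fun w => / RtoC (2 * PI) * CInt (fun t =>
   f (z0 + RtoC r * cis t) * (RtoC r * cis t) / (z0 + RtoC r * cis t - w) ^ 1) 0 (2 * PI))%C
   f z _ (r - Cmod (z - z0))); [lra | |].
- intros w Hw; symmetry; apply cauchy_formula_type; [|exact Hf].
  generalize (Cmod_triangle (w - z) (z - z0)).
  replace (w - z + (z - z0))%C with (w - z0)%C by ring; lra.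
- apply cderiv_scal.
  apply (cderiv_cauchy_type_1 (fun t => f (z0 + RtoC r * cis t) * (RtoC r * cis t))%C
    (fun t => z0 + RtoC r * cis t)%C 0 (2 * PI) (r - Cmod (z - z0))); try lra.
  + intros t _; generalize (rcont_cis t); intros; apply rcont_mult; [|rcont_arith].
    apply (rcont_comp_holo f (fun t => z0 + RtoC r * cis t)%C), rcont_circle.
    apply Hf; rewrite circle_radius; lra.
  + intros t _; apply rcont_circle.
  + intros t _; apply circle_dist; lra.
Qed.

(** The derivative is itself an integral of Cauchy type, with squared kernel, over a circle of
    radius [s] between [|z - z0|] and [r]; it can be differentiated once more under the integral
    sign. *)
Lemma holo_C_derive (f : C -> C) (z0 : C) (r : R) :
  holo_disc f z0 r -> holo_disc (C_derive f) z0 r.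
Proof.
intros Hf z Hz; generalize two_PI_pos; intros HPI.
set (s := (Cmod (z - z0) + r) / 2).
assert (Hs : Cmod (z - z0) < s < r) by (unfold s; lra).
assert (Hs0 : 0 < s) by (generalize (Cmod_ge_0 (z - z0)); lra).
assert (Hfs : forall w, Cmod (w - z0) <= s -> holo_at f w) by (intros w Hw; apply Hf; lra).
assert (H2 : holo_at (fun w => CInt (fun t => f (z0 + RtoC s * cis t) * (RtoC s * cis t)
                / (z0 + RtoC s * cis t - w) ^ 2)%C 0 (2 * PI)) z).
{ apply (ex_cderiv_cauchy_type_2 (fun t => f (z0 + RtoC s * cis t) * (RtoC s * cis t))%C
    (fun t => z0 + RtoC s * cis t)%C 0 (2 * PI) (s - Cmod (z - z0))); try lra.
  + intros t _; generalize (rcont_cis t); intros; apply rcont_mult; [|rcont_arith].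
    apply (rcont_comp_holo f (fun t => z0 + RtoC s * cis t)%C), rcont_circle.
    apply Hfs; rewrite circle_radius; lra.
  + intros t _; apply rcont_circle.
  + intros t _; apply circle_dist; lra. }
destruct H2 as [l Hl]; exists (/ RtoC (2 * PI) * l)%C.
eapply (cderiv_ext_loc _ _ z _ (s - Cmod (z - z0))); [lra | | apply cderiv_scal, Hl].
intros w Hw; symmetry; apply is_C_derive_unique, cderiv_cauchy_formula; [|exact Hfs].
generalize (Cmod_triangle (w - z) (z - z0)).
replace (w - z + (z - z0))%C with (w - z0)%C by ring; lra.
Qed.

Lemma cauchy_estimate (f : C -> C) (z : C) (r M : R) : 0 < r ->
  (forall w, Cmod (w - z) <= r -> holo_at f w) ->
  (forall w, Cmod (w - z) = r -> Cmod (f w) <= M) ->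
  Cmod (C_derive f z) * r <= M.
Proof.
intros Hr Hf HM; generalize two_PI_pos; intros HPI.
rewrite (is_C_derive_unique f z _ (cderiv_cauchy_formula f z z r ltac:(rewrite Cmod_minus_diag; lra) Hf)).
rewrite Cmod_mult, Cmod_inv, Cmod_R, Rabs_pos_eq by (lra || apply RtoC_neq_0; lra).
match goal with |- / _ * Cmod ?X * r <= M => assert (B : Cmod X <= (2 * PI - 0) * (M / r)) end.
{ apply CInt_bound; [lra | |].
  - apply (ex_CInt_cauchy_type (fun t => f (z + RtoC r * cis t) * (RtoC r * cis t))%C
     (fun t => z + RtoC r * cis t)%C 0 (2 * PI) r z); try lra.
    + intros t _; generalize (rcont_cis t); intros; apply rcont_mult; [|rcont_arith].
      apply (rcont_comp_holo f (fun t => z + RtoC r * cis t)%C), rcont_circle.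
      apply Hf; rewrite circle_radius; lra.
    + intros t _; apply rcont_circle.
    + intros t _; generalize (circle_dist z z r t); rewrite Cmod_minus_diag; lra.
    + rewrite Cmod_minus_diag; lra.
  - intros t _.
    assert (F : Cmod (f (z + RtoC r * cis t)%C) <= M) by (apply HM, circle_radius; lra).
    replace (z + r * cis t - z)%C with (r * cis t)%C by ring.
    rewrite Cmod_div by (apply Cpow_nz, Cmult_neq_0; [apply RtoC_neq_0; lra | apply cis_neq_0]).
    rewrite Cmod_pow, !Cmod_mult, Cmod_cis, Cmod_R, Rabs_pos_eq by lra.
    apply Rmult_le_reg_r with r; [exact Hr|].
    replace (M / r * r) with M by (field; lra).
    match goal with |- ?X <= _ => replace X with (Cmod (f (z + RtoC r * cis t)%C)) by (field; lra) end.
    exact F. }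
rewrite Rminus_0_r in B.
apply Rmult_le_compat_l with (r := / (2 * PI)) in B; [|left; apply Rinv_0_lt_compat; lra].
apply Rmult_le_compat_r with (r := r) in B; [|lra].
replace (/ (2 * PI) * (2 * PI * (M / r)) * r) with M in B by (field; split; lra).
exact B.
Qed.

(** Cauchy's formula survives a uniform limit: inside the circle of radius [s], [g] is the
    Cauchy-type integral of its own boundary values, and such integrals are differentiable.
    Continuity of [g] along the circle has to come first, so that these integrals exist. *)
Lemma weierstrass (u : nat -> C -> C) (g : C -> C) (z0 : C) (r : R) :
  (forall n, holo_disc (u n) z0 r) ->
  (forall eps, 0 < eps -> exists n, forall w, Cmod (w - z0) < r -> Cmod (u n w - g w) <= eps) ->
  holo_disc g z0 r.
Proof.
intros Hu Hg z Hz; generalize two_PI_pos; intros HPI.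
set (s := (Cmod (z - z0) + r) / 2).
assert (Hs : Cmod (z - z0) < s < r) by (unfold s; lra).
assert (Hs0 : 0 < s) by (generalize (Cmod_ge_0 (z - z0)); lra).
set (gam := fun t => (z0 + RtoC s * cis t)%C).
assert (Hgam : forall t, Cmod (gam t - z0) = s) by (intros t; apply circle_radius; lra).
set (phi := fun t => (g (gam t) * (RtoC s * cis t))%C).
assert (Cg : forall t, rcont (fun t => g (gam t)) t).
{ intros t; apply rcont_iff; intros eps Heps.
  destruct (Hg (eps / 4) ltac:(lra)) as [n Hn].
  assert (K : rcont (fun t => u n (gam t)) t).
  { apply rcont_comp_holo; [apply Hu; rewrite Hgam; lra | apply rcont_circle]. }
  destruct (proj1 (rcont_iff _ _) K (eps / 4) ltac:(lra)) as [d [Hd D]].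
  exists d; split; [exact Hd | intros x Hx].
  specialize (D x Hx).
  generalize (Hn (gam x) ltac:(rewrite Hgam; lra)) (Hn (gam t) ltac:(rewrite Hgam; lra)).
  rewrite (Cmod_minus_sym (u n (gam x))); intros A1 A2.
  replace (g (gam x) - g (gam t))%C with
    ((g (gam x) - u n (gam x)) + (u n (gam x) - u n (gam t)) + (u n (gam t) - g (gam t)))%C by ring.
  eapply Rle_lt_trans; [apply Cmod_triangle|].
  eapply Rle_lt_trans; [apply Rplus_le_compat_r, Cmod_triangle|]; lra. }
assert (Cphi : forall t, rcont phi t).
{ intros t; generalize (rcont_cis t) (Cg t); intros.
  unfold phi; apply rcont_mult; [assumption | rcont_arith]. }
assert (Cgam : forall t, rcont gam t) by (intros; apply rcont_circle).
assert (F : forall w, Cmod (w - z0) < s ->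
   (/ RtoC (2 * PI) * CInt (fun t => phi t / (gam t - w) ^ 1) 0 (2 * PI))%C = g w).
{ intros w Hw; symmetry; apply Ceq_minus, Cmod_eq_0, Rle_antisym; [|apply Cmod_ge_0].
  set (e := s - Cmod (w - z0)).
  assert (He : 0 < s / e) by (apply Rdiv_lt_0_compat; unfold e; lra).
  assert (Dist : forall t, e <= Cmod (gam t - w)) by (intros t; apply circle_dist; lra).
  assert (Ex : forall ph, (forall t, rcont ph t) ->
    ex_CInt (fun t => ph t / (gam t - w) ^ 1)%C 0 (2 * PI)).
  { intros ph Hph; apply (ex_CInt_cauchy_type ph gam 0 (2 * PI) e w); try lra; auto.
    - unfold e; lra.
    - rewrite Cmod_minus_diag; unfold e; lra. }
  (* 1 pays for replacing [g] by [u n] at [w], and [s / e] for doing so under the integral, where it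
     bounds the modulus of the kernel. *)
  apply (Rle_eps_zero _ (1 + s / e)); [lra | intros eps Heps].
  destruct (Hg eps ltac:(lra)) as [n Hn].
  assert (Hun : forall x, Cmod (x - z0) <= s -> holo_at (u n) x)
    by (intros x Hx; apply Hu; lra).
  assert (Cu : forall t, rcont (fun t => u n (gam t) * (RtoC s * cis t))%C t).
  { intros t; generalize (rcont_cis t); intros; apply rcont_mult; [|rcont_arith].
    apply rcont_comp_holo; [apply Hun; rewrite Hgam; lra | apply Cgam]. }
  replace (g w - / RtoC (2 * PI) * CInt (fun t => phi t / (gam t - w) ^ 1) 0 (2 * PI))%C
   with ((g w - u n w) + / RtoC (2 * PI) *
     (CInt (fun t => u n (gam t) * (RtoC s * cis t) / (gam t - w) ^ 1) 0 (2 * PI)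
      - CInt (fun t => phi t / (gam t - w) ^ 1) 0 (2 * PI)))%C
   by (rewrite (cauchy_formula_type (u n) z0 w s Hw Hun) at 1; unfold gam; ring).
  rewrite <- (CInt_minus (fun t => u n (gam t) * (RtoC s * cis t) / (gam t - w) ^ 1)%C)
    by (apply Ex; assumption).
  eapply Rle_trans; [apply Cmod_triangle|].
  rewrite Rmult_plus_distr_r, Rmult_1_l.
  apply Rplus_le_compat; [rewrite Cmod_minus_sym; apply Hn; lra|].
  rewrite Cmod_mult, Cmod_inv, Cmod_R, Rabs_pos_eq by (lra || apply RtoC_neq_0; lra).
  apply Rmult_le_reg_l with (2 * PI); [exact HPI|].
  rewrite <- Rmult_assoc, Rinv_r, Rmult_1_l by lra.
  replace (2 * PI) with (2 * PI - 0) at 2 by ring.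
  apply CInt_bound; [lra | |].
  - apply (@ex_RInt_minus C_R_NormedModule);
    [apply (Ex (fun t => u n (gam t) * (RtoC s * cis t))%C Cu) | apply (Ex phi Cphi)].
  - intros t _; unfold phi.
    assert (De : 0 < e) by (unfold e; lra).
    assert (N : (gam t - w)%C <> 0) by (apply Cmod_gt_0; specialize (Dist t); lra).
    replace (u n (gam t) * (s * cis t) / (gam t - w) ^ 1 - g (gam t) * (s * cis t) / (gam t - w) ^ 1)%C
      with ((u n (gam t) - g (gam t)) * (s * cis t) * / (gam t - w))%C by (simpl; field; exact N).
    rewrite !Cmod_mult, Cmod_cis, Cmod_R, Cmod_inv, Rabs_pos_eq by (assumption || lra).
    assert (I : / Cmod (gam t - w) <= / e) by (apply Rinv_le_contravar; [exact De | apply Dist]).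
    assert (I0 : 0 < / Cmod (gam t - w)) by (apply Rinv_0_lt_compat; specialize (Dist t); lra).
    specialize (Hn (gam t) ltac:(rewrite Hgam; lra)).
    replace (s / e * eps) with (eps * (s * 1) * / e) by (unfold Rdiv; ring).
    apply Rmult_le_compat; [ | lra | | exact I].
    + apply Rmult_le_pos; [apply Cmod_ge_0 | lra].
    + apply Rmult_le_compat_r; lra. }
exists (/ RtoC (2 * PI) * CInt (fun t => phi t / (gam t - z) ^ 2) 0 (2 * PI))%C.
eapply (cderiv_ext_loc _ _ z _ (s - Cmod (z - z0))); [lra | |].
{ intros w Hw; apply F.
  generalize (Cmod_triangle (w - z) (z - z0)).
  replace (w - z + (z - z0))%C with (w - z0)%C by ring; lra. }
apply cderiv_scal, (cderiv_cauchy_type_1 phi gam 0 (2 * PI) (s - Cmod (z - z0))); auto; try lra.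
intros t _; apply circle_dist; lra.
Qed.

Lemma segment_in_disc (z0 z w : C) (r x : R) : 0 <= x <= 1 ->
  Cmod (z - z0) < r -> Cmod (w - z0) < r -> Cmod (z + RtoC x * (w - z) - z0) < r.
Proof.
intros Hx Hz Hw.
replace (z + x * (w - z) - z0)%C with (RtoC (1 - x) * (z - z0) + RtoC x * (w - z0))%C
  by (rewrite RtoC_minus; ring).
eapply Rle_lt_trans; [apply Cmod_triangle|].
rewrite !Cmod_mult, !Cmod_R, !Rabs_pos_eq by lra.
(* One of the two weights is at least 1/2, which keeps the inequality strict. *)
destruct (Rle_dec x (1 / 2)); nra.
Qed.

(** Integration along rays from [z0] works: the increment from [z] to [w] is the integral over the
    segment between them, by Goursat on the triangle [z0], [z], [w], that is, for the curve
    [z - z0 + y (w - z)] with the side [x = 0] pinched to a vertex. Continuity of [G] at [z] then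
    gives the derivative. *)
Lemma holo_primitive (G : C -> C) (z0 : C) (r : R) : holo_disc G z0 r ->
  exists P, forall z, Cmod (z - z0) < r -> cderiv P z (G z).
Proof.
intros HG.
exists (fun z => CInt (fun x => G (z0 + RtoC x * (z - z0)) * (z - z0))%C 0 1).
intros z Hz.
assert (Hr : 0 < r) by (generalize (Cmod_ge_0 (z - z0)); lra).
assert (Hz0 : Cmod (z0 - z0) < r) by (rewrite Cmod_minus_diag; lra).
assert (Ex : forall w, Cmod (w - z0) < r ->
  ex_CInt (fun y => G (z + RtoC y * (w - z)) * (w - z))%C 0 1).
{ intros w Hw; apply ex_CInt_cont; [lra | intros y Hy].
  apply rcont_mult; [|apply rcont_const].
  apply (rcont_comp_holo G (fun y => z + RtoC y * (w - z))%C); [|rcont_arith].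
  apply HG; now apply segment_in_disc. }
assert (D : forall w, Cmod (w - z0) < r ->
  (CInt (fun x => G (z0 + RtoC x * (w - z0)) * (w - z0)) 0 1
   - CInt (fun x => G (z0 + RtoC x * (z - z0)) * (z - z0)) 0 1
   = CInt (fun y => G (z + RtoC y * (w - z)) * (w - z)) 0 1)%C).
{ intros w Hw.
  assert (T := goursat_star G z0 (fun y => (z - z0) + RtoC y * (w - z))%C (fun _ => (w - z)%C)
     0 1 0 1 (r + Cmod (w - z))).
  unfold radial, transversal in T; cbv beta in T.
  rewrite Cmult_0_l, Cmult_1_l, Cplus_0_r in T.
  replace (z - z0 + (w - z))%C with (w - z0)%C in T by ring.
  rewrite (CInt_ext (fun y => G (z0 + 0 * _) * _)%C (fun _ => RtoC 0)) in T
    by (lra || intros; ring).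
  rewrite CInt_const in T.
  rewrite (CInt_ext (fun y => G (z0 + 1 * _) * _)%C
      (fun y => G (z + RtoC y * (w - z)) * (w - z))%C) in T.
  2: lra.
  2:{ intros y _; rewrite !Cmult_1_l; do 2 f_equal; ring. }
  assert (T0 : forall a b c : C, (a + b - c - RtoC (1 - 0) * 0)%C = 0 -> (c - a)%C = b).
  { intros a b c E; apply Ceq_minus.
    transitivity (- (a + b - c - RtoC (1 - 0) * 0))%C; [ring | rewrite E; ring]. }
  apply T0, T; try lra.
  - generalize (Cmod_ge_0 (w - z)); lra.
  - intros y _; apply rderiv_star_radial.
  - intros y _; apply rcont_const.
  - intros y Hy.
    eapply Rle_trans; [apply Cmod_triangle|].
    rewrite Cmod_mult, Cmod_R, Rabs_pos_eq by lra.
    generalize (Cmod_ge_0 (w - z)); nra.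
  - intros y _; lra.
  - intros x y Hx Hy; apply HG.
    replace (z - z0 + y * (w - z))%C with (z + y * (w - z) - z0)%C by ring.
    apply segment_in_disc; [exact Hx | exact Hz0|].
    now apply segment_in_disc. }
apply cderiv_iff; intros eps Heps.
destruct (HG z Hz) as [l Hl].
destruct (cderiv_cont G z l Hl eps Heps) as [d [Hd Kd]].
exists (Rmin d (r - Cmod (z - z0))); split; [apply Rmin_glb_lt; lra|].
intros w Hw.
assert (Hw1 := Rlt_le_trans _ _ _ Hw (Rmin_l _ _)).
assert (Hw2 := Rlt_le_trans _ _ _ Hw (Rmin_r _ _)).
assert (Hwr : Cmod (w - z0) < r).
{ generalize (Cmod_triangle (w - z) (z - z0)).
  replace (w - z + (z - z0))%C with (w - z0)%C by ring; lra. }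
rewrite D by exact Hwr.
replace ((w - z) * G z)%C with (CInt (fun _ => (w - z) * G z)%C 0 1)
  by (rewrite CInt_const, Rminus_0_r; ring).
assert (ExC : ex_CInt (fun _ => (w - z) * G z)%C 0 1)
  by (apply ex_CInt_cont; [lra | intros; apply rcont_const]).
rewrite <- CInt_minus by auto.
replace (eps * Cmod (w - z)) with ((1 - 0) * (eps * Cmod (w - z))) by ring.
apply CInt_bound; [lra | now apply (@ex_RInt_minus C_R_NormedModule); auto|].
intros y Hy.
replace (G (z + y * (w - z)) * (w - z) - (w - z) * G z)%C
  with ((G (z + y * (w - z)) - G z) * (w - z))%C by ring.
rewrite Cmod_mult; apply Rmult_le_compat_r; [apply Cmod_ge_0|].
left; apply Kd.
replace (z + y * (w - z) - z)%C with (y * (w - z))%C by ring.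
rewrite Cmod_mult, Cmod_R, Rabs_pos_eq by lra.
generalize (Cmod_ge_0 (w - z)); nra.
Qed.

(** * Exponential, logarithm and cosine lifts *)

Definition Cexp (z : C) : C := (RtoC (exp (Re z)) * cis (Im z))%C.

Lemma exp_le_mono (x y : R) : x <= y -> exp x <= exp y.
Proof. intros [H | ->]; [left; now apply exp_increasing | lra]. Qed.

Lemma Cmod_Cexp (z : C) : Cmod (Cexp z) = exp (Re z).
Proof.
unfold Cexp; rewrite Cmod_mult, Cmod_cis, Cmod_R, Rabs_pos_eq; [ring | left; apply exp_pos].
Qed.

Lemma Cexp_plus (z w : C) : Cexp (z + w) = (Cexp z * Cexp w)%C.
Proof.
unfold Cexp, cis; rewrite re_plus, im_plus, exp_plus, cos_plus, sin_plus.
apply injective_projections; simpl; ring.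
Qed.

Lemma Cexp_0 : Cexp 0 = 1.
Proof.
unfold Cexp, cis; simpl; rewrite exp_0, cos_0, sin_0; apply injective_projections; simpl; ring.
Qed.

Lemma Cexp_opp (z : C) : (Cexp z * Cexp (- z))%C = 1.
Proof. rewrite <- Cexp_plus, Cplus_opp_r; apply Cexp_0. Qed.

Lemma rderiv_Cexp_segment (z h : C) (t : R) :
  rderiv (fun t => Cexp (z + RtoC t * h)) t (h * Cexp (z + RtoC t * h))%C.
Proof.
apply rderiv_pair; simpl; unfold Re, Im; simpl; auto_derive; try easy; unfold Rminus; ring.
Qed.

Lemma Re_le_Cmod (z : C) : Re z <= Cmod z.
Proof. eapply Rle_trans; [apply Rle_abs | apply re_le_Cmod]. Qed.

(** The mean value inequality is used twice along the segment from [z] to [w]: to bound the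
    increments of [Cexp] by [K * |h|], then for [Cexp (z + t h) - t h Cexp z], whose derivative is
    [h] times such an increment. The remainder is therefore quadratic in [h]. *)
Lemma cderiv_Cexp (z : C) : cderiv Cexp z (Cexp z).
Proof.
apply cderiv_iff; intros eps Heps.
set (K := exp (Re z + 1)); assert (HK : 0 < K) by apply exp_pos.
exists (Rmin 1 (eps / K)); split; [apply Rmin_glb_lt; [lra | now apply Rdiv_lt_0_compat]|].
intros w Hw.
assert (Hw1 := Rlt_le_trans _ _ _ Hw (Rmin_l _ _)).
assert (Hw2 := Rlt_le_trans _ _ _ Hw (Rmin_r _ _)).
set (h := (w - z)%C) in *.
assert (Hh := Cmod_ge_0 h).
assert (B : forall t, 0 <= t <= 1 -> Cmod (h * Cexp (z + RtoC t * h)) <= Cmod h * K).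
{ intros t Ht; rewrite Cmod_mult, Cmod_Cexp.
  apply Rmult_le_compat_l; [exact Hh|].
  apply exp_le_mono; rewrite re_plus, re_scal_l.
  generalize (Re_le_Cmod h); nra. }
assert (D1 : forall t, 0 <= t <= 1 -> Cmod (Cexp (z + RtoC t * h) - Cexp z) <= Cmod h * K).
{ intros t Ht.
  replace (Cexp z) with (Cexp (z + RtoC 0 * h)) by (f_equal; ring).
  apply Rle_trans with (Cmod h * K * (t - 0)).
  - apply (mean_value_ineq (fun t => Cexp (z + RtoC t * h))
      (fun t => h * Cexp (z + RtoC t * h))%C); [lra | |].
    + intros x _; apply rderiv_Cexp_segment.
    + intros x Hx; apply B; lra.
  - assert (0 <= Cmod h * K) by (apply Rmult_le_pos; lra); nra. }
replace (Cexp w - Cexp z - h * Cexp z)%C with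
 ((Cexp (z + RtoC 1 * h) - RtoC 1 * (h * Cexp z)) - (Cexp (z + RtoC 0 * h) - RtoC 0 * (h * Cexp z)))%C.
2:{ replace (z + 1 * h)%C with w by (unfold h; ring).
    replace (z + 0 * h)%C with z by ring; ring. }
apply Rle_trans with (Cmod h * (Cmod h * K) * (1 - 0)).
- apply (mean_value_ineq (fun t => Cexp (z + RtoC t * h) - RtoC t * (h * Cexp z))%C
    (fun t => h * Cexp (z + RtoC t * h) - h * Cexp z)%C); [lra | |].
  + intros x _; apply (@is_derive_minus R_AbsRing C_R_NormedModule);
    [apply rderiv_Cexp_segment|].
    eapply (@is_derive_ext R_AbsRing C_R_NormedModule); [|apply (rderiv_star_radial 0)].
    intros t; apply Cplus_0_l.
  + intros x Hx.
    replace (h * Cexp (z + x * h) - h * Cexp z)%C with (h * (Cexp (z + x * h) - Cexp z))%C by ring.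
    rewrite Cmod_mult; apply Rmult_le_compat_l; [exact Hh | now apply D1].
- apply Rmult_lt_compat_r with (r := K) in Hw2; [|exact HK].
  replace (eps / K * K) with eps in Hw2 by (field; lra).
  nra.
Qed.

Lemma cis_surjective (x y : R) : x * x + y * y = 1 -> exists t, cis t = (x, y) /\ Rabs t <= PI.
Proof.
intros E.
assert (Hx : -1 <= x <= 1) by nra.
generalize (acos_bound x); intros B.
assert (S : sqrt (1 - x ^ 2) = Rabs y).
{ rewrite <- sqrt_Rsqr_abs; f_equal; unfold Rsqr; simpl; lra. }
destruct (Rle_dec 0 y) as [Hy | Hy].
- exists (acos x); split; [|apply Rabs_le; lra].
  unfold cis; rewrite cos_acos, sin_acos by exact Hx.
  f_equal; unfold Rsqr; replace (1 - x * x) with (1 - x ^ 2) by ring.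
  rewrite S, Rabs_pos_eq; lra.
- exists (- acos x); split; [|apply Rabs_le; lra].
  unfold cis; rewrite cos_neg, sin_neg, cos_acos, sin_acos by exact Hx.
  f_equal; unfold Rsqr; replace (1 - x * x) with (1 - x ^ 2) by ring.
  rewrite S, Rabs_left; lra.
Qed.

(** Polar coordinates with an argument in [[- PI, PI]]; the size of the logarithm is recorded
    because it enters Schottky's constant. *)
Lemma Cexp_surjective (u : C) : u <> 0 ->
  exists v, Cexp v = u /\ Cmod v <= Rabs (ln (Cmod u)) + PI.
Proof.
intros Hu; assert (P := proj1 (Cmod_gt_0 u) Hu).
destruct (cis_surjective (Re u / Cmod u) (Im u / Cmod u)) as [t [Et Bt]].
{ replace (Re u / Cmod u * (Re u / Cmod u) + Im u / Cmod u * (Im u / Cmod u))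
    with ((Re u * Re u + Im u * Im u) / (Cmod u * Cmod u)) by (field; lra).
  rewrite <- Cmod_sqr; field; lra. }
exists (ln (Cmod u), t); split.
- unfold Cexp; simpl; rewrite exp_ln, Et by exact P.
  apply injective_projections; simpl; unfold Re, Im; field; lra.
- eapply Rle_trans; [apply Cmod_le_Re_Im|]; simpl; lra.
Qed.

Lemma lipschitz_disc (f f' : C -> C) (z0 z : C) (r M : R) :
  (forall w, Cmod (w - z0) < r -> cderiv f w (f' w)) ->
  (forall w, Cmod (w - z0) < r -> Cmod (f' w) <= M) ->
  Cmod (z - z0) < r -> Cmod (f z - f z0) <= M * Cmod (z - z0).
Proof.
intros Hf HM Hz.
assert (Hr : 0 < r) by (generalize (Cmod_ge_0 (z - z0)); lra).
assert (Hseg : forall t, 0 <= t <= 1 -> Cmod (z0 + RtoC t * (z - z0) - z0) < r).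
{ intros t Ht; apply segment_in_disc; [exact Ht | rewrite Cmod_minus_diag; lra | exact Hz]. }
replace (f z) with (f (z0 + RtoC 1 * (z - z0)))%C by (f_equal; ring).
replace (f z0) with (f (z0 + RtoC 0 * (z - z0)))%C by (f_equal; ring).
apply Rle_trans with (M * Cmod (z - z0) * (1 - 0)); [|lra].
apply (mean_value_ineq (fun t => f (z0 + RtoC t * (z - z0)))%C
  (fun t => f' (z0 + RtoC t * (z - z0)) * (z - z0))%C); [lra | |].
- intros t Ht; apply rderiv_comp; [now apply Hf, Hseg | apply rderiv_star_radial].
- intros t Ht; rewrite Cmod_mult; apply Rmult_le_compat_r; [apply Cmod_ge_0 | now apply HM, Hseg].
Qed.

(** A primitive of [f' / f], normalised to [v0] at the centre, works because [f * exp (- L)] has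
    derivative zero and equals 1 at the centre. Prescribing [v0] lets the size of the branch be
    controlled there. *)
Lemma holo_log (f : C -> C) (z0 v0 : C) (r : R) :
  holo_disc f z0 r -> (forall w, Cmod (w - z0) < r -> f w <> 0) -> Cexp v0 = f z0 ->
  exists L, holo_disc L z0 r /\ L z0 = v0 /\ forall w, Cmod (w - z0) < r -> Cexp (L w) = f w.
Proof.
intros Hf Hn Ev.
destruct (holo_primitive (fun w => C_derive f w / f w)%C z0 r) as [P HP].
{ intros w Hw; destruct (holo_C_derive f z0 r Hf w Hw) as [l1 D1]; destruct (Hf w Hw) as [l2 D2].
  eexists; apply (cderiv_mult (C_derive f) (fun w => / f w)%C); [exact D1|].
  apply cderiv_inv; [exact D2 | now apply Hn]. }
set (L := fun w => (v0 - P z0 + P w)%C).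
assert (HL : forall w, Cmod (w - z0) < r -> cderiv L w (C_derive f w / f w)%C).
{ intros w Hw; eapply cderiv_ext.
  - apply cderiv_plus; [apply cderiv_const | now apply HP].
  - ring. }
exists L; repeat split.
- intros w Hw; eexists; now apply HL.
- unfold L; ring.
- intros w Hw.
  set (q := fun w => (f w * Cexp (- (1) * L w))%C).
  assert (Dq : forall x, Cmod (x - z0) < r -> cderiv q x (RtoC 0)).
  { intros x Hx; specialize (Hn x Hx); eapply cderiv_ext.
    - apply cderiv_mult; [now apply C_derive_spec, Hf|].
      apply (cderiv_comp Cexp (fun w => - (1) * L w)%C); [apply cderiv_Cexp|].
      apply cderiv_scal; now apply HL.
    - cbv beta; field; exact Hn. }
  assert (E : q w = q z0).
  { apply Ceq_minus, Cmod_eq_0, Rle_antisym; [|apply Cmod_ge_0].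
    replace 0 with (0 * Cmod (w - z0)) by ring.
    apply (lipschitz_disc q (fun _ => RtoC 0) z0 w r); [exact Dq | | exact Hw].
    intros; rewrite Cmod_0; lra. }
  unfold q in E.
  replace (- (1) * L w)%C with (- L w)%C in E by ring.
  replace (- (1) * L z0)%C with (- v0)%C in E by (unfold L; ring).
  rewrite <- Ev, Cexp_opp in E.
  transitivity (Cexp (L w) * (f w * Cexp (- L w)))%C; [rewrite E; ring|].
  transitivity (f w * (Cexp (L w) * Cexp (- L w)))%C; [ring|].
  rewrite Cexp_opp; ring.
Qed.

Lemma holo_sqrt (f : C -> C) (z0 : C) (r : R) : 0 < r ->
  holo_disc f z0 r -> (forall w, Cmod (w - z0) < r -> f w <> 0) ->
  exists s, holo_disc s z0 r /\ forall w, Cmod (w - z0) < r -> (s w * s w)%C = f w.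
Proof.
intros Hr Hf Hn.
destruct (Cexp_surjective (f z0)) as [v [Ev _]]; [apply Hn; now rewrite Cmod_minus_diag|].
destruct (holo_log f z0 v r Hf Hn Ev) as [L [HL [_ EL]]].
exists (fun w => Cexp (/ 2 * L w)); split.
- intros w Hw; destruct (HL w Hw) as [l Dl].
  eexists; apply (cderiv_comp Cexp (fun w => / 2 * L w)%C); [apply cderiv_Cexp|].
  apply cderiv_scal, Dl.
- intros w Hw; rewrite <- Cexp_plus, <- EL by exact Hw; f_equal; field.
Qed.

Definition Ccos (z : C) : C := ((Cexp (Ci * z) + Cexp (- (Ci * z))) / 2)%C.

Lemma ln_abs_bound (u k : R) : 0 < u -> u <= 1 + k -> / u <= 1 + k -> Rabs (ln u) <= k.
Proof.
intros Hu H1 H2.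
assert (Hv : 0 < / u) by now apply Rinv_0_lt_compat.
assert (B : forall x, 0 < x -> x <= 1 + k -> ln x <= k).
{ intros x Hx Hxk; rewrite <- (ln_exp k); apply ln_le; [exact Hx|].
  generalize (exp_ineq1_le k); lra. }
apply Rabs_le; split; [|now apply B].
generalize (B _ Hv H2); rewrite ln_Rinv by exact Hu; lra.
Qed.

(* Inverting [Ccos F = f] means [Cexp (Ci F) = f + s] with [s^2 = f^2 - 1]; both [f + s] and
   its inverse [f - s] are bounded in terms of [f], hence so is a branch of the logarithm. *)
Lemma holo_Ccos_lift (f : C -> C) (z0 : C) (r : R) : 0 < r ->
  holo_disc f z0 r ->
  (forall w, Cmod (w - z0) < r -> f w <> 1 /\ f w <> (- (1))%C) ->
  exists F, holo_disc F z0 r /\ (forall w, Cmod (w - z0) < r -> Ccos (F w) = f w) /\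
    Cmod (F z0) <= 2 * Cmod (f z0) + PI.
Proof.
intros Hr Hf Hn.
destruct (holo_sqrt (fun w => f w * f w - 1)%C z0 r Hr) as [s [Hs Es]].
{ intros w Hw; destruct (Hf w Hw) as [l Dl]; eexists.
  apply cderiv_minus; [apply cderiv_mult; exact Dl | apply cderiv_const]. }
{ intros w Hw E; destruct (Hn w Hw) as [N1 N2].
  replace (f w * f w - 1)%C with ((f w - 1) * (f w + 1))%C in E by ring.
  revert E; apply Cmult_neq_0; intros E.
  - apply N1; now apply Ceq_minus.
  - apply N2; apply Ceq_minus; rewrite <- E; ring. }
cbv beta in Es.
assert (Eu : forall w, Cmod (w - z0) < r -> ((f w + s w) * (f w - s w))%C = 1).
{ intros w Hw; transitivity (f w * f w - s w * s w)%C; [ring | rewrite Es by exact Hw; ring]. }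
assert (Nu : forall w, Cmod (w - z0) < r -> (f w + s w)%C <> 0).
{ intros w Hw E; apply C1_nz; rewrite <- (Eu w Hw), E; ring. }
assert (Hz0 : Cmod (z0 - z0) < r) by now rewrite Cmod_minus_diag.
destruct (Cexp_surjective (f z0 + s z0)%C (Nu z0 Hz0)) as [v [Ev Bv]].
destruct (holo_log (fun w => f w + s w)%C z0 v r) as [L [HL [EL0 EL]]]; [ | exact Nu | exact Ev|].
{ intros w Hw; destruct (Hf w Hw), (Hs w Hw); eexists; apply cderiv_plus; eassumption. }
assert (Ci2 : (Ci * Ci)%C = (- (1))%C) by (apply injective_projections; simpl; ring).
exists (fun w => - Ci * L w)%C; repeat split.
- intros w Hw; destruct (HL w Hw) as [l Dl]; eexists; apply cderiv_scal, Dl.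
- intros w Hw; unfold Ccos.
  replace (Ci * (- Ci * L w))%C with (- (Ci * Ci) * L w)%C by ring; rewrite Ci2.
  replace (- - (1) * L w)%C with (L w) by ring.
  assert (E2 : Cexp (- L w) = (f w - s w)%C).
  { transitivity (Cexp (- L w) * ((f w + s w) * (f w - s w)))%C; [rewrite Eu by exact Hw; ring|].
    rewrite <- EL at 1 by exact Hw.
    transitivity ((Cexp (L w) * Cexp (- L w)) * (f w - s w))%C; [ring|].
    rewrite Cexp_opp; ring. }
  rewrite EL, E2 by exact Hw; field.
- rewrite EL0, Cmod_mult, Cmod_opp, Cmod_Ci, Rmult_1_l.
  eapply Rle_trans; [exact Bv|]; apply Rplus_le_compat_r.
  set (m := Cmod (f z0)); assert (Hm : 0 <= m) by apply Cmod_ge_0.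
  (* From [s ^ 2 = f ^ 2 - 1]. Hence [f + s] and [f - s], inverse to each other, are both at most
     [1 + 2 * m] in modulus, which bounds the real logarithm by [2 * m]. *)
  assert (Bs : Cmod (s z0) <= m + 1).
  { assert (Q : Cmod (s z0) * Cmod (s z0) <= (m + 1) * (m + 1)).
    { rewrite <- Cmod_mult, Es by exact Hz0.
      eapply Rle_trans; [apply Cmod_triangle_minus|].
      rewrite Cmod_mult, Cmod_1; fold m; nra. }
    generalize (Cmod_ge_0 (s z0)); nra. }
  apply ln_abs_bound.
  + now apply Cmod_gt_0, Nu.
  + eapply Rle_trans; [apply Cmod_triangle|]; fold m; lra.
  + rewrite <- Cmod_inv by now apply Nu.
    replace (/ (f z0 + s z0))%C with (f z0 - s z0)%C.
    * eapply Rle_trans; [apply Cmod_triangle_minus|]; fold m; lra.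
    * transitivity ((f z0 - s z0) * ((f z0 + s z0) * / (f z0 + s z0)))%C.
      { rewrite Cinv_r by now apply Nu. ring. }
      transitivity ((f z0 + s z0) * (f z0 - s z0) * / (f z0 + s z0))%C; [ring|].
      rewrite Eu by exact Hz0; ring.
Qed.

Lemma Ccos_RtoC (x : R) : Ccos (RtoC x) = RtoC (cos x).
Proof.
unfold Ccos, Cexp, cis; simpl.
replace (0 * x - 1 * 0) with 0 by ring.
replace (0 * 0 + 1 * x) with x by ring.
rewrite Ropp_0, exp_0, cos_neg, sin_neg.
apply injective_projections; simpl; field.
Qed.

Lemma Cmod_Ccos_le (z : C) : Cmod (Ccos z) <= exp (Cmod z).
Proof.
unfold Ccos; rewrite Cmod_div by (apply RtoC_neq_0; lra).
rewrite Cmod_R, Rabs_pos_eq by lra.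
assert (B : forall w, Cmod w = Cmod z -> Cmod (Cexp w) <= exp (Cmod z)).
{ intros w <-; rewrite Cmod_Cexp; apply exp_le_mono, Re_le_Cmod. }
assert (M : Cmod (Ci * z) = Cmod z) by (rewrite Cmod_mult, Cmod_Ci; ring).
generalize (Cmod_triangle (Cexp (Ci * z)) (Cexp (- (Ci * z)))).
generalize (B (Ci * z)%C M) (B (- (Ci * z))%C ltac:(now rewrite Cmod_opp)); lra.
Qed.

(** On an interval of length 3 of nonnegative reals, cosh grows by at least 1, since [exp 3 >= 4],
    and so takes an integer value; evenness handles negative [y0]. *)
Lemma cosh_reaches_integer (y0 : R) : exists y, Rabs (y - y0) <= 3 /\ exists k : Z, cosh y = IZR k.
Proof.
assert (P : forall y0, 0 <= y0 -> exists y, y0 <= y <= y0 + 3 /\ exists k : Z, cosh y = IZR k).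
{ clear y0; intros y0 Hy.
  assert (G : cosh y0 + 1 <= cosh (y0 + 3)).
  { unfold cosh.
    assert (E1 : 1 <= exp y0) by (generalize (exp_ineq1_le y0); lra).
    assert (E2 : 4 <= exp 3) by (generalize (exp_ineq1_le 3); lra).
    assert (E3 : exp (- y0) <= 1).
    { rewrite exp_Ropp, <- Rinv_1; apply Rinv_le_contravar; lra. }
    rewrite exp_plus; generalize (exp_pos (- (y0 + 3))); nra. }
  destruct (archimed (cosh y0)) as [U1 U2].
  destruct (IVT_gen cosh y0 (y0 + 3) (IZR (up (cosh y0)))) as [y [Hy1 Hy2]].
  - intros x; apply derivable_continuous_pt, derivable_pt_cosh.
  - rewrite Rmin_left, Rmax_right by lra; lra.
  - rewrite Rmin_left, Rmax_right in Hy1 by lra.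
    exists y; split; [exact Hy1 | now exists (up (cosh y0))]. }
destruct (Rle_dec 0 y0) as [Hy | Hy].
- destruct (P y0 Hy) as [y [B Hk]]; exists y; split; [apply Rabs_le; lra | exact Hk].
- destruct (P (- y0) ltac:(lra)) as [y [B [k Hk]]]; exists (- y); split; [apply Rabs_le; lra|].
  exists k; rewrite <- Hk; unfold cosh; rewrite Ropp_involutive; lra.
Qed.

(* The points [2 k pi + i y] with [cosh y] an integer. *)
Lemma Ccos_integer_net (z : C) : exists p, Cmod (p - z) <= 11 /\ exists k : Z, Ccos p = RtoC (IZR k).
Proof.
destruct (cosh_reaches_integer (Im z)) as [y [By [k Hk]]].
generalize PI_RGT_0 PI_4; intros P1 P2.
destruct (archimed (Re z / (2 * PI))) as [U1 U2].
set (m := up (Re z / (2 * PI))) in *.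
exists (2 * (IZR m * PI), y); split.
- eapply Rle_trans; [apply Cmod_le_Re_Im|]; simpl.
  (* 8 bounds the horizontal period [2 * PI], since [up] overshoots by at most one period; 3 is the
     vertical displacement. *)
  replace 11 with (8 + 3) by ring; apply Rplus_le_compat; [|exact By].
  unfold Re in *; set (x := fst z) in *.
  assert (E : x = x / (2 * PI) * (2 * PI)) by (field; lra).
  apply Rabs_le; split; rewrite E; nra.
- exists k; rewrite <- Hk; unfold Ccos, Cexp, cis, cosh; simpl.
  assert (S0 : sin (IZR m * PI) = 0) by (apply sin_eq_0_1; now exists m).
  assert (S2 : sin (2 * (IZR m * PI)) = 0) by (rewrite sin_2a, S0; ring).
  assert (C2 : cos (2 * (IZR m * PI)) = 1) by (rewrite cos_2a_sin, S0; ring).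
  replace (0 * (2 * (IZR m * PI)) - 1 * y) with (- y) by ring.
  replace (0 * y + 1 * (2 * (IZR m * PI))) with (2 * (IZR m * PI)) by ring.
  rewrite cos_neg, sin_neg, S2, C2, Ropp_involutive.
  apply injective_projections; simpl; field.
Qed.

(** * The theorems of Bloch and Schottky *)

Lemma holo_disc_near (z0 z w : C) (r s : R) :
  Cmod (z - z0) + s <= r -> Cmod (w - z) < s -> Cmod (w - z0) < r.
Proof.
intros H Hw; generalize (Cmod_triangle (w - z) (z - z0)).
replace (w - z + (z - z0))%C with (w - z0)%C by ring; lra.
Qed.

(** Write [A] for the modulus of the derivative at [p]. Cauchy's estimate bounds the second
    derivative by [8 * A / t], so the derivative varies by at most [A / 4] within [t / 32], and on
    the circle of radius [t / 64] the map moves by at least three quarters of its linear part. An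
    omitted [v] close to [h p] would make [/ (h - v)] larger at the centre than on the circle. *)
Lemma bloch_local (h : C -> C) (p : C) (t : R) : 0 < t ->
  holo_disc h p t -> 0 < Cmod (C_derive h p) ->
  (forall w, Cmod (w - p) < t -> Cmod (C_derive h w) <= 4 * Cmod (C_derive h p)) ->
  forall v, Cmod (v - h p) < t * Cmod (C_derive h p) / 256 ->
  exists w, Cmod (w - p) < t /\ h w = v.
Proof.
intros Ht Hh HA HB v Hv.
set (A := Cmod (C_derive h p)) in *.
assert (Hh' := holo_C_derive h p t Hh).
assert (Hpp : Cmod (p - p) = 0) by apply Cmod_minus_diag.
assert (H2 : forall w, Cmod (w - p) < t / 2 -> Cmod (C_derive (C_derive h) w) <= 8 * A / t).
{ intros w Hw.
  assert (E : Cmod (C_derive (C_derive h) w) * (t / 2) <= 4 * A).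
  { apply cauchy_estimate; [lra | |]; intros x Hx; [apply Hh' | apply HB];
    generalize (Cmod_triangle (x - w) (w - p));
    replace (x - w + (w - p))%C with (x - p)%C by ring; lra. }
  apply Rmult_le_reg_r with (t / 2); [lra|].
  replace (8 * A / t * (t / 2)) with (4 * A) by (field; lra); exact E. }
assert (H1 : forall w, Cmod (w - p) < t / 32 -> Cmod (C_derive h w - C_derive h p) <= A / 4).
{ intros w Hw.
  apply Rle_trans with (8 * A / t * Cmod (w - p)).
  - apply (lipschitz_disc (C_derive h) (C_derive (C_derive h)) p w (t / 2)); [| exact H2 | lra].
    intros x Hx; apply C_derive_spec, Hh'; lra.
  - replace (A / 4) with (8 * A / t * (t / 32)) by (field; lra).
    apply Rmult_le_compat_l; [|lra].
    apply Rmult_le_pos; [lra | left; now apply Rinv_0_lt_compat]. }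
assert (H0 : forall w, Cmod (w - p) = t / 64 -> 3 / 4 * A * (t / 64) <= Cmod (h w - h p)).
{ intros w Hw.
  set (k := fun w => (h w - C_derive h p * (w - p))%C).
  assert (L : Cmod (k w - k p) <= A / 4 * Cmod (w - p)).
  { apply (lipschitz_disc k (fun w => C_derive h w - C_derive h p)%C p w (t / 32)); [| exact H1 | lra].
    intros x Hx; eapply cderiv_ext.
    - apply cderiv_minus; [apply C_derive_spec, Hh; lra|].
      apply cderiv_scal, cderiv_minus; [apply cderiv_id | apply cderiv_const].
    - ring. }
  unfold k in L.
  replace (h w - C_derive h p * (w - p) - (h p - C_derive h p * (p - p)))%C
    with ((h w - h p) - C_derive h p * (w - p))%C in L by ring.
  generalize (Cmod_triangle_rev (C_derive h p * (w - p)) (h w - h p)).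
  rewrite (Cmod_minus_sym (C_derive h p * _)), (Cmod_mult (C_derive h p)); fold A.
  rewrite Hw in *; lra. }
apply NNPP; intros Hno.
assert (Hv' : forall w, Cmod (w - p) < t -> (h w - v)%C <> 0).
{ intros w Hw E; apply Hno; exists w; split; [exact Hw | now apply Ceq_minus]. }
set (dl := 3 / 4 * A * (t / 64)) in *.
assert (Hdl : 0 < dl) by (unfold dl; repeat apply Rmult_lt_0_compat; lra).
(* [t * A / 256] is less than [dl / 2 = 3 * t * A / 512]; so [|h - v|] is at least [dl / 2] on the
   circle but smaller at its centre. *)
assert (Hvd : Cmod (v - h p) < dl / 2) by (unfold dl; nra).
assert (M : Cmod (/ (h p - v)) * (t / 64 - Cmod (p - p)) <= 2 / dl * (t / 64)).
{ apply (cauchy_modulus_bound (fun w => / (h w - v))%C p p (t / 64)); [lra | |].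
  - intros w Hw; destruct (Hh w ltac:(lra)) as [l Dl]; eexists.
    apply (cderiv_inv (fun w => h w - v)%C); [apply cderiv_minus; [exact Dl | apply cderiv_const]|].
    apply Hv'; lra.
  - intros w Hw; rewrite Cmod_inv by (apply Hv'; lra).
    replace (2 / dl) with (/ (dl / 2)) by (field; lra).
    apply Rinv_le_contravar; [lra|].
    generalize (H0 w Hw) (Cmod_triangle (h w - v) (v - h p)).
    replace (h w - v + (v - h p))%C with (h w - h p)%C by ring; lra. }
assert (N := Hv' p ltac:(lra)).
rewrite Hpp, Rminus_0_r, Cmod_inv in M by exact N.
apply Rmult_le_reg_r in M; [|lra].
assert (P : 0 < Cmod (h p - v)) by now apply Cmod_gt_0.
assert (Q : / Cmod (h p - v) > / (dl / 2)).
{ apply Rinv_lt_contravar; [apply Rmult_lt_0_compat; lra | rewrite Cmod_minus_sym; lra]. }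
replace (/ (dl / 2)) with (2 / dl) in Q by (field; lra); lra.
Qed.

Lemma circle_param (z0 w : C) (r : R) : 0 < r -> Cmod (w - z0) = r ->
  exists t, - PI <= t <= PI /\ w = (z0 + RtoC r * cis t)%C.
Proof.
intros Hr Hw.
destruct (cis_surjective (Re ((w - z0) / r)) (Im ((w - z0) / r))) as [t [Et Bt]].
{ rewrite <- Cmod_sqr, Cmod_div, Cmod_R, Rabs_pos_eq, Hw by (lra || apply RtoC_neq_0; lra).
  field; lra. }
exists t; split; [now apply Rabs_le_between|].
rewrite Et; change (Re ((w - z0) / r), Im ((w - z0) / r)) with
  (fst ((w - z0) / r)%C, snd ((w - z0) / r)%C).
rewrite <- surjective_pairing; field; apply RtoC_neq_0; lra.
Qed.

(* Bloch's theorem, applied at a point where [(r - |z - z0|) |G'(z)|] is at least half of its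
   supremum. *)
Lemma bloch_omitting_net (G : C -> C) (z0 : C) (R0 d : R) : 0 < R0 -> 0 < d ->
  holo_disc G z0 R0 ->
  (forall v, exists p, Cmod (p - v) <= d /\ forall w, Cmod (w - z0) < R0 -> G w <> p) ->
  Cmod (C_derive G z0) * R0 <= 2048 * d.
Proof.
intros HR Hd HG Hnet; generalize two_PI_pos; intros HPI.
(* The closed disc of radius [r] lies inside the domain, so the derivative is bounded on its
   boundary and the weighted supremum [S] is finite. *)
set (r := R0 / 2); assert (Hr : 0 < r) by (unfold r; lra).
assert (HG' := holo_C_derive G z0 R0 HG).
assert (H00 : Cmod (z0 - z0) = 0) by apply Cmod_minus_diag.
destruct (rcont_bounded (fun t => C_derive G (z0 + RtoC r * cis t)) (- PI) PI) as [M [HM BM]]; [lra | |].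
{ intros t _; apply (rcont_comp_holo (C_derive G) (fun t => z0 + RtoC r * cis t)%C), rcont_circle.
  apply HG'; rewrite circle_radius; unfold r; lra. }
set (E := fun x => exists z, Cmod (z - z0) < r /\ x = Cmod (C_derive G z) * (r - Cmod (z - z0))).
destruct (completeness E) as [S [US LS]].
{ exists (M * r); intros x [z [Hz ->]].
  apply cauchy_modulus_bound; [exact Hz | |].
  - intros w Hw; apply HG'; unfold r in *; lra.
  - intros w Hw.
    destruct (circle_param z0 w r Hr Hw) as [t [Ht ->]]; now apply BM. }
{ exists (Cmod (C_derive G z0) * (r - Cmod (z0 - z0))), z0; split; [lra | reflexivity]. }
assert (S0 : Cmod (C_derive G z0) * r <= S).
{ apply US; exists z0; split; [lra | rewrite H00; ring]. }
(* A near-maximal point gives [t * A > S / 4], so the covered disc has radius above [S / 1024]; it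
   would meet the net if [S] exceeded [1024 * d]. Passing from [r] to [R0] doubles the constant. *)
assert (Hbig : S <= 1024 * d).
2:{ unfold r in S0; lra. }
apply Rnot_lt_le; intros HS.
assert (exists p, Cmod (p - z0) < r /\ S / 2 < Cmod (C_derive G p) * (r - Cmod (p - z0))) as [p [Hp HpS]].
{ apply NNPP; intros Hno.
  assert (S <= S / 2); [|lra].
  apply LS; intros x [z [Hz ->]]; apply Rnot_lt_le; intros Hlt; apply Hno; now exists z. }
(* Within [t], half the distance from [p] to the circle, the weight stays at least [t]; the
   derivative is then at most [S / t < 4 * A], as [bloch_local] demands. *)
set (t := (r - Cmod (p - z0)) / 2); assert (Ht : 0 < t) by (unfold t; lra).
set (A := Cmod (C_derive G p)) in *.
assert (HtA : S / 2 < 2 * (t * A)) by (unfold t; lra).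
assert (HA : 0 < A) by (generalize (Cmod_ge_0 (C_derive G p)); fold A; nra).
destruct (Hnet (G p)) as [v [Hv1 Hv2]].
destruct (bloch_local G p t Ht) with (v := v) as [w [Hw Ew]].
- apply (holo_disc_sub G z0 p R0); [unfold t, r in *; lra | exact HG].
- exact HA.
- intros w Hw; fold A.
  assert (Dw : t <= r - Cmod (w - z0)).
  { generalize (Cmod_triangle (w - p) (p - z0)).
    replace (w - p + (p - z0))%C with (w - z0)%C by ring; unfold t in *; lra. }
  assert (Q : Cmod (C_derive G w) * (r - Cmod (w - z0)) <= S).
  { apply US; exists w; split; [lra | reflexivity]. }
  generalize (Cmod_ge_0 (C_derive G w)); intros; nra.
- fold A; lra.
- apply (Hv2 w); [|exact Ew].
  apply (holo_disc_near z0 p w R0 t); [unfold t, r in *; lra | exact Hw].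
Qed.

Lemma schottky_01 (M : R) : exists K, forall (f : C -> C) (z0 : C) (r : R),
  0 < r -> holo_disc f z0 r ->
  (forall w, Cmod (w - z0) < r -> f w <> 0 /\ f w <> 1) ->
  Cmod (f z0) <= M ->
  forall z, Cmod (z - z0) < r / 2 -> Cmod (f z) <= K.
Proof.
generalize PI2_1 PI_4; intros PI1 PI4.
(* 22528 is 2048 * 11, with 11 the mesh of the net, and bounds the variation of [G] on the half
   disc. Each lift turns a bound [m] at the centre into [2 * m + PI]: from [2 * M + 1] to
   [4 * M + 6], then to [8 * M + 16], using [PI <= 4]. *)
set (B := 22528 + (8 * M + 16)).
exists ((exp (4 * exp B) + 1) / 2); intros f z0 r Hr Hf Hn HM z Hz.
assert (Hz00 : Cmod (z0 - z0) < r) by (rewrite Cmod_minus_diag; lra).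
assert (HPI : RtoC PI <> 0) by (apply RtoC_neq_0; lra).
destruct (holo_Ccos_lift (fun w => 2 * f w - 1)%C z0 r Hr) as [F [HF [EF BF]]].
{ intros w Hw; destruct (Hf w Hw) as [l Dl]; eexists.
  apply cderiv_minus; [apply cderiv_scal, Dl | apply cderiv_const]. }
{ intros w Hw; destruct (Hn w Hw) as [N0 N1]; split; intros E.
  - apply N1; transitivity ((2 * f w - 1 + 1) / 2)%C; [field | rewrite E; field].
  - apply N0; transitivity ((2 * f w - 1 + 1) / 2)%C; [field | rewrite E; field]. }
cbv beta in BF, EF.
(* At a multiple of [PI] the cosine is 1 or -1, so [f] would be 1 or 0. The multiples 1 and -1
   permit the second lift; the general case yields the net. *)
assert (Hint : forall w (k : Z), Cmod (w - z0) < r -> F w <> RtoC (IZR k * PI)).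
{ intros w k Hw E; specialize (EF w Hw); rewrite E, Ccos_RtoC in EF.
  destruct (Hn w Hw) as [N0 N1].
  assert (S : sin (IZR k * PI) = 0) by (apply sin_eq_0_1; now exists k).
  assert (C1 : cos (IZR k * PI) = 1 \/ cos (IZR k * PI) = -1).
  { generalize (sin2_cos2 (IZR k * PI)); rewrite S; unfold Rsqr; intros Q.
    assert (P : (cos (IZR k * PI) - 1) * (cos (IZR k * PI) + 1) = 0) by lra.
    apply Rmult_integral in P; destruct P; [left | right]; lra. }
  assert (Ef : f w = ((RtoC (cos (IZR k * PI)) + 1) / 2)%C) by (rewrite EF; field).
  destruct C1 as [C1 | C1]; rewrite C1 in Ef.
  - apply N1; rewrite Ef; field.
  - apply N0; rewrite Ef; apply injective_projections; simpl; field. }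
destruct (holo_Ccos_lift (fun w => / RtoC PI * F w)%C z0 r Hr) as [G [HG [EG BG]]].
{ intros w Hw; destruct (HF w Hw) as [l Dl]; eexists; apply cderiv_scal, Dl. }
{ intros w Hw; split; intros E.
  - apply (Hint w 1%Z Hw); rewrite RtoC_mult, <- E; field; exact HPI.
  - apply (Hint w (-1)%Z Hw); rewrite RtoC_mult.
    replace (RtoC (IZR (-1))) with (- (1))%C by (apply injective_projections; simpl; ring).
    rewrite <- E; field; exact HPI. }
cbv beta in BG, EG.
assert (BF' : Cmod (/ RtoC PI * F z0) <= 4 * M + 6).
{ assert (X : Cmod (F z0) <= 4 * M + 6).
  { eapply Rle_trans; [exact BF|].
    assert (Cmod (2 * f z0 - 1) <= 2 * M + 1); [|lra].
    eapply Rle_trans; [apply Cmod_triangle_minus|].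
    rewrite Cmod_mult, Cmod_R, Cmod_1, Rabs_pos_eq by lra; lra. }
  rewrite Cmod_mult, Cmod_inv, Cmod_R, Rabs_pos_eq by (exact HPI || lra).
  assert (I : 0 < / PI <= 1).
  { split; [apply Rinv_0_lt_compat; lra | rewrite <- Rinv_1; apply Rinv_le_contravar; lra]. }
  generalize (Cmod_ge_0 (F z0)); nra. }
assert (HG0 : Cmod (G z0) <= 8 * M + 16) by lra.
assert (HG' : forall w, Cmod (w - z0) < r / 2 -> Cmod (C_derive G w) <= 2048 * 11 / (r / 2)).
{ intros w Hw.
  assert (Q : Cmod (C_derive G w) * (r / 2) <= 2048 * 11).
  { apply bloch_omitting_net; try lra.
    - apply (holo_disc_sub G z0 w r); [lra | exact HG].
    - intros v; destruct (Ccos_integer_net v) as [p [Hp [k Hk]]].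
      exists p; split; [exact Hp | intros x Hx E].
      assert (Hx' : Cmod (x - z0) < r) by (apply (holo_disc_near z0 w x r (r / 2)); lra).
      apply (Hint x k Hx').
      rewrite <- E, EG in Hk by exact Hx'.
      rewrite RtoC_mult, <- Hk; field; exact HPI. }
  apply Rmult_le_reg_r with (r / 2); [lra|].
  unfold Rdiv at 2; rewrite Rmult_assoc, Rinv_l, Rmult_1_r by lra; exact Q. }
assert (HGz : Cmod (G z) <= B).
{ assert (L : Cmod (G z - G z0) <= 2048 * 11 / (r / 2) * Cmod (z - z0)).
  { apply (lipschitz_disc G (C_derive G) z0 z (r / 2)); [| exact HG' | exact Hz].
    intros w Hw; apply C_derive_spec, HG; lra. }
  assert (L2 : 2048 * 11 / (r / 2) * Cmod (z - z0) <= 22528).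
  { replace 22528 with (2048 * 11 / (r / 2) * (r / 2)) by (field; lra).
    apply Rmult_le_compat_l; [|lra].
    apply Rmult_le_pos; [lra | left; apply Rinv_0_lt_compat; lra]. }
  generalize (Cmod_triangle_rev (G z) (G z0)); unfold B; lra. }
assert (Hzr : Cmod (z - z0) < r) by lra.
assert (HFz : Cmod (F z) <= 4 * exp B).
{ replace (F z) with (RtoC PI * Ccos (G z))%C by (rewrite EG by exact Hzr; field; exact HPI).
  rewrite Cmod_mult, Cmod_R, Rabs_pos_eq by lra.
  apply Rmult_le_compat; [lra | apply Cmod_ge_0 | lra |].
  eapply Rle_trans; [apply Cmod_Ccos_le | now apply exp_le_mono]. }
replace (f z) with ((Ccos (F z) + 1) / 2)%C by (rewrite EF by exact Hzr; field).
rewrite Cmod_div, Cmod_R, (Rabs_pos_eq 2) by (lra || apply RtoC_neq_0; lra).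
apply Rmult_le_compat_r; [lra|].
eapply Rle_trans; [apply Cmod_triangle|].
rewrite Cmod_1; apply Rplus_le_compat_r.
eapply Rle_trans; [apply Cmod_Ccos_le | now apply exp_le_mono].
Qed.

(** The map [w |-> (w - a) / (b - a)] carries the omitted pair to 0 and 1. The constant is fixed
    before the function, the centre and the radius; this order lets the centre move and the bound be
    iterated along a chain of discs. *)
Lemma schottky (a b : C) (M : R) : a <> b ->
  exists K, forall (f : C -> C) (z0 : C) (r : R),
  0 < r -> holo_disc f z0 r ->
  (forall w, Cmod (w - z0) < r -> f w <> a /\ f w <> b) ->
  Cmod (f z0) <= M ->
  forall z, Cmod (z - z0) < r / 2 -> Cmod (f z) <= K.
Proof.
intros Hab.
assert (N : (b - a)%C <> 0) by (intros E; apply Hab; symmetry; now apply Ceq_minus).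
set (m := Cmod (b - a)); assert (Hm : 0 < m) by now apply Cmod_gt_0.
destruct (schottky_01 ((M + Cmod a) / m)) as [K HK].
exists (m * K + Cmod a); intros f z0 r Hr Hf Hn HM z Hz.
assert (Q : Cmod (/ (b - a) * (f z - a)) <= K).
{ apply (HK (fun w => / (b - a) * (f w - a))%C z0 r Hr); [ | | | exact Hz].
  - intros w Hw; destruct (Hf w Hw) as [l Dl]; eexists.
    apply cderiv_scal, cderiv_minus; [exact Dl | apply cderiv_const].
  - intros w Hw; destruct (Hn w Hw) as [Na Nb]; split; intros E.
    + apply Na, Ceq_minus.
      transitivity ((b - a) * (/ (b - a) * (f w - a)))%C; [field; exact N | rewrite E; ring].
    + apply Nb, Ceq_minus.
      transitivity ((b - a) * (/ (b - a) * (f w - a)) - (b - a))%C; [field; exact N | rewrite E; ring].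
  - rewrite Cmod_mult, Cmod_inv by exact N; fold m.
    rewrite Rmult_comm; apply Rmult_le_compat_r; [left; now apply Rinv_0_lt_compat|].
    eapply Rle_trans; [apply Cmod_triangle_minus | lra]. }
replace (f z) with ((b - a) * (/ (b - a) * (f z - a)) + a)%C by (field; exact N).
eapply Rle_trans; [apply Cmod_triangle|].
rewrite Cmod_mult; fold m; apply Rplus_le_compat_r, Rmult_le_compat_l; lra.
Qed.

(** * Montel's theorem for bounded families *)

Definition strict_mono (phi : nat -> nat) : Prop :=
  forall m n, (m < n)%nat -> (phi m < phi n)%nat.

Lemma strict_mono_step (phi : nat -> nat) :
  (forall n, (phi n < phi (S n))%nat) -> strict_mono phi.
Proof.
intros H m n; induction n as [|n IH]; [lia | intros Hm].
specialize (H n); destruct (Nat.eq_dec m n) as [-> | D]; [exact H|].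
assert (phi m < phi n)%nat by (apply IH; lia); lia.
Qed.

Lemma strict_mono_ge (phi : nat -> nat) (n : nat) : strict_mono phi -> (n <= phi n)%nat.
Proof.
intros H; induction n as [|n IH]; [lia|].
specialize (H n (S n) (Nat.lt_succ_diag_r n)); lia.
Qed.

Lemma strict_mono_comp (phi psi : nat -> nat) :
  strict_mono phi -> strict_mono psi -> strict_mono (fun n => phi (psi n)).
Proof. intros H1 H2 m n H; now apply H1, H2. Qed.

Lemma frequently_subsequence (P : nat -> nat -> Prop) :
  (forall k N, exists p, (N <= p)%nat /\ P k p) ->
  exists phi, strict_mono phi /\ forall k, P k (phi k).
Proof.
intros H.
destruct (functional_choice (fun (q : nat * nat) (p : nat) => (snd q <= p)%nat /\ P (fst q) p))
  as [pick Hp]; [intros [k N]; apply H|].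
pose (phi := fix phi k := match k with
  | O => pick (O, O) | S j => pick (S j, S (phi j)) end).
exists phi; split.
- apply strict_mono_step; intros n.
  exact (proj1 (Hp (S n, S (phi n)))).
- intros [|k]; [exact (proj2 (Hp (O, O))) | exact (proj2 (Hp (S k, S (phi k))))].
Qed.

Definition Ccauchy (u : nat -> C) : Prop :=
  forall eps, 0 < eps -> exists N, forall m n, (N <= m)%nat -> (N <= n)%nat ->
    Cmod (u m - u n) <= eps.

Lemma real_bounded_subsequence (u : nat -> R) (M : R) : (forall n, Rabs (u n) <= M) ->
  exists phi, strict_mono phi /\ exists l, forall eps, 0 < eps ->
    exists N, forall n, (N <= n)%nat -> Rabs (u (phi n) - l) <= eps.
Proof.
intros HM.
destruct (Bolzano_Weierstrass u (fun c => - M <= c <= M)) as [l Hl].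
{ apply compact_P3. }
{ intros n; now apply Rabs_le_between. }
destruct (frequently_subsequence (fun k p => Rabs (u p - l) < / INR (S k))) as [phi [Hphi H]].
{ intros k N; apply (Hl (fun x => Rabs (x - l) < / INR (S k)) N).
  assert (P : 0 < / INR (S k)) by (apply Rinv_0_lt_compat, lt_0_INR; lia).
  exists (mkposreal _ P); intros x Hx; exact Hx. }
exists phi; split; [exact Hphi|]; exists l; intros eps Heps.
destruct (archimed_cor1 eps Heps) as [N [HN HN0]].
exists N; intros n Hn; left.
eapply Rlt_le_trans; [apply H|].
apply Rle_trans with (/ INR N); [|lra].
apply Rinv_le_contravar; [now apply lt_0_INR | apply le_INR; lia].
Qed.

Lemma bounded_subsequence (u : nat -> C) (M : R) : (forall n, Cmod (u n) <= M) ->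
  exists phi, strict_mono phi /\ Ccauchy (fun n => u (phi n)).
Proof.
intros HM.
destruct (real_bounded_subsequence (fun n => Re (u n)) M) as [phi [Hphi [x Hx]]].
{ intros n; eapply Rle_trans; [apply re_le_Cmod | apply HM]. }
destruct (real_bounded_subsequence (fun n => Im (u (phi n))) M) as [psi [Hpsi [y Hy]]].
{ intros n; eapply Rle_trans; [|apply (HM (phi n))].
  eapply Rle_trans; [apply Rmax_r | apply Rmax_Cmod]. }
exists (fun n => phi (psi n)); split; [now apply strict_mono_comp|].
intros eps Heps.
destruct (Hx (eps / 4) ltac:(lra)) as [N1 H1], (Hy (eps / 4) ltac:(lra)) as [N2 H2].
exists (Nat.max N1 N2).
assert (D : forall n, (Nat.max N1 N2 <= n)%nat -> Cmod (u (phi (psi n)) - (x, y)) <= eps / 2).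
{ intros n Hn; eapply Rle_trans; [apply Cmod_le_Re_Im|].
  specialize (H1 (psi n)); specialize (H2 n ltac:(lia)).
  assert (Hn' := strict_mono_ge psi n Hpsi); specialize (H1 ltac:(lia)).
  simpl; unfold Re, Im in *; simpl.
  unfold Rminus in H1, H2; lra. }
intros m n Hm Hn.
replace (u (phi (psi m)) - u (phi (psi n)))%C with
  ((u (phi (psi m)) - (x, y)) - (u (phi (psi n)) - (x, y)))%C by ring.
eapply Rle_trans; [apply Cmod_triangle_minus|].
generalize (D m Hm) (D n Hn); lra.
Qed.

Lemma diagonal_subsequence (v : nat -> nat -> C) (M : R) : (forall k n, Cmod (v k n) <= M) ->
  exists phi, strict_mono phi /\ forall k, Ccauchy (fun n => v k (phi n)).
Proof.
intros HM.
destruct (functional_choice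
  (fun (q : nat * (nat -> nat)) (psi : nat -> nat) => strict_mono psi /\ Ccauchy (fun n => v (fst q) (snd q (psi n))))) as [pick Hp].
{ intros [k phi]; apply (bounded_subsequence (fun n => v k (phi n)) M); intros n; apply HM. }
pose (Phi := fix Phi k := match k with
  | O => fun n => pick (O, fun n => n) n
  | S j => fun n => Phi j (pick (S j, Phi j) n) end).
assert (HS : forall k, strict_mono (Phi k)).
{ induction k as [|k IH]; simpl; [exact (proj1 (Hp (O, _)))|].
  apply strict_mono_comp; [exact IH | exact (proj1 (Hp (S k, Phi k)))]. }
assert (HC : forall k, Ccauchy (fun n => v k (Phi k n))).
{ intros [|k]; [exact (proj2 (Hp (O, fun n => n))) | exact (proj2 (Hp (S k, Phi k)))]. }
(* Row [k + j] is a subsequence of row [k], its [n]-th entry sitting at a position at least [n]. So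
   from index [k] on the diagonal runs inside row [k], where [v k] is Cauchy. *)
assert (Hsub : forall k j n, exists p, (n <= p)%nat /\ Phi (k + j)%nat n = Phi k p).
{ intros k j; induction j as [|j IH]; intros n.
  - exists n; rewrite Nat.add_0_r; split; [lia | reflexivity].
  - rewrite Nat.add_succ_r; simpl.
    destruct (IH (pick (S (k + j), Phi (k + j)%nat) n)) as [p [Hp1 Hp2]].
    exists p; split; [|exact Hp2].
    generalize (strict_mono_ge _ n (proj1 (Hp (S (k + j), Phi (k + j)%nat)))); lia. }
exists (fun k => Phi k k); split.
- apply strict_mono_step; intros n; simpl.
  apply HS.
  generalize (strict_mono_ge _ (S n) (proj1 (Hp (S n, Phi n)))); lia.
- intros k eps Heps; destruct (HC k eps Heps) as [N HN].
  exists (Nat.max N k); intros m n Hm Hn.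
  destruct (Hsub k (m - k)%nat m) as [p [Hp1 Hp2]].
  destruct (Hsub k (n - k)%nat n) as [q [Hq1 Hq2]].
  replace (k + (m - k))%nat with m in Hp2 by lia.
  replace (k + (n - k))%nat with n in Hq2 by lia.
  rewrite Hp2, Hq2; apply HN; lia.
Qed.

(* The [k]-th Taylor coefficient at [z0], scaled by [r ^ k]. *)
Definition taylor_coef (z0 : C) (r : R) (h : C -> C) (k : nat) : C :=
  (/ RtoC (2 * PI) * CInt (fun t => h (z0 + RtoC r * cis t) * cis (- t) ^ k) 0 (2 * PI))%C.

Lemma rcont_pow (f : R -> C) (t : R) (k : nat) : rcont f t -> rcont (fun s => f s ^ k)%C t.
Proof.
intros H; induction k as [|k IH]; [apply rcont_const|].
exact (rcont_mult f (fun s => f s ^ k)%C t H IH).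
Qed.

Section TaylorCoefficients.

Variables (z0 : C) (r : R).
Hypothesis Hr : 0 < r.

Lemma rcont_on_circle (h : C -> C) (t : R) :
  (forall w, Cmod (w - z0) <= r -> holo_at h w) -> rcont (fun t => h (z0 + RtoC r * cis t)%C) t.
Proof.
intros Hh; apply rcont_comp_holo; [|apply rcont_circle].
apply Hh; rewrite circle_radius; lra.
Qed.

Lemma ex_CInt_taylor_coef (h : C -> C) (k : nat) :
  (forall w, Cmod (w - z0) <= r -> holo_at h w) ->
  ex_CInt (fun t => h (z0 + RtoC r * cis t) * cis (- t) ^ k)%C 0 (2 * PI).
Proof.
intros Hh; generalize two_PI_pos; intros HPI.
apply ex_CInt_cont; [lra | intros t _].
apply rcont_mult; [now apply rcont_on_circle | apply rcont_pow, rcont_cis_neg].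
Qed.

Lemma taylor_coef_bound (h : C -> C) (k : nat) (M : R) :
  (forall w, Cmod (w - z0) <= r -> holo_at h w) ->
  (forall w, Cmod (w - z0) = r -> Cmod (h w) <= M) -> Cmod (taylor_coef z0 r h k) <= M.
Proof.
intros Hh HM; generalize two_PI_pos; intros HPI; unfold taylor_coef.
rewrite Cmod_mult, Cmod_inv, Cmod_R, Rabs_pos_eq by (lra || apply RtoC_neq_0; lra).
apply Rmult_le_reg_l with (2 * PI); [exact HPI|].
rewrite <- Rmult_assoc, Rinv_r, Rmult_1_l by lra.
replace (2 * PI) with (2 * PI - 0) at 2 by ring.
apply CInt_bound; [lra | now apply ex_CInt_taylor_coef|].
intros t _; rewrite Cmod_mult, Cmod_pow, Cmod_cis, pow1, Rmult_1_r.
apply HM, circle_radius; lra.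
Qed.

Lemma taylor_coef_minus (f g : C -> C) (k : nat) :
  (forall w, Cmod (w - z0) <= r -> holo_at f w) ->
  (forall w, Cmod (w - z0) <= r -> holo_at g w) ->
  taylor_coef z0 r (fun w => f w - g w)%C k = (taylor_coef z0 r f k - taylor_coef z0 r g k)%C.
Proof.
intros Hf Hg; generalize two_PI_pos; intros HPI; unfold taylor_coef.
rewrite <- (CInt_ext (fun t => f (z0 + RtoC r * cis t) * cis (- t) ^ k
                          - g (z0 + RtoC r * cis t) * cis (- t) ^ k)%C) by (lra || intros; ring).
rewrite CInt_minus by now apply ex_CInt_taylor_coef.
ring.
Qed.

(* Expand the Cauchy kernel as [1 + u + ... + u^(N-1) + u^N / (1 - u)] with [|u| <= 1/2]. *)
Lemma small_coefs_small (h : C -> C) (z : C) (M eta : R) (N : nat) : 0 <= eta ->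
  (forall w, Cmod (w - z0) <= r -> holo_at h w) ->
  (forall w, Cmod (w - z0) = r -> Cmod (h w) <= M) ->
  (forall k, (k < N)%nat -> Cmod (taylor_coef z0 r h k) <= eta) ->
  Cmod (z - z0) <= r / 2 -> Cmod (h z) <= 2 * eta + 2 * M * (/ 2) ^ N.
Proof.
intros Heta Hh HM Hcoef Hz; generalize two_PI_pos; intros HPI.
assert (Hr0 : RtoC r <> 0) by (apply RtoC_neq_0; lra).
assert (NPI : RtoC (2 * PI) <> 0) by (apply RtoC_neq_0; lra).
assert (HM0 : 0 <= M).
{ eapply Rle_trans; [apply Cmod_ge_0 | apply (HM (z0 + RtoC r * cis 0)%C), circle_radius; lra]. }
set (a := ((z - z0) / RtoC r)%C).
assert (Ha : Cmod a <= / 2).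
{ unfold a; rewrite Cmod_div, Cmod_R, Rabs_pos_eq by (assumption || lra).
  apply Rmult_le_reg_r with r; [exact Hr|].
  unfold Rdiv; rewrite Rmult_assoc, Rinv_l; lra. }
assert (Hu : forall t, Cmod (a * cis (- t)) <= / 2).
{ intros t; rewrite Cmod_mult, Cmod_cis; lra. }
assert (Nu : forall t, (1 - a * cis (- t))%C <> 0).
{ intros t; apply one_minus_neq_0; specialize (Hu t); lra. }
(* [J n] is the remainder after [n] terms: [J 0] is [h z], and [u ^ n / (1 - u) = u ^ n + u ^ (n +
   1) / (1 - u)] splits off one coefficient. *)
set (J := fun n => (/ RtoC (2 * PI) * CInt (fun t => h (z0 + RtoC r * cis t)
     * ((a * cis (- t)) ^ n / (1 - a * cis (- t)))) 0 (2 * PI))%C).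
assert (ExJ : forall n, ex_CInt (fun t => h (z0 + RtoC r * cis t)
     * ((a * cis (- t)) ^ n / (1 - a * cis (- t))))%C 0 (2 * PI)).
{ intros n; apply ex_CInt_cont; [lra | intros t _].
  apply rcont_mult; [now apply rcont_on_circle|].
  apply rcont_mult; [|apply rcont_geometric; lra].
  apply rcont_pow; generalize (rcont_cis_neg t); intros; rcont_arith. }
assert (J0 : h z = J O).
{ rewrite (cauchy_formula_type h z0 z r) by (assumption || lra).
  unfold J; f_equal; apply CInt_ext; [lra | intros t _].
  assert (N1 := circle_neq z0 z r t ltac:(lra)).
  assert (N2 := cis_neq_0 t); specialize (Nu t).
  unfold a in *; rewrite cis_neg in *; simpl; field; repeat split; try assumption.
  intros E; apply N1; rewrite <- E; ring. }
assert (JS : forall n, J n = (a ^ n * taylor_coef z0 r h n + J (S n))%C).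
{ intros n; unfold J, taylor_coef.
  rewrite <- (CInt_ext (fun t => a ^ n * (h (z0 + RtoC r * cis t) * cis (- t) ^ n)
      + h (z0 + RtoC r * cis t) * ((a * cis (- t)) ^ S n / (1 - a * cis (- t))))%C).
  - rewrite (CInt_plus (fun t => a ^ n * (h (z0 + RtoC r * cis t) * cis (- t) ^ n))%C
       (fun t => h (z0 + RtoC r * cis t) * ((a * cis (- t)) ^ S n / (1 - a * cis (- t))))%C),
     (CInt_scal (a ^ n) (fun t => h (z0 + RtoC r * cis t) * cis (- t) ^ n)%C).
    + ring.
    + now apply ex_CInt_taylor_coef.
    + now apply (ex_CInt_scal (a ^ n)), ex_CInt_taylor_coef.
    + apply ExJ.
  - lra.
  - intros t _; rewrite Cpow_S, Cpow_mult_l; field; apply Nu. }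
assert (JB : forall n, Cmod (J n) <= 2 * M * (/ 2) ^ n).
{ intros n; unfold J.
  rewrite Cmod_mult, Cmod_inv, Cmod_R, Rabs_pos_eq by (lra || exact NPI).
  apply Rmult_le_reg_l with (2 * PI); [exact HPI|].
  rewrite <- Rmult_assoc, Rinv_r, Rmult_1_l by lra.
  replace (2 * PI) with (2 * PI - 0) at 2 by ring.
  apply CInt_bound; [lra | apply ExJ|].
  intros t _; rewrite Cmod_mult, Cmod_div, Cmod_pow by apply Nu.
  replace (2 * M * (/ 2) ^ n) with (M * ((/ 2) ^ n * 2)) by ring.
  apply Rmult_le_compat; [apply Cmod_ge_0 | | apply HM, circle_radius; lra|].
  - apply Rmult_le_pos; [apply pow_le, Cmod_ge_0 | left; apply Rinv_0_lt_compat, Cmod_gt_0, Nu].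
  - apply Rmult_le_compat; [apply pow_le, Cmod_ge_0 | | |].
    + left; apply Rinv_0_lt_compat, Cmod_gt_0, Nu.
    + apply pow_incr; split; [apply Cmod_ge_0 | apply Hu].
    + replace 2 with (/ / 2) by lra; apply Rinv_le_contravar; [lra|].
      generalize (Cmod_triangle_rev 1 (a * cis (- t))); rewrite Cmod_1; specialize (Hu t); lra. }
(* [2 - 2 * (/ 2) ^ n] is the partial sum of the geometric series of ratio 1/2. *)
assert (D : forall n, (n <= N)%nat -> Cmod (h z - J n) <= eta * (2 - 2 * (/ 2) ^ n)).
{ induction n as [|n IH]; intros Hn.
  - rewrite J0, Cmod_minus_diag; simpl; lra.
  - specialize (IH ltac:(lia)); specialize (Hcoef n ltac:(lia)).
    replace (h z - J (S n))%C with ((h z - J n) + a ^ n * taylor_coef z0 r h n)%C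
      by (rewrite (JS n); ring).
    eapply Rle_trans; [apply Cmod_triangle|].
    rewrite Cmod_mult, Cmod_pow.
    assert (Q : Cmod a ^ n * Cmod (taylor_coef z0 r h n) <= (/ 2) ^ n * eta).
    { apply Rmult_le_compat; [apply pow_le, Cmod_ge_0 | apply Cmod_ge_0 | | exact Hcoef].
      apply pow_incr; split; [apply Cmod_ge_0 | exact Ha]. }
    simpl; lra. }
replace (h z) with ((h z - J N) + J N)%C by ring.
eapply Rle_trans; [apply Cmod_triangle|].
generalize (D N (le_n N)) (JB N).
assert (0 < (/ 2) ^ N) by (apply pow_lt; lra); nra.
Qed.

End TaylorCoefficients.

(** The limit inherits every Cauchy estimate of the sequence, with the same [eps] and [N]. An
    estimate uniform over a set of points thus passes unchanged to the pointwise limits. *)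
Lemma Ccauchy_cv (u : nat -> C) : Ccauchy u ->
  exists l, forall eps N, (forall m n, (N <= m)%nat -> (N <= n)%nat -> Cmod (u m - u n) <= eps) ->
    forall n, (N <= n)%nat -> Cmod (u n - l) <= eps.
Proof.
intros H.
assert (B : exists M, forall n, Rabs (Re (u n)) <= M /\ Rabs (Im (u n)) <= M).
{ destruct (H 1 Rlt_0_1) as [N HN].
  assert (B0 : forall k, exists M, forall n, (n < k)%nat -> Cmod (u n) <= M).
  { induction k as [|k [M HM]]; [exists 0; lia|].
    exists (Rmax M (Cmod (u k))); intros n Hn.
    destruct (Nat.eq_dec n k) as [-> | D]; [apply Rmax_r|].
    eapply Rle_trans; [apply HM; lia | apply Rmax_l]. }
  destruct (B0 (S N)) as [M HM]; exists (M + 1); intros n.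
  assert (X : Cmod (u n) <= M + 1).
  { destruct (Compare_dec.le_lt_dec n N) as [L | L]; [specialize (HM n ltac:(lia)); lra|].
    specialize (HN n N ltac:(lia) (le_n N)); specialize (HM N ltac:(lia)).
    generalize (Cmod_triangle_rev (u n) (u N)); lra. }
  split; (eapply Rle_trans; [|exact X]); [apply re_le_Cmod|].
  eapply Rle_trans; [apply Rmax_r | apply Rmax_Cmod]. }
destruct B as [M HM].
destruct (real_bounded_subsequence (fun n => Re (u n)) M) as [phi [Hphi [x Hx]]]; [apply HM|].
destruct (real_bounded_subsequence (fun n => Im (u (phi n))) M) as [psi [Hpsi [y Hy]]];
  [intros; apply HM|].
exists (x, y); intros eps N HN n Hn.
apply le_epsilon; intros e He.
destruct (Hx (e / 2) ltac:(lra)) as [N1 H1], (Hy (e / 2) ltac:(lra)) as [N2 H2].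
set (p := Nat.max N (Nat.max N1 N2)).
assert (P1 := strict_mono_ge psi p Hpsi); assert (P2 := strict_mono_ge phi (psi p) Hphi).
specialize (H1 (psi p) ltac:(lia)); specialize (H2 p ltac:(lia)).
specialize (HN n (phi (psi p)) Hn ltac:(lia)).
replace (u n - (x, y))%C with ((u n - u (phi (psi p))) + (u (phi (psi p)) - (x, y)))%C by ring.
eapply Rle_trans; [apply Cmod_triangle|]; apply Rplus_le_compat; [exact HN|].
eapply Rle_trans; [apply Cmod_le_Re_Im|].
simpl; unfold Re, Im in *; simpl; unfold Rminus in H1, H2; lra.
Qed.

(** The scaled Taylor coefficients are bounded by [M], so a diagonal subsequence makes all of them
    Cauchy. For a difference of two members, finitely many small coefficients and a geometric tail
    control the values, so the subsequence is uniformly Cauchy. The radius is halved twice: for a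
    closed disc inside the domain, then for the ratio 1/2 in the expansion. *)
Lemma montel_bounded (u : nat -> C -> C) (z0 : C) (r M : R) : 0 < r ->
  (forall n, holo_disc (u n) z0 r) ->
  (forall n w, Cmod (w - z0) < r -> Cmod (u n w) <= M) ->
  exists phi, strict_mono phi /\ exists g, holo_disc g z0 (r / 4) /\
    forall eps, 0 < eps -> exists N, forall n, (N <= n)%nat ->
      forall w, Cmod (w - z0) < r / 4 -> Cmod (u (phi n) w - g w) <= eps.
Proof.
intros Hr Hu HM.
set (s := r / 2); assert (Hs : 0 < s < r) by (unfold s; lra).
assert (Hus : forall n w, Cmod (w - z0) <= s -> holo_at (u n) w)
  by (intros n w Hw; apply Hu; lra).
assert (HMs : forall n w, Cmod (w - z0) = s -> Cmod (u n w) <= M)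
  by (intros n w Hw; apply HM; lra).
assert (HM0 : 0 <= M).
{ eapply Rle_trans; [apply Cmod_ge_0 | apply (HM O z0); rewrite Cmod_minus_diag; lra]. }
destruct (diagonal_subsequence (fun k n => taylor_coef z0 s (u n) k) M) as [phi [Hphi HC]].
{ intros k n; apply taylor_coef_bound; [lra | apply Hus | apply HMs]. }
exists phi; split; [exact Hphi|].
assert (UC : forall eps, 0 < eps -> exists N, forall m n, (N <= m)%nat -> (N <= n)%nat ->
  forall w, Cmod (w - z0) < r / 4 -> Cmod (u (phi m) w - u (phi n) w) <= eps).
{ intros eps Heps.
  assert (HK : exists K, 2 * (2 * M) * (/ 2) ^ K <= eps / 2).
  { assert (Hd : 0 < eps / (8 * (M + 1))) by (apply Rdiv_lt_0_compat; lra).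
    destruct (pow_lt_1_zero (/ 2) ltac:(rewrite Rabs_pos_eq; lra) _ Hd) as [K HK].
    exists K; specialize (HK K (le_n K)).
    rewrite Rabs_pos_eq in HK by (apply pow_le; lra).
    assert (E : eps / (8 * (M + 1)) * (8 * (M + 1)) = eps) by (field; lra).
    assert (0 < (/ 2) ^ K) by (apply pow_lt; lra); nra. }
  destruct HK as [K HK].
  assert (HN : exists N, forall k, (k < K)%nat -> forall m n, (N <= m)%nat -> (N <= n)%nat ->
    Cmod (taylor_coef z0 s (u (phi m)) k - taylor_coef z0 s (u (phi n)) k) <= eps / 4).
  { clear HK; induction K as [|K [N IH]]; [exists O; lia|].
    destruct (HC K (eps / 4) ltac:(lra)) as [N' HN'].
    exists (Nat.max N N'); intros k Hk m n Hm Hn.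
    destruct (Nat.eq_dec k K) as [-> | D]; [apply HN' | apply IH]; lia. }
  destruct HN as [N HN]; exists N; intros m n Hm Hn w Hw.
  apply Rle_trans with (2 * (eps / 4) + 2 * (2 * M) * (/ 2) ^ K); [|lra].
  apply (small_coefs_small z0 s ltac:(lra) (fun w => u (phi m) w - u (phi n) w)%C); try lra.
  - intros x Hx; destruct (Hus (phi m) x Hx), (Hus (phi n) x Hx).
    eexists; apply cderiv_minus; eassumption.
  - intros x Hx; eapply Rle_trans; [apply Cmod_triangle_minus|].
    generalize (HMs (phi m) x Hx) (HMs (phi n) x Hx); lra.
  - intros k Hk; rewrite taylor_coef_minus by (lra || apply Hus); now apply HN.
  - unfold s; lra. }
(* Pointwise limits, chosen together with their Cauchy estimates; outside the small disc 0 serves as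
   a default value. *)
destruct (functional_choice (fun w l : C => Cmod (w - z0) < r / 4 -> forall eps N,
  (forall m n, (N <= m)%nat -> (N <= n)%nat -> Cmod (u (phi m) w - u (phi n) w) <= eps) ->
    forall n, (N <= n)%nat -> Cmod (u (phi n) w - l) <= eps)) as [g Hg].
{ intros w; destruct (Rlt_dec (Cmod (w - z0)) (r / 4)) as [Hw | Hw]; [|exists 0; tauto].
  destruct (Ccauchy_cv (fun n => u (phi n) w)) as [l Hl]; [|exists l; intros _; exact Hl].
  intros eps Heps; destruct (UC eps Heps) as [N HN]; exists N; auto. }
assert (CV : forall eps, 0 < eps -> exists N, forall n, (N <= n)%nat ->
      forall w, Cmod (w - z0) < r / 4 -> Cmod (u (phi n) w - g w) <= eps).
{ intros eps Heps; destruct (UC eps Heps) as [N HN].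
  exists N; intros n Hn w Hw; apply (Hg w Hw eps N); auto. }
exists g; split; [|exact CV].
apply (weierstrass (fun n => u (phi n))).
- intros n; apply (holo_disc_le _ z0 r); [lra | apply Hu].
- intros eps Heps; destruct (CV eps Heps) as [N HN]; exists N; auto.
Qed.

(** * Normality criteria *)

Lemma open_disc (z0 : C) (r : R) : @open C_UniformSpace (fun w => Cmod (w - z0) < r).
Proof.
intros z Hz; apply locally_C_iff; exists (r - Cmod (z - z0)); split; [lra|].
intros w Hw; apply (holo_disc_near z0 z w r (r - Cmod (z - z0))); lra.
Qed.

Lemma bounded_or_infinity (v : nat -> R) :
  (exists phi, strict_mono phi /\ exists M, forall n, v (phi n) <= M) \/
  (forall M, exists N, forall n, (N <= n)%nat -> M < v n).
Proof.
destruct (classic (forall M, exists N, forall n, (N <= n)%nat -> M < v n)) as [H | H];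
  [now right | left].
apply not_all_ex_not in H; destruct H as [M H].
destruct (frequently_subsequence (fun _ p => v p <= M)) as [phi [Hphi HM]].
{ intros _ N; apply NNPP; intros Hno; apply H; exists N; intros n Hn.
  apply Rnot_le_lt; intros L; apply Hno; now exists n. }
exists phi; split; [exact Hphi | now exists M].
Qed.

(** Normality at a point asks for a single neighbourhood, so one disc suffices: the bounded case is
    Montel's theorem on a quarter of the radius, and otherwise the sequence itself tends to
    infinity. Convergence is uniform on the whole small disc, hence the trivial neighbourhood
    [fun _ => True] as witness. *)
Lemma Fatou_of_dichotomy (D : C -> Prop) (F : (C -> C) -> Prop) (z0 : C) (r : R) : 0 < r ->
  family_in_H F D -> (forall w, Cmod (w - z0) < r -> D w) ->
  (forall u, (forall n, F (u n)) ->
    (exists phi, strict_mono phi /\ exists M, forall n w,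
       Cmod (w - z0) < r -> Cmod (u (phi n) w) <= M) \/
    (forall M, exists N, forall n, (N <= n)%nat ->
       forall w, Cmod (w - z0) < r -> M < Cmod (u n w))) ->
  Fatou D F z0.
Proof.
intros Hr HF HD H.
assert (H00 : Cmod (z0 - z0) = 0) by apply Cmod_minus_diag.
split; [apply HD; lra|].
exists (fun w => Cmod (w - z0) < r / 4); repeat split.
- apply open_disc.
- lra.
- intros w Hw; apply HD; lra.
- intros u Hu.
  assert (Htriv : forall z : C, @locally C_UniformSpace z (fun _ => True))
    by (intros z; apply filter_true).
  destruct (H u Hu) as [[phi [Hphi [M HM]]] | Hinf].
  + destruct (montel_bounded (fun n => u (phi n)) z0 r M Hr) as [psi [Hpsi [g [Hg HC]]]].
    * intros n w Hw; apply (HF _ (Hu (phi n))), HD, Hw.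
    * intros n w Hw; now apply HM.
    * exists (fun n => phi (psi n)); split; [now apply strict_mono_comp | left].
      exists g; split; [exact Hg|].
      intros z Hz; exists (fun _ => True); split; [apply Htriv|].
      intros eps Heps; destruct (HC (eps / 2) ltac:(lra)) as [N HN].
      exists N; intros n Hn w Hw _; specialize (HN n Hn w Hw); lra.
  + exists (fun n => n); split; [auto | right].
    intros z Hz; exists (fun _ => True); split; [apply Htriv|].
    intros M; destruct (Hinf M) as [N HN].
    exists N; intros n Hn w Hw _; apply HN; [exact Hn | lra].
Qed.

(* When [u n z0] tends to infinity, so does [u n] uniformly near [z0]: Schottky's bound is
   applied at the nearby point, with [z0] in the half-radius disc. *)
Lemma Fatou_of_two_omitted_values (D : C -> Prop) (F : (C -> C) -> Prop) (z0 a b : C) (r : R) :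
  0 < r -> a <> b -> family_in_H F D -> (forall w, Cmod (w - z0) < r -> D w) ->
  (forall f, F f -> forall w, Cmod (w - z0) < r -> f w <> a /\ f w <> b) ->
  Fatou D F z0.
Proof.
intros Hr Hab HF HD Hom.
apply (Fatou_of_dichotomy D F z0 (r / 4)); [lra | exact HF | intros w Hw; apply HD; lra|].
intros u Hu.
assert (Hh : forall n, holo_disc (u n) z0 r)
  by (intros n w Hw; apply (HF _ (Hu n)), HD, Hw).
destruct (bounded_or_infinity (fun n => Cmod (u n z0))) as [[phi [Hphi [M HM]]] | Hinf];
  [left | right].
- exists phi; split; [exact Hphi|].
  destruct (schottky a b M Hab) as [K HK]; exists K; intros n w Hw.
  apply (HK (u (phi n)) z0 r Hr (Hh _)); [apply Hom, Hu | apply HM | lra].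
- intros M; destruct (schottky a b M Hab) as [K HK].
  destruct (Hinf K) as [N HN]; exists N; intros n Hn w Hw.
  apply Rnot_le_lt; intros L; specialize (HN n Hn); cbv beta in HN.
  assert (Cmod (u n z0) <= K); [|lra].
  (* Since [w] is closer than [r / 4] to [z0], the disc of radius [3 / 4 * r] about [w] stays within
     [r] of [z0], and its half radius [3 / 8 * r] still reaches [z0]. *)
  apply (HK (u n) w (3 / 4 * r)); [lra | | | exact L |].
  + apply (holo_disc_sub _ z0 w r); [lra | apply Hh].
  + intros x Hx; apply Hom; [apply Hu|].
    apply (holo_disc_near z0 w x r (3 / 4 * r)); lra.
  + rewrite Cmod_minus_sym; lra.
Qed.

Lemma circle_chord (z0 : C) (r s t : R) : 0 <= r ->
  Cmod (z0 + RtoC r * cis t - (z0 + RtoC r * cis s)) <= r * Rabs (t - s).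
Proof.
intros Hr.
assert (P : forall s t, s <= t ->
  Cmod (z0 + RtoC r * cis t - (z0 + RtoC r * cis s)) <= r * (t - s)).
{ clear s t; intros s t Hst.
  apply (mean_value_ineq (fun t => z0 + RtoC r * cis t)%C
    (fun t => RtoC r * (Ci * cis t))%C); [exact Hst | |]; intros x _.
  - apply rderiv_affine, rderiv_cis.
  - rewrite !Cmod_mult, Cmod_cis, Cmod_Ci, Cmod_R, Rabs_pos_eq by exact Hr; lra. }
destruct (Rle_dec s t) as [L | L].
- rewrite Rabs_pos_eq by lra; now apply P.
- rewrite Cmod_minus_sym, Rabs_minus_sym, Rabs_pos_eq by lra; apply P; lra.
Qed.

(* Schottky's bound is propagated along the circle of radius [r] through discs of radius [r],
   none of which contains the centre. *)
Lemma schottky_chain (a b z0 : C) (r M : R) : 0 < r -> a <> b ->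
  forall n, exists K, forall f,
  (forall w, Cmod (w - z0) < 2 * r -> holo_at f w) ->
  (forall w, Cmod (w - z0) < 2 * r -> w <> z0 -> f w <> a /\ f w <> b) ->
  forall s d, Rabs d <= / 4 -> Cmod (f (z0 + RtoC r * cis s)%C) <= M ->
  Cmod (f (z0 + RtoC r * cis (s + INR n * d))%C) <= K.
Proof.
intros Hr Hab; induction n as [|n [K IH]].
- exists M; intros f _ _ s d _ H; simpl INR; now rewrite Rmult_0_l, Rplus_0_r.
- destruct (schottky a b K Hab) as [K' HK'].
  exists K'; intros f Hf Hom s d Hd H.
  set (p := (z0 + RtoC r * cis (s + INR n * d))%C).
  assert (Hp : Cmod (p - z0) = r) by (apply circle_radius; lra).
  assert (Hin : forall w, Cmod (w - p) < r -> Cmod (w - z0) < 2 * r)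
    by (intros w Hw; apply (holo_disc_near z0 p w (2 * r) r); lra).
  apply (HK' f p r Hr).
  + intros w Hw; apply Hf, Hin, Hw.
  + intros w Hw; apply Hom; [now apply Hin|].
    intros ->; rewrite Cmod_minus_sym in Hw; lra.
  + now apply IH.
  (* An angle of at most 1/4 moves the point by at most [r / 4], inside the half radius of the disc
     about [p]. *)
  + eapply Rle_lt_trans; [apply circle_chord; lra|].
    rewrite S_INR; replace (s + (INR n + 1) * d - (s + INR n * d)) with d by ring; nra.
Qed.

Lemma schottky_circle (a b z0 : C) (r M : R) : 0 < r -> a <> b ->
  exists K, forall f,
  (forall w, Cmod (w - z0) < 2 * r -> holo_at f w) ->
  (forall w, Cmod (w - z0) < 2 * r -> w <> z0 -> f w <> a /\ f w <> b) ->
  forall v w, Cmod (v - z0) = r -> Cmod (w - z0) = r -> Cmod (f v) <= M -> Cmod (f w) <= K.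
Proof.
intros Hr Hab; generalize PI_4; intros HPI.
(* Two angles in [[- PI, PI]] differ by at most [2 * PI <= 8], which 32 steps of at most 1/4
   cover. *)
destruct (schottky_chain a b z0 r M Hr Hab 32) as [K HK].
exists K; intros f Hf Hom v w Hv Hw HM.
destruct (circle_param z0 v r Hr Hv) as [s [Hs ->]].
destruct (circle_param z0 w r Hr Hw) as [t [Ht ->]].
replace t with (s + INR 32 * ((t - s) / 32)) by (simpl; field).
apply HK; [exact Hf | exact Hom | apply Rabs_le; lra | exact HM].
Qed.

Lemma Fatou_of_punctured_omission (D : C -> Prop) (F : (C -> C) -> Prop) (z0 a b : C) (r : R) :
  0 < r -> a <> b -> family_in_H F D -> (forall w, Cmod (w - z0) < 2 * r -> D w) ->
  (forall f, F f -> forall w, Cmod (w - z0) < 2 * r -> w <> z0 -> f w <> a /\ f w <> b) ->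
  Fatou D F z0.
Proof.
intros Hr Hab HF HD Hom.
apply (Fatou_of_dichotomy D F z0 (r / 2)); [lra | exact HF | intros w Hw; apply HD; lra|].
intros u Hu.
assert (Hh : forall n w, Cmod (w - z0) < 2 * r -> holo_at (u n) w)
  by (intros n w Hw; apply (HF _ (Hu n)), HD, Hw).
set (p := (z0 + RtoC r * cis 0)%C).
assert (Hp : Cmod (p - z0) = r) by (apply circle_radius; lra).
destruct (bounded_or_infinity (fun n => Cmod (u n p))) as [[phi [Hphi [M HM]]] | Hinf];
  [left | right].
- exists phi; split; [exact Hphi|].
  destruct (schottky_circle a b z0 r M Hr Hab) as [K HK].
  (* On the half disc the weight [r - Cmod (w - z0)] is at least [r / 2], whence the factor 2. *)
  exists (2 * K); intros n w Hw.
  assert (B : Cmod (u (phi n) w) * (r - Cmod (w - z0)) <= K * r).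
  { apply cauchy_modulus_bound; [lra | intros x Hx; apply Hh; lra|].
    intros x Hx; apply (HK (u (phi n)) (Hh _) (Hom _ (Hu _)) p x Hp Hx), HM. }
  generalize (Cmod_ge_0 (u (phi n) w)); nra.
- intros M.
  set (c0 := Cmod a + Cmod b).
  assert (Hc0 : 0 <= c0) by (generalize (Cmod_ge_0 a) (Cmod_ge_0 b); unfold c0; lra).
  (* If [u n] exceeds [2 * k + c0] on the circle, [u n - c] exceeds [2 * k] there whether [c] is [a]
     or [b]; passing to the half disc costs a factor 2, and [k - c0] is still above [M]. *)
  set (k := Rabs M + c0 + 1).
  assert (Hk : 0 < k) by (generalize (Rabs_pos M); unfold k; lra).
  destruct (schottky_circle a b z0 r (2 * k + c0) Hr Hab) as [K HK].
  destruct (Hinf K) as [N HN]; exists N; intros n Hn w Hw.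
  specialize (HN n Hn); cbv beta in HN.
  assert (Hbig : forall x, Cmod (x - z0) = r -> 2 * k + c0 < Cmod (u n x)).
  { intros x Hx; apply Rnot_le_lt; intros L.
    generalize (HK (u n) (Hh n) (Hom _ (Hu n)) x p Hx Hp L); lra. }
  (* Only the centre could be sent to [a] or [b], and [u n z0] cannot equal both; the value that
     remains omitted may depend on [n], hence the common bound [c0]. *)
  assert (exists c, Cmod c <= c0 /\ forall x, Cmod (x - z0) < 2 * r -> (u n x - c)%C <> 0)
    as [c [Hc Hnc]].
  { assert (forall c, (c = a \/ c = b) -> u n z0 <> c ->
      forall x, Cmod (x - z0) < 2 * r -> (u n x - c)%C <> 0) as Q.
    { intros c Hc Hz x Hx E; apply Ceq_minus in E.
      destruct (Ceq_dec x z0) as [-> | Nx]; [now apply Hz|].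
      destruct (Hom _ (Hu n) x Hx Nx) as [Na Nb]; destruct Hc as [-> | ->]; auto. }
    destruct (Ceq_dec (u n z0) a) as [E | E].
    - exists b; split; [unfold c0; generalize (Cmod_ge_0 a); lra|].
      apply Q; [now right | rewrite E; exact Hab].
    - exists a; split; [unfold c0; generalize (Cmod_ge_0 b); lra|].
      apply Q; [now left | exact E]. }
  assert (B : Cmod (/ (u n w - c)) * (r - Cmod (w - z0)) <= / (2 * k) * r).
  { apply (cauchy_modulus_bound (fun x => / (u n x - c))%C); [lra | |].
    - intros x Hx; destruct (Hh n x ltac:(lra)) as [l Dl]; eexists.
      apply (cderiv_inv (fun x => u n x - c)%C);
      [apply cderiv_minus; [exact Dl | apply cderiv_const] | apply Hnc; lra].
    - intros x Hx; rewrite Cmod_inv by (apply Hnc; lra).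
      apply Rinv_le_contravar; [lra|].
      generalize (Hbig x Hx) (Cmod_triangle_rev (u n x) c); lra. }
  assert (Nw : (u n w - c)%C <> 0) by (apply Hnc; lra).
  rewrite Cmod_inv in B by exact Nw.
  assert (Pw := proj1 (Cmod_gt_0 _) Nw).
  assert (G : k <= Cmod (u n w - c)).
  { assert (I : 0 < / Cmod (u n w - c)) by now apply Rinv_0_lt_compat.
    assert (B2 : / Cmod (u n w - c) <= / k).
    { apply Rmult_le_reg_r with (r / 2); [lra|].
      apply Rle_trans with (/ (2 * k) * r); [|right; field; lra].
      eapply Rle_trans; [|exact B]; apply Rmult_le_compat_l; lra. }
    rewrite <- (Rinv_inv k), <- (Rinv_inv (Cmod (u n w - c))).
    now apply Rinv_le_contravar. }
  generalize (Cmod_triangle_minus (u n w) c) (Rle_abs M); unfold k in G; lra.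
Qed.

(** * The Julia set and the two assertions *)

Lemma normal_at_open (D : C -> Prop) (F : (C -> C) -> Prop) (z : C) :
  normal_at D F z -> exists d, 0 < d /\ forall w, Cmod (w - z) < d -> normal_at D F w.
Proof.
intros [G [HG [Gz [GD GF]]]].
destruct (proj1 (locally_C_iff z G) (HG z Gz)) as [d [Hd H]].
exists d; split; [exact Hd|]; intros w Hw; exists G; auto.
Qed.

(** The complement is taken in the whole plane, so that points outside [D] may serve as omitted
    values; this covers both the dichotomy and the case of two points outside [D]. *)
Lemma Julia_interior_empty (D : C -> Prop) (F : (C -> C) -> Prop) :
  family_in_H F D -> forward_invariant F (Julia D F) ->
  has_two_points (fun z => ~ Julia D F z) -> is_empty (interior_of (Julia D F)).
Proof.
intros HF Hinv [a [b [Ha [Hb Hab]]]] z Hz.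
destruct (proj1 (locally_C_iff z _) Hz) as [d [Hd H]].
assert (Jz : Julia D F z) by (apply H; rewrite Cmod_minus_diag; lra).
apply (proj2 Jz), (Fatou_of_two_omitted_values D F z a b d); auto.
- intros w Hw; apply (H w Hw).
- intros f Hf w Hw; generalize (Hinv f Hf w (H w Hw)); intros J.
  split; intros E; rewrite E in J; auto.
Qed.

(** The Fatou set is open, so a point of it has a neighbour at distance [d / 2] that is also outside
    the Julia set; it provides the second omitted value in the dichotomy. *)
Lemma Fatou_two_points (D : C -> Prop) (F : (C -> C) -> Prop) (z : C) :
  D z -> ~ Julia D F z -> has_two_points (fun z => ~ Julia D F z).
Proof.
intros Dz Jz.
assert (Fz : Fatou D F z) by (apply NNPP; intros N; apply Jz; now split).
destruct (normal_at_open D F z (proj2 Fz)) as [d [Hd H]].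
exists z, (z + RtoC (d / 2))%C; repeat split; [exact Jz | |].
- intros [Dw Nw]; apply Nw; split; [exact Dw | apply H].
  replace (z + RtoC (d / 2) - z)%C with (RtoC (d / 2)) by ring.
  rewrite Cmod_R, Rabs_pos_eq; lra.
- intros E; apply (RtoC_neq_0 (d / 2)); [lra|].
  transitivity (z + RtoC (d / 2) - z)%C; [ring | rewrite <- E; ring].
Qed.

Lemma Julia_closed_in (D : C -> Prop) (F : (C -> C) -> Prop) : closed_in D (Julia D F).
Proof.
exists (fun z => ~ normal_at D F z); split.
- intros z Hz Nz; apply Hz, locally_C_iff.
  destruct (normal_at_open D F z Nz) as [d [Hd H]].
  exists d; split; [exact Hd|]; intros w Hw K; apply K, H, Hw.
- intros z; unfold Julia, Fatou; tauto.
Qed.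

Theorem theorem1p3 :
  forall (D : C -> Prop) (F : (C -> C) -> Prop),
    is_domain D ->
    family_in_H F D ->
    (forward_invariant F (Julia D F) ->
       (same_set (Julia D F) D \/ is_empty (interior_of (Julia D F)))
       /\ (has_two_points (fun z => ~ D z) ->
             is_empty (interior_of (Julia D F))))
    /\
    (has_two_points (Julia D F) ->
     forward_invariant F (Fatou D F) ->
     perfect_in D (Julia D F)).
Proof.
intros D F [_ [HD _]] HF; split.
- intros Hinv; split.
  + destruct (classic (exists z, D z /\ ~ Julia D F z)) as [[z [Dz Jz]] | Hno]; [right | left].
    * apply Julia_interior_empty; [exact HF | exact Hinv|].
      now apply (Fatou_two_points D F z).
    * intros z; split; [now intros [Dz _]|].
      intros Dz; apply NNPP; intros Jz; apply Hno; now exists z.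
  + intros [a [b [Ha [Hb Hab]]]]; apply Julia_interior_empty; [exact HF | exact Hinv|].
    exists a, b; repeat split; try assumption; intros [J _]; auto.
- intros [a [b [Ja [Jb Hab]]]] Hinv; split; [apply Julia_closed_in|].
  intros z [Jz Hiso].
  destruct (proj1 (locally_C_iff z _) Hiso) as [d1 [Hd1 H1]].
  destruct (proj1 (locally_C_iff z D) (HD z (proj1 Jz))) as [d2 [Hd2 H2]].
  set (r := Rmin d1 d2 / 2).
  assert (Hr : 0 < r) by (generalize (Rmin_glb_lt d1 d2 0 Hd1 Hd2); unfold r; lra).
  assert (Hr1 : 2 * r <= d1) by (generalize (Rmin_l d1 d2); unfold r; lra).
  assert (Hr2 : 2 * r <= d2) by (generalize (Rmin_r d1 d2); unfold r; lra).
  assert (HDr : forall w, Cmod (w - z) < 2 * r -> D w) by (intros w Hw; apply H2; lra).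
  apply (proj2 Jz), (Fatou_of_punctured_omission D F z a b r); auto.
  intros f Hf w Hw Hwz.
  (* Isolation makes every other point of the disc a Fatou point, and invariance keeps its image in
     the Fatou set, away from [a] and [b]; one of these may well be [z] itself. *)
  assert (Fw : Fatou D F w).
  { apply NNPP; intros N; apply Hwz, H1; [lra | split; [now apply HDr | exact N]]. }
  generalize (Hinv f Hf w Fw); intros Ffw.
  split; intros E; rewrite E in Ffw; [now apply (proj2 Ja) | now apply (proj2 Jb)].
Qed.
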